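(* Let $X$ be a schematic finite space and $Y$ a finite space. A morphism $f\colon X\to Y$ is schematic if and only if $\mathbb Rf_*$ preserves quasi-coherence (i.e. $R^if_*\mathcal M$ is quasi-coherent for every quasi-coherent $\mathcal O_X$-module $\mathcal M$ and every $i\ge0$).
   Context: All rings are commutative with unit. A ringed finite space is a ringed space $(X,\mathcal O)$ with $X$ a finite topological space; morphisms are morphisms of ringed spaces. For $p\in X$, $U_p$ is the smallest open subset containing $p$; $p\le q$ means $q\in U_p$. The stalk is $\mathcal O_p=\mathcal O(U_p)$, with restriction morphisms $\mathcal O_p\to\mathcal O_q$ for $p\le q$. A finite space is a ringed finite space all of whose restriction morphisms are flat. An $\mathcal O$-module is quasi-coherent if it is locally a cokernel of a morphism between free modules of arbitrary rank. All spaces and morphisms are over a fixed commutative base ring $k$ (i.e. over the one-point ringed space $( *,k)$; $k=\mathbb Z$ imposes no restriction). $X\times Y=X\times_kY$ is the product topological space with $\mathcal O_{(x,y)}=\mathcal O_x\otimes_k\mathcal O_y$. A finite space $X$ is schematic if $R^i\delta_*\mathcal O_X$ is quasi-coherent for all $i\ge0$, where $\delta\colon X\to X\times X$ is the diagonal morphism. A morphism $f\colon X\to Y$ of finite spaces is schematic if $R^i\Gamma_*\mathcal O_X$ is quasi-coherent for all $i\ge0$, where $\Gamma\colon X\to X\times Y$ is the graph of $f$ (the morphism with components $\mathrm{Id}_X$ and $f$). *)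

(* Defs.v *)
From HB Require Import structures.
From mathcomp Require Import all_boot all_order all_algebra.
From mathcomp Require Import generic_quotient.
From mathcomp Require Import boolp classical_sets functions cardinality.

Set Implicit Arguments.
Unset Strict Implicit.
Unset Printing Implicit Defensive.

Import Order.TTheory GRing.Theory.
Local Open Scope ring_scope.
Local Open Scope quotient_scope.

(* [comPzRingType] is used throughout, since the zero ring is allowed:
   it may well occur as a tensor product of nonzero stalks. *)

Definition restr (A B : comPzRingType) (f : {rmorphism A -> B})
  (M : lmodType B) : Type := M.

Section Restr.
Variables (A B : comPzRingType) (f : {rmorphism A -> B}) (M : lmodType B).

HB.instance Definition _ := GRing.Zmodule.on (restr f M).

Let scale (a : A) (m : restr f M) : restr f M := f a *: (m : M).

Fact restr_scaleA a b m : scale a (scale b m) = scale (a * b) m.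
Proof. by rewrite /scale scalerA rmorphM. Qed.
Fact restr_scale1 : left_id 1 scale.
Proof. by move=> m; rewrite /scale rmorph1 scale1r. Qed.
Fact restr_scaleDr : right_distributive scale +%R.
Proof. by move=> a m n; rewrite /scale scalerDr. Qed.
Fact restr_scaleDl m : {morph scale^~ m : a b / a + b}.
Proof. by move=> a b; rewrite /scale rmorphD scalerDl. Qed.

HB.instance Definition _ := GRing.Zmodule_isLmodule.Build A (restr f M)
  restr_scaleA restr_scale1 restr_scaleDr restr_scaleDl.

End Restr.

(* A list of pairs [(m_i, n_i)] stands for the formal sum of the [m_i (x) n_i];
   these are taken modulo the congruence generated by the bilinearity relations
   (opposites are obtained by negating the [m_i]). *)

Section Tensor.
Variables (A : comPzRingType) (M N : lmodType A).

Inductive tens_rel : seq (M * N) -> seq (M * N) -> Prop :=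
| tens_refl s : tens_rel s s
| tens_sym s t : tens_rel s t -> tens_rel t s
| tens_trans s t u : tens_rel s t -> tens_rel t u -> tens_rel s u
| tens_cat s s' t t' :
    tens_rel s s' -> tens_rel t t' -> tens_rel (s ++ t) (s' ++ t')
| tens_comm s t : tens_rel (s ++ t) (t ++ s)
| tens_0l n : tens_rel [:: (0, n)] [::]
| tens_addl m m' n : tens_rel [:: (m + m', n)] [:: (m, n); (m', n)]
| tens_addr m n n' : tens_rel [:: (m, n + n')] [:: (m, n); (m, n')]
| tens_bal a m n : tens_rel [:: (a *: m, n)] [:: (m, a *: n)].

Definition tens_relb (s t : seq (M * N)) : bool := `[< tens_rel s t >].

Fact tens_relb_equiv : equiv_class_of tens_relb.
Proof.
split=> [s|s t|t s u]; first exact/asboolP/tens_refl.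
  by apply/asboolP/asboolP; exact: tens_sym.
by move=> /asboolP st /asboolP tu; exact/asboolP/(tens_trans st tu).
Qed.

Canonical tens_equiv := EquivRelPack tens_relb_equiv.

Definition tensor : Type := {eq_quot tens_relb}.

HB.instance Definition _ := Choice.on tensor.
HB.instance Definition _ := EqQuotient.on tensor.

Lemma eq_tensor s t : tens_rel s t -> \pi_tensor s = \pi_tensor t.
Proof. by move=> st; apply/eqmodP/asboolP. Qed.

Lemma tensor_reprK s : tens_rel (repr (\pi_tensor s)) s.
Proof. by apply/asboolP; have /eqmodP := reprK (\pi_tensor s). Qed.

Lemma tensorW (P : tensor -> Prop) :
  (forall s, P (\pi_tensor s)) -> forall x, P x.
Proof. by move=> Ppi x; rewrite -[x]reprK; exact: Ppi. Qed.

Definition tens_add (x y : tensor) : tensor := \pi_tensor (repr x ++ repr y).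
Definition tens_opp (x : tensor) : tensor :=
  \pi_tensor [seq (- p.1, p.2) | p <- repr x].

Lemma tens_addE s t :
  tens_add (\pi_tensor s) (\pi_tensor t) = \pi_tensor (s ++ t).
Proof. by apply/eq_tensor/tens_cat; exact: tensor_reprK. Qed.

Lemma tens_oppE s :
  tens_opp (\pi_tensor s) = \pi_tensor [seq (- p.1, p.2) | p <- s].
Proof.
apply: eq_tensor; move: (repr _) (tensor_reprK s) => r; elim=> {s r} /=.
- by move=> s; exact: tens_refl.
- by move=> s t _; exact: tens_sym.
- by move=> s t u _ st _; exact: tens_trans.
- by move=> s s' t t' _ hs _ ht; rewrite !map_cat; exact: tens_cat.
- by move=> s t; rewrite !map_cat; exact: tens_comm.
- by move=> n; rewrite oppr0; exact: tens_0l.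
- by move=> m m' n; rewrite opprD; exact: tens_addl.
- by move=> m n n'; exact: tens_addr.
- by move=> a m n; rewrite -scalerN; exact: tens_bal.
Qed.

Fact tens_addA : associative tens_add.
Proof.
elim/tensorW=> s; elim/tensorW=> t; elim/tensorW=> u.
by rewrite !tens_addE catA.
Qed.
Fact tens_addC : commutative tens_add.
Proof.
elim/tensorW=> s; elim/tensorW=> t; rewrite !tens_addE.
exact/eq_tensor/tens_comm.
Qed.
Fact tens_add0 : left_id (\pi_tensor [::]) tens_add.
Proof. by elim/tensorW=> s; rewrite tens_addE. Qed.
Fact tens_addN : left_inverse (\pi_tensor [::]) tens_opp tens_add.
Proof.
elim/tensorW=> s; rewrite tens_oppE tens_addE; apply: eq_tensor.
elim: s => [|[m n] s IHs]; first exact: tens_refl.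
rewrite map_cons cat_cons.
set t := map _ _ in IHs *.
apply: (@tens_trans _ ([:: (- m, n); (m, n)] ++ (t ++ s))).
  rewrite -[_ :: t ++ _]/([:: (- m, n)] ++ (t ++ ([:: (m, n)] ++ s))).
  rewrite -[[:: _; _]]/([:: (- m, n)] ++ [:: (m, n)]) -catA.
  apply: tens_cat; first exact: tens_refl.
  by rewrite !catA; apply: tens_cat; [exact: tens_comm | exact: tens_refl].
rewrite -[[::]]cats0; apply: tens_cat => //.
by apply: (tens_trans (tens_sym (tens_addl _ _ _))); rewrite addNr; exact: tens_0l.
Qed.

HB.instance Definition _ := GRing.isZmodule.Build tensor
  tens_addA tens_addC tens_add0 tens_addN.

Definition pure (m : M) (n : N) : tensor := \pi_tensor [:: (m, n)].

Lemma pureDl m m' n : pure (m + m') n = pure m n + pure m' n.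
Proof. by rewrite [RHS]tens_addE; exact/eq_tensor/tens_addl. Qed.
Lemma pureDr m n n' : pure m (n + n') = pure m n + pure m n'.
Proof. by rewrite [RHS]tens_addE; exact/eq_tensor/tens_addr. Qed.
Lemma pureZ a m n : pure (a *: m) n = pure m (a *: n).
Proof. exact/eq_tensor/tens_bal. Qed.

Lemma tensor_ind (P : tensor -> Prop) :
  P 0 -> (forall m n x, P x -> P (pure m n + x)) -> forall x, P x.
Proof.
move=> P0 PD; elim/tensorW; elim=> [//|[m n] s IHs].
by rewrite -cat1s -tens_addE; exact: PD.
Qed.

Record balanced (V : zmodType) := Balanced {
  bal_fun :> M -> N -> V;
  _ : forall m m' n, bal_fun (m + m') n = bal_fun m n + bal_fun m' n;
  _ : forall m n n', bal_fun m (n + n') = bal_fun m n + bal_fun m n';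
  _ : forall a m n, bal_fun (a *: m) n = bal_fun m (a *: n) }.

Definition tens_lift (V : zmodType) (phi : balanced V) (x : tensor) : V :=
  \sum_(p <- repr x) phi p.1 p.2.

Lemma tens_liftE (V : zmodType) (phi : balanced V) s :
  tens_lift phi (\pi_tensor s) = \sum_(p <- s) phi p.1 p.2.
Proof.
case: phi => phi hl hr hb; rewrite /tens_lift /=.
move: (repr _) (tensor_reprK s) => r; elim=> {s r}.
- by [].
- by move=> s t _ ->.
- by move=> s t u _ -> _ ->.
- by move=> s s' t t' _ hs _ ht; rewrite !big_cat /= hs ht.
- by move=> s t; rewrite !big_cat /= addrC.
- by move=> n; rewrite big_seq1 big_nil /=; apply: (addIr (phi 0 n)); rewrite -hl !add0r.
- by move=> m m' n; rewrite !big_cons big_nil /= hl !addr0.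
- by move=> m n n'; rewrite !big_cons big_nil /= hr !addr0.
- by move=> a m n; rewrite !big_seq1 /= hb.
Qed.

Fact tens_lift_is_additive V phi : zmod_morphism (@tens_lift V phi).
Proof.
suff hD : {morph tens_lift phi : x y / x + y}.
  by move=> x y; apply: (addIr (tens_lift phi y)); rewrite -hD !subrK.
elim/tensorW=> s; elim/tensorW=> t.
by rewrite [_ + _]tens_addE !tens_liftE big_cat.
Qed.
HB.instance Definition _ V phi :=
  GRing.isZmodMorphism.Build tensor V (tens_lift phi) (@tens_lift_is_additive V phi).

Lemma tens_lift_pure V phi m n : @tens_lift V phi (pure m n) = phi m n.
Proof. by rewrite tens_liftE big_seq1. Qed.

End Tensor.

(* [tens_map u] is [id (x) u] *)
Section TensMap.
Variables (A : comPzRingType) (L M N : lmodType A) (u : {linear M -> N}).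

Fact tens_map_addr (l : L) : {morph (fun m => pure l (u m)) : m m' / m + m'}.
Proof. by move=> m m'; rewrite linearD pureDr. Qed.
Fact tens_map_scale a (l : L) m : pure (a *: l) (u m) = pure l (u (a *: m)).
Proof. by rewrite linearZ pureZ. Qed.

Definition tens_map : tensor L M -> tensor L N := 
  tens_lift (Balanced (fun l l' m => pureDl l l' (u m)) tens_map_addr tens_map_scale).

End TensMap.

Definition flat (A B : comPzRingType) (f : {rmorphism A -> B}) : Prop :=
  forall (M N : lmodType A) (u : {linear M -> N}),
    injective u -> injective (@tens_map A (restr f B^o) M N u).

Section AlgTensor.
Variables (k A B : comPzRingType).
Variables (f : {rmorphism k -> A}) (g : {rmorphism k -> B}).

Definition algtens : Type := tensor (restr f A^o) (restr g B^o).

HB.instance Definition _ := GRing.Zmodule.on algtens.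

Definition algpure (a : A) (b : B) : algtens :=
  @pure k (restr f A^o) (restr g B^o) a b.

Lemma algpureDl a a' b : algpure (a + a') b = algpure a b + algpure a' b.
Proof. exact: pureDl. Qed.
Lemma algpureDr a b b' : algpure a (b + b') = algpure a b + algpure a b'.
Proof. exact: pureDr. Qed.
Lemma algpureZ c a b : algpure (f c * a) b = algpure a (g c * b).
Proof. exact: pureZ. Qed.

Lemma algtens_ind (P : algtens -> Prop) :
  P 0 -> (forall a b x, P x -> P (algpure a b + x)) -> forall x, P x.
Proof. move=> P0 PD; apply: (@tensor_ind k (restr f A^o) (restr g B^o)); [exact: P0 | exact: PD]. Qed.

Section Lift.
Variables (V : zmodType) (phi : A -> B -> V).
Hypothesis phiDl : forall a a' b, phi (a + a') b = phi a b + phi a' b.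
Hypothesis phiDr : forall a b b', phi a (b + b') = phi a b + phi a b'.
Hypothesis phiZ : forall c a b, phi (f c * a) b = phi a (g c * b).

Definition alglift (x : algtens) : V :=
  tens_lift (@Balanced k (restr f A^o) (restr g B^o) V phi phiDl phiDr phiZ) x.

Fact alglift_is_additive : zmod_morphism alglift.
Proof. exact: tens_lift_is_additive. Qed.
HB.instance Definition _ :=
  GRing.isZmodMorphism.Build algtens V alglift alglift_is_additive.

Lemma alglift_pure a b : alglift (algpure a b) = phi a b.
Proof. exact: tens_lift_pure. Qed.
End Lift.

(* [puremul a b] is multiplication by the pure tensor of [a] and [b] *)
Section PureMul.
Variables (a : A) (b : B).
Let phi c d := algpure (a * c) (b * d).
Fact puremulDl c c' d : phi (c + c') d = phi c d + phi c' d.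
Proof. by rewrite /phi mulrDr algpureDl. Qed.
Fact puremulDr c d d' : phi c (d + d') = phi c d + phi c d'.
Proof. by rewrite /phi mulrDr algpureDr. Qed.
Fact puremulZ e c d : phi (f e * c) d = phi c (g e * d).
Proof. by rewrite /phi mulrCA algpureZ mulrCA. Qed.
Definition puremul := alglift puremulDl puremulDr puremulZ.
Lemma puremulE c d : puremul (algpure c d) = algpure (a * c) (b * d).
Proof. exact: alglift_pure. Qed.
HB.instance Definition _ := GRing.Additive.on puremul.
End PureMul.

Section Mul.
Variable y : algtens.
Let phi a b := puremul a b y.
Fact algmulDl a a' b : phi (a + a') b = phi a b + phi a' b.
Proof.
rewrite /phi; elim/algtens_ind: y => [|c d x IHx]; first by rewrite !raddf0 addr0.
by rewrite !raddfD /= IHx !puremulE mulrDl algpureDl addrACA.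
Qed.
Fact algmulDr a b b' : phi a (b + b') = phi a b + phi a b'.
Proof.
rewrite /phi; elim/algtens_ind: y => [|c d x IHx]; first by rewrite !raddf0 addr0.
by rewrite !raddfD /= IHx !puremulE mulrDl algpureDr addrACA.
Qed.
Fact algmulZ e a b : phi (f e * a) b = phi a (g e * b).
Proof.
rewrite /phi; elim/algtens_ind: y => [|c d x IHx]; first by rewrite !raddf0.
by rewrite !raddfD /= IHx !puremulE -!mulrA algpureZ.
Qed.
Definition algmul_r := alglift algmulDl algmulDr algmulZ.
HB.instance Definition _ := GRing.Additive.on algmul_r.
End Mul.

Definition algmul (x y : algtens) : algtens := algmul_r y x.

Lemma algmul_pure a b y : algmul (algpure a b) y = puremul a b y.
Proof. exact: alglift_pure. Qed.

Lemma algmul_pure2 a b c d :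
  algmul (algpure a b) (algpure c d) = algpure (a * c) (b * d).
Proof. by rewrite algmul_pure puremulE. Qed.

Fact algmul_Dl : left_distributive algmul +%R.
Proof. by move=> x y z; rewrite /algmul raddfD. Qed.
Fact algmul_0l y : algmul 0 y = 0.
Proof. by rewrite /algmul raddf0. Qed.
Fact algmul_Dr x : {morph algmul x : y z / y + z}.
Proof.
move=> y z; elim/algtens_ind: x => [|a b x IHx]; first by rewrite !algmul_0l addr0.
by rewrite !algmul_Dl !algmul_pure raddfD /= IHx addrACA.
Qed.
Fact algmul_0r x : algmul x 0 = 0.
Proof. by apply: (addIr (algmul x 0)); rewrite -algmul_Dr !add0r. Qed.

Fact algmulC : commutative algmul.
Proof.
move=> x y; elim/algtens_ind: x => [|a b x IHx]; first by rewrite algmul_0l algmul_0r.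
rewrite algmul_Dl algmul_Dr IHx; congr (_ + _).
elim/algtens_ind: y {IHx} => [|c d y IHy]; first by rewrite algmul_0l algmul_0r.
by rewrite algmul_Dl algmul_Dr IHy !algmul_pure2 [c * a]mulrC [d * b]mulrC.
Qed.
Fact algmulA : associative algmul.
Proof.
move=> x y z; elim/algtens_ind: x => [|a b x IHx]; first by rewrite !algmul_0l.
rewrite !algmul_Dl IHx; congr (_ + _).
elim/algtens_ind: y {IHx} => [|c d y IHy]; first by rewrite !(algmul_0l, algmul_0r).
rewrite !(algmul_Dl, algmul_Dr) IHy; congr (_ + _).
elim/algtens_ind: z {IHy} => [|e h z IHz]; first by rewrite !algmul_0r.
by rewrite !algmul_Dr IHz !algmul_pure2 !mulrA.
Qed.
Fact algmul_1l : left_id (algpure 1 1) algmul.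
Proof.
elim/algtens_ind => [|a b x IHx]; first by rewrite algmul_0r.
by rewrite algmul_Dr IHx algmul_pure2 !mul1r.
Qed.

HB.instance Definition _ := GRing.Zmodule_isComPzRing.Build algtens
  algmulA algmulC algmul_1l algmul_Dl.

Lemma algpureM a b c d : algpure a b * algpure c d = algpure (a * c) (b * d).
Proof. exact: algmul_pure2. Qed.

Definition algscal (c : k) : algtens := algpure (f c) 1.

Fact algscal_is_additive : zmod_morphism algscal.
Proof.
move=> c d; apply: (addIr (algscal d)); rewrite subrK.
by rewrite /algscal -algpureDl -rmorphD subrK.
Qed.
Fact algscal_is_multiplicative : monoid_morphism algscal.
Proof.
by split=> [|c d]; rewrite /algscal ?rmorph1 // rmorphM algpureM mulr1.
Qed.
HB.instance Definition _ :=
  GRing.isZmodMorphism.Build k algtens algscal algscal_is_additive.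
HB.instance Definition _ :=
  GRing.isMonoidMorphism.Build k algtens algscal algscal_is_multiplicative.

(* the ring map [A (x)_k B -> C] with components [u] and [v] *)
Section Copair.
Variables (C : comPzRingType) (u : {rmorphism A -> C}) (v : {rmorphism B -> C}).
Hypothesis uv : forall c, u (f c) = v (g c).
Let phi a b := u a * v b.
Fact copairDl a a' b : phi (a + a') b = phi a b + phi a' b.
Proof. by rewrite /phi rmorphD mulrDl. Qed.
Fact copairDr a b b' : phi a (b + b') = phi a b + phi a b'.
Proof. by rewrite /phi rmorphD mulrDr. Qed.
Fact copairZ c a b : phi (f c * a) b = phi a (g c * b).
Proof. by rewrite /phi !rmorphM uv mulrCA mulrA. Qed.
Definition copair : algtens -> C := alglift copairDl copairDr copairZ.
HB.instance Definition _ := GRing.Additive.on copair.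

Lemma copair_pure a b : copair (algpure a b) = u a * v b.
Proof. exact: alglift_pure. Qed.

Fact copair_is_multiplicative : monoid_morphism copair.
Proof.
split=> [|x y]; first by rewrite copair_pure !rmorph1 mulr1.
elim/algtens_ind: x => [|a b x IHx]; first by rewrite !(mul0r, raddf0).
rewrite mulrDl !raddfD /= IHx mulrDl; congr (_ + _).
elim/algtens_ind: y {IHx} => [|c d y IHy]; first by rewrite !(mulr0, raddf0).
by rewrite mulrDr !raddfD /= IHy mulrDr algpureM !copair_pure !rmorphM mulrACA.
Qed.
HB.instance Definition _ :=
  GRing.isMonoidMorphism.Build algtens C copair copair_is_multiplicative.
End Copair.

Definition tens_inl (a : A) : algtens := algpure a 1.
Definition tens_inr (b : B) : algtens := algpure 1 b.

Fact tens_inl_is_additive : zmod_morphism tens_inl.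
Proof. by move=> a a'; apply: (addIr (tens_inl a')); rewrite -algpureDl !subrK. Qed.
Fact tens_inr_is_additive : zmod_morphism tens_inr.
Proof. by move=> b b'; apply: (addIr (tens_inr b')); rewrite -algpureDr !subrK. Qed.
Fact tens_inl_is_multiplicative : monoid_morphism tens_inl.
Proof. by split=> // a a'; rewrite [RHS]algpureM mulr1. Qed.
Fact tens_inr_is_multiplicative : monoid_morphism tens_inr.
Proof. by split=> // b b'; rewrite [RHS]algpureM mulr1. Qed.
HB.instance Definition _ :=
  GRing.isZmodMorphism.Build A algtens tens_inl tens_inl_is_additive.
HB.instance Definition _ :=
  GRing.isMonoidMorphism.Build A algtens tens_inl tens_inl_is_multiplicative.
HB.instance Definition _ :=
  GRing.isZmodMorphism.Build B algtens tens_inr tens_inr_is_additive.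
HB.instance Definition _ :=
  GRing.isMonoidMorphism.Build B algtens tens_inr tens_inr_is_multiplicative.

Lemma tens_inlr a b : tens_inl a * tens_inr b = algpure a b.
Proof. by rewrite [LHS]algpureM mulr1 mul1r. Qed.

Lemma tens_inlk c : tens_inl (f c) = tens_inr (g c).
Proof. by have := algpureZ c 1 1; rewrite !mulr1. Qed.

End AlgTensor.

(* A finite topological space is given by its specialization preorder:
   [x <= y] iff [y] lies in the smallest open subset [U_x] containing [x].
   Open subsets are the subsets closed upwards, [U_x = [set y | x <= y]], and a
   sheaf is the same as the functor of its stalks [F_x = F(U_x)], the sections
   over an open [U] being the families [(s_x)_(x in U)] compatible with the
   restriction morphisms [F_x -> F_y], [x <= y]. *)

Record rspace (k : comPzRingType) := RSpace {
  rs_disp : Order.disp_t;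
  rs_points :> finPreorderType rs_disp;
  stalk : rs_points -> comPzRingType;
  rres : forall x y, (x <= y)%O -> {rmorphism stalk x -> stalk y};
  rres_id : forall x (h : (x <= x)%O) a, rres h a = a;
  rres_comp : forall x y z (h : (x <= y)%O) (h' : (y <= z)%O) (h'' : (x <= z)%O) a,
    rres h' (rres h a) = rres h'' a;
  (* the structure morphism to the one-point ringed space with ring [k] *)
  kmap : forall x, {rmorphism k -> stalk x};
  kmap_res : forall x y (h : (x <= y)%O) c, rres h (kmap x c) = kmap y c }.

Arguments stalk {k X} x : rename.
Arguments rres {k X x y} h : rename.
Arguments kmap {k X} x : rename.

Definition finite_space (k : comPzRingType) (X : rspace k) : Prop :=
  forall (x y : X) (h : (x <= y)%O), flat (rres h).

(* A morphism [O_Y -> f_* O_X] amounts, by adjunction, to compatible ring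
   morphisms [O_(f x) -> O_x]. *)
Record rmor (k : comPzRingType) (X Y : rspace k) := RMor {
  rm_fun :> X -> Y;
  rm_le : forall x y : X, (x <= y)%O -> (rm_fun x <= rm_fun y)%O;
  rm_sharp : forall x, {rmorphism stalk (rm_fun x) -> stalk x};
  rm_res : forall (x y : X) (h : (x <= y)%O) a,
    rm_sharp y (rres (rm_le h) a) = rres h (rm_sharp x a);
  rm_kmap : forall x c, rm_sharp x (kmap (rm_fun x) c) = kmap x c }.

Definition rid (k : comPzRingType) (X : rspace k) : rmor X X :=
  @RMor k X X id (fun x y h => h) (fun x => idfun)
    (fun x y h a => erefl) (fun x c => erefl).

(* In the product preorder [U_(x, y) = U_x x U_y], so this is the product
   topology; the stalk at [(x, y)] is [O_x (x)_k O_y]. *)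
Section Product.
Variables (k : comPzRingType) (X Y : rspace k).

Definition prod_points : finPreorderType _ := (X *p Y)%type.
Definition prod_stalk (p : prod_points) : comPzRingType :=
  algtens (kmap p.1) (kmap p.2).

Lemma prod_le1 (p q : prod_points) : (p <= q)%O -> (p.1 <= q.1)%O.
Proof. by move=> /andP[]. Qed.
Lemma prod_le2 (p q : prod_points) : (p <= q)%O -> (p.2 <= q.2)%O.
Proof. by move=> /andP[]. Qed.

Fact prod_res_compat (p q : prod_points) (h : (p <= q)%O) c :
  (tens_inl (kmap q.1) (kmap q.2) \o rres (prod_le1 h)) (kmap p.1 c) =
  (tens_inr (kmap q.1) (kmap q.2) \o rres (prod_le2 h)) (kmap p.2 c).
Proof. by rewrite /= !kmap_res tens_inlk. Qed.

Definition prod_res (p q : prod_points) (h : (p <= q)%O) :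
  {rmorphism prod_stalk p -> prod_stalk q} := copair (prod_res_compat h).

Lemma prod_res_pure (p q : prod_points) (h : (p <= q)%O) a b :
  prod_res h (algpure _ _ a b) =
  algpure _ _ (rres (prod_le1 h) a) (rres (prod_le2 h) b).
Proof. by rewrite [LHS]copair_pure tens_inlr. Qed.

Fact prod_res_id p (h : (p <= p)%O) a : prod_res h a = a.
Proof.
elim/algtens_ind: a => [|a b x IHx]; first by rewrite raddf0.
by rewrite raddfD /= IHx prod_res_pure !rres_id.
Qed.
Fact prod_res_comp p q r (h : (p <= q)%O) (h' : (q <= r)%O) (h'' : (p <= r)%O) a :
  prod_res h' (prod_res h a) = prod_res h'' a.
Proof.
elim/algtens_ind: a => [|a b x IHx]; first by rewrite !raddf0.
rewrite !raddfD /= IHx !prod_res_pure; congr (algpure _ _ _ _ + _).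
  exact: rres_comp.
exact: rres_comp.
Qed.

Definition prod_kmap (p : prod_points) : {rmorphism k -> prod_stalk p} :=
  algscal (kmap p.1) (kmap p.2).

Fact prod_kmap_res p q (h : (p <= q)%O) c : prod_res h (prod_kmap p c) = prod_kmap q c.
Proof. by rewrite [LHS]prod_res_pure rmorph1 kmap_res. Qed.

Definition rprod : rspace k := RSpace prod_res_id prod_res_comp prod_kmap_res.

End Product.

(* [rpair f g] is the morphism to [X x Y] with components [f] and [g]. *)
Section Pairing.
Variables (k : comPzRingType) (Z X Y : rspace k) (f : rmor Z X) (g : rmor Z Y).

Definition pair_fun (z : Z) : rprod X Y := (f z, g z).

Fact pair_le x y : (x <= y)%O -> (pair_fun x <= pair_fun y)%O.
Proof. by move=> h; apply/andP; split; exact: rm_le. Qed.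

Fact pair_compat z c : rm_sharp f z (kmap (f z) c) = rm_sharp g z (kmap (g z) c).
Proof. by rewrite !rm_kmap. Qed.

Definition pair_sharp z : {rmorphism stalk (pair_fun z) -> stalk z} :=
  copair (pair_compat z).

Fact pair_res x y (h : (x <= y)%O) a :
  pair_sharp y (rres (pair_le h) a) = rres h (pair_sharp x a).
Proof.
elim/algtens_ind: a => [|a b t IHt]; first by rewrite !raddf0.
rewrite !raddfD /= IHt; congr (_ + _).
rewrite [rres (pair_le h) _]prod_res_pure [LHS]copair_pure [in RHS]copair_pure /= rmorphM.
rewrite -!rm_res; congr (_ * _).
  by congr (rm_sharp f y (rres _ a)); exact: bool_irrelevance.
by congr (rm_sharp g y (rres _ b)); exact: bool_irrelevance.
Qed.

Fact pair_kmap z c : pair_sharp z (kmap (pair_fun z) c) = kmap z c.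
Proof. by rewrite [LHS]copair_pure rmorph1 mulr1 rm_kmap. Qed.

Definition rpair : rmor Z (rprod X Y) := RMor pair_res pair_kmap.
End Pairing.

Definition diagonal (k : comPzRingType) (X : rspace k) : rmor X (rprod X X) :=
  rpair (rid X) (rid X).

Definition graph (k : comPzRingType) (X Y : rspace k) (f : rmor X Y) :
  rmor X (rprod X Y) := rpair (rid X) f.

Section Modules.
Variables (k : comPzRingType) (X : rspace k).

Record omod := OMod {
  mstalk :> forall x : X, lmodType (stalk x);
  mres : forall (x y : X) (h : (x <= y)%O),
    {linear mstalk x -> mstalk y | rres h \; *:%R};
  mres_id : forall x (h : (x <= x)%O) m, mres h m = m;
  mres_comp : forall x y z (h : (x <= y)%O) (h' : (y <= z)%O) (h'' : (x <= z)%O) m,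
    mres h' (mres h m) = mres h'' m }.

Definition struct_res (x y : X) (h : (x <= y)%O) : (stalk x)^o -> (stalk y)^o := rres h.
Fact struct_res_linear x y (h : (x <= y)%O) :
  linear_for (rres h \; *:%R) (struct_res h).
Proof. by move=> a m n; rewrite /struct_res rmorphD rmorphM. Qed.
HB.instance Definition _ x y h :=
  GRing.isLinear.Build _ _ _ (rres h \; *:%R) (struct_res h) (@struct_res_linear x y h).
Definition struct_mod : omod :=
  @OMod (fun x => (stalk x)^o) (fun x y h => struct_res h)
    (@rres_id k X) (@rres_comp k X).

Record ohom (M N : omod) := OHom {
  oh_fun :> forall x, {linear M x -> N x};
  oh_res : forall x y (h : (x <= y)%O) m,
    oh_fun y (mres M h m) = mres N h (oh_fun x m) }.

Definition omod_iso (M N : omod) : Prop :=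
  exists u : ohom M N, forall x, bijective (u x).

Definition ohom0 (M N : omod) : ohom M N :=
  @OHom M N (fun x => \0) (fun x y h m => esym (linear0 (mres N h))).

End Modules.

Section Free.
Variables (I : Type) (A : comPzRingType).

Definition fin_supp : {pred I -> A^o} :=
  fun s => `[< finite_set [set i | s i != 0]%classic >].

Fact fin_supp_submod : subsemimod_closed fin_supp.
Proof.
split; [split|].
- apply/asboolP; apply: (sub_finite_set _ (finite_set0 I)).
  by move=> i /=; rewrite eqxx.
- move=> s t /asboolP fs /asboolP ft; apply/asboolP.
  have fst : finite_set ([set i | s i != 0] `|` [set i | t i != 0])%classic.
    by rewrite finite_setU.
  apply: sub_finite_set fst => i /=; rewrite [(s + t) i]/(s i + t i) => st.
  have [si|] := eqVneq (s i) 0; [right | by left].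
  by move: st; rewrite si -[t i in X in _ -> X]add0r.
- move=> a s /asboolP fs; apply/asboolP; apply: sub_finite_set fs => i /=.
  apply: contra_neq => si.
  exact: etrans (congr1 (fun b : A^o => a *: b) si) (scaler0 _ a).
Qed.
HB.instance Definition _ :=
  GRing.isSubSemiModClosed.Build A (I -> A^o) fin_supp fin_supp_submod.

Record free_mod : Type := FreeMod {
  free_fun :> I -> A^o; free_supp : fin_supp free_fun }.

HB.instance Definition _ := [isSub for free_fun].
HB.instance Definition _ := [Choice of free_mod by <:].
HB.instance Definition _ := [SubChoice_isSubLmodule of free_mod by <:].

End Free.

Section FreeSheaf.
Variables (k : comPzRingType) (X : rspace k) (I : Type).

Section Res.
Variables (x y : X) (h : (x <= y)%O).

Fact free_res_supp (s : free_mod I (stalk x)) :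
  fin_supp (fun i => rres h (s i) : (stalk y)^o).
Proof.
case: s => s /= /asboolP fs; apply/asboolP; apply: sub_finite_set fs => i /=.
by apply: contra_neq => ->; rewrite rmorph0.
Qed.

Definition free_res (s : free_mod I (stalk x)) : free_mod I (stalk y) :=
  FreeMod (free_res_supp s).

Fact free_res_linear : linear_for (rres h \; *:%R) free_res.
Proof.
move=> a s t; apply/val_inj/funext => i /=.
exact: (etrans (rmorphD _ _ _) (congr1 (+%R^~ _) (rmorphM _ _ _))).
Qed.
HB.instance Definition _ := GRing.isLinear.Build _ _ _ (rres h \; *:%R)
  free_res free_res_linear.
End Res.

Fact free_res_id x (h : (x <= x)%O) s : free_res h s = s.
Proof. by apply/val_inj/funext => i; exact: rres_id. Qed.
Fact free_res_comp x y z (h : (x <= y)%O) (h' : (y <= z)%O) (h'' : (x <= z)%O) s :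
  free_res h' (free_res h s) = free_res h'' s.
Proof. by apply/val_inj/funext => i; exact: rres_comp. Qed.

Definition free_sheaf : omod X := @OMod k X (fun x => free_mod I (stalk x))
  (fun x y h => free_res h) free_res_id free_res_comp.
End FreeSheaf.

Section QuasiCoherent.
Variables (k : comPzRingType) (X : rspace k).

Definition is_open (U : {set X}) : Prop :=
  forall x y : X, (x <= y)%O -> x \in U -> y \in U.

(* [phi] restricts to a morphism of [O_U]-modules from [M|U] to [N|U]. The
   values of [phi] outside [U] are irrelevant: they may be taken to be zero. *)
Definition hom_on (U : {set X}) (M N : omod X)
    (phi : forall x, {linear M x -> N x}) : Prop :=
  forall x y (h : (x <= y)%O) m, x \in U -> y \in U ->
    phi y (mres M h m) = mres N h (phi x m).

(* [M|U] is the cokernel of a morphism [phi] between free [O_U]-modules *)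
Definition presented_on (U : {set X}) (M : omod X) : Prop :=
  exists (I J : Type)
    (phi : forall x, {linear free_sheaf X I x -> free_sheaf X J x})
    (psi : forall x, {linear free_sheaf X J x -> M x}),
    [/\ hom_on U phi, hom_on U psi &
      forall x, x \in U ->
        (forall m, exists s, psi x s = m) /\
        (forall s, psi x s = 0 <-> exists t, phi x t = s)].

Definition quasi_coherent (M : omod X) : Prop :=
  forall x : X, exists U : {set X},
    [/\ is_open U, x \in U & presented_on U M].

End QuasiCoherent.

Section Direct.
Variables (k : comPzRingType) (X Y : rspace k) (f : rmor X Y).

Section Stalk.
Variables (M : omod X) (y : Y).

(* Sections of [M] over the open subset [f^-1(U_y)]: this is [(f_* M)_y]. *)
Record dsec : Type := DSec {
  ds_fun :> forall x, (y <= f x)%O -> M x;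
  ds_res : forall (x x' : X) (h : (x <= x')%O) (hx : (y <= f x)%O)
    (hx' : (y <= f x')%O), mres M h (ds_fun hx) = ds_fun hx' }.

Arguments ds_fun : clear implicits.

HB.instance Definition _ := gen_eqMixin dsec.
HB.instance Definition _ := gen_choiceMixin dsec.

Lemma dsecP (s t : dsec) : (forall x hx, s x hx = t x hx) -> s = t.
Proof.
case: s t => [s sP] [t tP] /= st; have e : s = t.
  by apply: functional_extensionality_dep => x; apply/funext => hx.
by case: _ / e in tP {st} *; congr DSec; exact: Prop_irrelevance.
Qed.

Program Definition ds0 := @DSec (fun x _ => 0) _.
Next Obligation. exact: linear0. Qed.
Program Definition ds_opp (s : dsec) := @DSec (fun x hx => - s x hx) _.
Next Obligation. by rewrite linearN (ds_res s h _ hx'). Qed.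
Program Definition ds_add (s t : dsec) := @DSec (fun x hx => s x hx + t x hx) _.
Next Obligation. by rewrite linearD (ds_res s h _ hx') (ds_res t h _ hx'). Qed.

Fact ds_addA : associative ds_add.
Proof. by move=> s t u; apply: dsecP => x hx; exact: addrA. Qed.
Fact ds_addC : commutative ds_add.
Proof. by move=> s t; apply: dsecP => x hx; exact: addrC. Qed.
Fact ds_add0 : left_id ds0 ds_add.
Proof. by move=> s; apply: dsecP => x hx; exact: add0r. Qed.
Fact ds_addN : left_inverse ds0 ds_opp ds_add.
Proof. by move=> s; apply: dsecP => x hx; exact: addNr. Qed.
HB.instance Definition _ := GRing.isZmodule.Build dsec
  ds_addA ds_addC ds_add0 ds_addN.

(* [O_y] acts on [M_x], [y <= f x], through [O_y -> O_(f x) -> O_x]. *)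
Program Definition ds_scale (a : stalk y) (s : dsec) :=
  @DSec (fun x hx => rm_sharp f x (rres hx a) *: s x hx) _.
Next Obligation.
rewrite linearZ /= (ds_res s h _ hx') -rm_res.
by rewrite (rres_comp _ _ hx').
Qed.

Fact ds_scaleA a b s : ds_scale a (ds_scale b s) = ds_scale (a * b) s.
Proof. by apply: dsecP => x hx; rewrite /= scalerA !rmorphM. Qed.
Fact ds_scale1 : left_id 1 ds_scale.
Proof. by move=> s; apply: dsecP => x hx; rewrite /= !rmorph1 scale1r. Qed.
Fact ds_scaleDr : right_distributive ds_scale +%R.
Proof. by move=> a s t; apply: dsecP => x hx; exact: scalerDr. Qed.
Fact ds_scaleDl s : {morph ds_scale^~ s : a b / a + b}.
Proof. by move=> a b; apply: dsecP => x hx; rewrite /= !rmorphD; exact: scalerDl. Qed.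
HB.instance Definition _ := GRing.Zmodule_isLmodule.Build (stalk y) dsec
  ds_scaleA ds_scale1 ds_scaleDr ds_scaleDl.
End Stalk.
Arguments ds_fun {M y} s x hx : rename.

Section DirectRes.
Variables (M : omod X) (y z : Y) (h : (y <= z)%O).
Program Definition dres (s : dsec M y) : dsec M z :=
  @DSec M z (fun x hx => s x (le_trans h hx)) _.
Next Obligation. exact: ds_res. Qed.
Fact dres_linear : linear_for (rres h \; *:%R) dres.
Proof.
move=> a s t; apply: dsecP => x hx /=; congr (rm_sharp f x _ *: _ + _).
by rewrite (rres_comp _ _ (le_trans h hx)).
Qed.
HB.instance Definition _ := GRing.isLinear.Build _ _ _ (rres h \; *:%R)
  dres dres_linear.
End DirectRes.

Fact dres_id (M : omod X) y (h : (y <= y)%O) (s : dsec M y) : dres h s = s.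
Proof. by apply: dsecP => x hx /=; congr (ds_fun s _); exact: bool_irrelevance. Qed.
Fact dres_comp (M : omod X) x y z (h : (x <= y)%O) (h' : (y <= z)%O)
  (h'' : (x <= z)%O) (s : dsec M x) : dres h' (dres h s) = dres h'' s.
Proof. by apply: dsecP => t ht /=; congr (ds_fun s _); exact: bool_irrelevance. Qed.

Definition direct_image (M : omod X) : omod Y :=
  @OMod k Y (fun y => dsec M y) (fun y z h => @dres M y z h) (@dres_id M) (@dres_comp M).

Section DirectHom.
Variables (M N : omod X) (u : ohom M N).
Section At.
Variable y : Y.
Program Definition dhom (s : dsec M y) : dsec N y :=
  @DSec N y (fun x hx => u x (s x hx)) _.
Next Obligation. by rewrite -oh_res (ds_res s h _ hx'). Qed.
Fact dhom_linear : linear dhom.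
Proof. by move=> a s t; apply: dsecP => x hx; exact: linearP. Qed.
HB.instance Definition _ := GRing.isLinear.Build _ _ _ _ dhom dhom_linear.
End At.
Fact dhom_res y z (h : (y <= z)%O) s : dhom (dres h s) = dres h (dhom s).
Proof. exact: dsecP. Qed.
Definition direct_hom : ohom (direct_image M) (direct_image N) :=
  @OHom k Y (direct_image M) (direct_image N) (fun y => dhom (y := y)) dhom_res.
End DirectHom.
End Direct.

(* [coh u v] is [Ker v / (Im u :&: Ker v)]; it is only used when [v \o u = 0]. *)

Section Cohomology.
Variables (A : comPzRingType) (L M N : lmodType A).
Variables (u : {linear L -> M}) (v : {linear M -> N}).

Definition is_cycle : {pred M} := fun m => v m == 0.

Fact is_cycle_submod : subsemimod_closed is_cycle.
Proof.
rewrite /is_cycle; split; [split|].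
- by rewrite unfold_in linear0.
- by move=> m n; rewrite !unfold_in linearD => /eqP-> /eqP->; rewrite addr0.
- by move=> a m; rewrite !unfold_in linearZ /= => /eqP->; rewrite scaler0.
Qed.
HB.instance Definition _ :=
  GRing.isSubSemiModClosed.Build A M is_cycle is_cycle_submod.

Record cycles : Type := Cycle { cycle_val :> M; cycleP : is_cycle cycle_val }.
HB.instance Definition _ := [isSub for cycle_val].
HB.instance Definition _ := [Choice of cycles by <:].
HB.instance Definition _ := [SubChoice_isSubLmodule of cycles by <:].

Definition cohomologous (z w : cycles) : bool :=
  `[< exists l, u l = val z - val w >].

Fact cohomologous_equiv : equiv_class_of cohomologous.
Proof.
split=> [z|z w|w z t].
- by apply/asboolP; exists 0; rewrite linear0 subrr.
- by apply/asboolP/asboolP => -[l hl]; exists (- l); rewrite linearN hl opprB.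
- move=> /asboolP[l hl] /asboolP[l' hl']; apply/asboolP; exists (l + l').
  by rewrite linearD hl hl' addrA subrK.
Qed.
Canonical cohomologous_equivRel := EquivRelPack cohomologous_equiv.

Definition coh : Type := {eq_quot cohomologous}.
HB.instance Definition _ := Choice.on coh.
HB.instance Definition _ := EqQuotient.on coh.

Lemma cohE (z w : cycles) :
  \pi_coh z = \pi_coh w <-> exists l, u l = val z - val w.
Proof.
split=> [/eqmodP/asboolP //|e]; exact/eqmodP/asboolP.
Qed.
Lemma cohW (P : coh -> Prop) : (forall z, P (\pi_coh z)) -> forall x, P x.
Proof. by move=> Ppi x; rewrite -[x]reprK; exact: Ppi. Qed.
Lemma coh_reprK z : exists l, u l = val (repr (\pi_coh z)) - val z.
Proof. by apply/cohE; rewrite reprK. Qed.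

Definition coh_opp (x : coh) := \pi_coh (- repr x).
Definition coh_add (x y : coh) := \pi_coh (repr x + repr y).
Definition coh_scale a (x : coh) := \pi_coh (a *: repr x).

Lemma coh_oppE z : coh_opp (\pi_coh z) = \pi_coh (- z).
Proof.
have [l hl] := coh_reprK z; apply/cohE; exists (- l).
by rewrite linearN hl; exact: opprD.
Qed.
Lemma coh_addE z w : coh_add (\pi_coh z) (\pi_coh w) = \pi_coh (z + w).
Proof.
have [l hl] := coh_reprK z; have [l' hl'] := coh_reprK w.
apply/cohE; exists (l + l').
rewrite linearD hl hl' addrACA -opprD; exact: erefl.
Qed.
Lemma coh_scaleE a z : coh_scale a (\pi_coh z) = \pi_coh (a *: z).
Proof.
have [l hl] := coh_reprK z; apply/cohE; exists (a *: l).
by rewrite linearZ /= hl scalerBr.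
Qed.

Fact coh_addA : associative coh_add.
Proof.
by elim/cohW=> x; elim/cohW=> y; elim/cohW=> z; rewrite !coh_addE addrA.
Qed.
Fact coh_addC : commutative coh_add.
Proof. by elim/cohW=> x; elim/cohW=> y; rewrite !coh_addE addrC. Qed.
Fact coh_add0 : left_id (\pi_coh 0) coh_add.
Proof. by elim/cohW=> x; rewrite coh_addE add0r. Qed.
Fact coh_addN : left_inverse (\pi_coh 0) coh_opp coh_add.
Proof. by elim/cohW=> x; rewrite coh_oppE coh_addE addNr. Qed.
HB.instance Definition _ := GRing.isZmodule.Build coh
  coh_addA coh_addC coh_add0 coh_addN.

Lemma coh_piD z w : \pi_coh (z + w) = \pi_coh z + \pi_coh w.
Proof. by rewrite [RHS]coh_addE. Qed.

Fact coh_scaleA a b x : coh_scale a (coh_scale b x) = coh_scale (a * b) x.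
Proof. by elim/cohW: x => x; rewrite !coh_scaleE scalerA. Qed.
Fact coh_scale1 : left_id 1 coh_scale.
Proof. by elim/cohW=> x; rewrite coh_scaleE scale1r. Qed.
Fact coh_scaleDr : right_distributive coh_scale +%R.
Proof.
move=> a; elim/cohW=> x; elim/cohW=> y.
by rewrite -coh_piD !coh_scaleE scalerDr coh_piD.
Qed.
Fact coh_scaleDl x : {morph coh_scale^~ x : a b / a + b}.
Proof.
by move=> a b; elim/cohW: x => x; rewrite !coh_scaleE scalerDl coh_piD.
Qed.
HB.instance Definition _ := GRing.Zmodule_isLmodule.Build A coh
  coh_scaleA coh_scale1 coh_scaleDr coh_scaleDl.

Lemma coh_piZ a z : \pi_coh (a *: z) = a *: \pi_coh z.
Proof. by rewrite [RHS]coh_scaleE. Qed.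

End Cohomology.

Section CohomologySheaf.
Variables (k : comPzRingType) (X : rspace k) (L M N : omod X).
Variables (u : ohom L M) (v : ohom M N).

Section Res.
Variables (x y : X) (h : (x <= y)%O).

Fact cycle_res_cycle (z : cycles (v x)) : is_cycle (v y) (mres M h (val z)).
Proof.
by case: z => z /= /eqP vz; rewrite /is_cycle oh_res vz linear0.
Qed.
Definition cycle_res (z : cycles (v x)) : cycles (v y) := Cycle (cycle_res_cycle z).

Definition coh_res (c : coh (u x) (v x)) : coh (u y) (v y) :=
  \pi_(coh (u y) (v y)) (cycle_res (repr c)).

Lemma coh_resE z : coh_res (\pi_(coh (u x) (v x)) z) =
  \pi_(coh (u y) (v y)) (cycle_res z).
Proof.
have [l hl] := coh_reprK (u x) z; apply/cohE; exists (mres L h l).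
by rewrite oh_res hl linearB.
Qed.

Fact coh_res_linear : linear_for (rres h \; *:%R) coh_res.
Proof.
move=> a; elim/cohW=> z; elim/cohW=> w.
rewrite -coh_piZ -coh_piD !coh_resE /= -coh_piZ -coh_piD.
by congr (\pi_(coh _ _) _); apply: val_inj; rewrite /= linearD linearZ.
Qed.
HB.instance Definition _ := GRing.isLinear.Build _ _ _ (rres h \; *:%R)
  coh_res coh_res_linear.
End Res.

Fact coh_res_id x (h : (x <= x)%O) c : coh_res h c = c.
Proof.
elim/cohW: c => z; rewrite coh_resE; congr (\pi_(coh _ _) _).
by apply: val_inj; exact: mres_id.
Qed.
Fact coh_res_comp x y z (h : (x <= y)%O) (h' : (y <= z)%O) (h'' : (x <= z)%O) c :
  coh_res h' (coh_res h c) = coh_res h'' c.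
Proof.
elim/cohW: c => t; rewrite !coh_resE; congr (\pi_(coh _ _) _).
by apply: val_inj; exact: mres_comp.
Qed.

Definition cohomology_sheaf : omod X :=
  @OMod k X (fun x => coh (u x) (v x)) coh_res coh_res_id coh_res_comp.

End CohomologySheaf.

Section Injective.
Variables (k : comPzRingType) (X : rspace k).

(* Monomorphisms are the stalkwise injective morphisms. *)
Definition injective_omod (E : omod X) : Prop :=
  forall (M N : omod X) (i : ohom M N) (u : ohom M E),
    (forall x, injective (i x)) ->
    exists w : ohom N E, forall x m, w x (i x m) = u x m.

Record inj_resolution (M : omod X) := InjResolution {
  ir_mod :> nat -> omod X;
  ir_d : forall n, ohom (ir_mod n) (ir_mod n.+1);
  ir_aug : ohom M (ir_mod 0);
  ir_inj : forall n, injective_omod (ir_mod n);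
  ir_aug_inj : forall x, injective (ir_aug x);
  ir_exact0 : forall x e, ir_d 0 x e = 0 <-> exists m, ir_aug x m = e;
  ir_exact : forall n x e, ir_d n.+1 x e = 0 <-> exists e', ir_d n x e' = e }.

End Injective.

Section Derived.
Variables (k : comPzRingType) (X Y : rspace k) (f : rmor X Y) (M : omod X).

(* [H^i(f_* E)] for an injective resolution [E] of [M] *)
Definition Rdirect_along (E : inj_resolution M) (i : nat) : omod Y :=
  match i with
  | 0 => cohomology_sheaf (ohom0 (direct_image f (E 0)) (direct_image f (E 0)))
           (direct_hom f (ir_d E 0))
  | i.+1 => cohomology_sheaf (direct_hom f (ir_d E i)) (direct_hom f (ir_d E i.+1))
  end.

(* [N] is a model of [R^i f_* M], which is defined up to isomorphism only *)
Definition is_Rdirect (i : nat) (N : omod Y) : Prop :=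
  exists E : inj_resolution M, omod_iso N (Rdirect_along E i).

Definition Rdirect_quasi_coherent (i : nat) : Prop :=
  forall N, is_Rdirect i N -> quasi_coherent N.

End Derived.

Definition preserves_quasi_coherence (k : comPzRingType) (X Y : rspace k)
    (f : rmor X Y) : Prop :=
  forall M : omod X, quasi_coherent M -> forall i, Rdirect_quasi_coherent f M i.

Definition schematic_space (k : comPzRingType) (X : rspace k) : Prop :=
  finite_space X /\ forall i, Rdirect_quasi_coherent (diagonal X) (struct_mod X) i.

Definition schematic (k : comPzRingType) (X Y : rspace k) (f : rmor X Y) : Prop :=
  forall i, Rdirect_quasi_coherent (graph f) (struct_mod X) i.

(* Main.v *)
(** Fix [y <= y'] in [Y], write [U_y] for the smallest open set at [y], and let [E] be an
    injective resolution of an [O_X]-module [M]. For an open subset [W] of [X] consider the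
    comparison of complexes
      [O_y' (x)_(O_y) Gamma(W /\ f^-1(U_y), E) -> Gamma(W /\ f^-1(U_y'), E)].
    As [O_y -> O_y'] is flat, its cone [T(W, M)] is exact iff [O_y' (x) -] carries the
    cohomology of [W /\ f^-1(U_y)] to that of [W /\ f^-1(U_y')]. Over a finite space
    quasi-coherence means that the restrictions of stalks are base changes. Hence the
    [R^i f_* M] are quasi-coherent iff all [T(X, M)] are exact, and base change along
    [(x, y) <= (x, y')] for [R^i Gamma_* O_X] is exactness of [T(U_x, O_X)]. Moreover
    [T(W, M)] satisfies Mayer-Vietoris in [W], so it is exact as soon as [T(U_x, M)] is
    for all [x] in [W].

    If [f] is schematic, exactness of [T(U_x, O_X)] passes to [T(U_x, M)] for [M]
    quasi-coherent by presenting [M] on [U_x], and then to [T(X, M)].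

    Conversely let [E] resolve [O_X], and let [j] be the inclusion of [U_x]. As [X] is
    schematic, the complex [j_* (E|U_x)] has quasi-coherent cohomology sheaves, finitely many
    of which are nonzero; if [R f_*] preserves quasi-coherence, devissage shows that
    [T(X, j_* (E|U_x)) = T(U_x, E)] is exact. Base change for [R^i Gamma_* O_X] along
    [(x, y) <= (x', y)] holds because [X] is schematic, and the two directions compose. *)

Require Import Defs.
From HB Require Import structures.
From mathcomp Require Import boolp classical_sets functions cardinality.
From mathcomp Require Import all_boot all_order all_algebra.
From mathcomp Require Import generic_quotient ring_quotient.

Set Implicit Arguments.
Unset Strict Implicit.
Unset Printing Implicit Defensive.

Import Order.TTheory GRing.Theory.
Local Open Scope ring_scope.
Local Open Scope quotient_scope.

(** * Short exact sequences of complexes and tensor products *)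

(** One device carries the whole argument: exactness of a cone satisfies two out of three in short
    exact sequences. No long exact sequence has to be built, and a chain map whose own cone is exact
    on stalks changes nothing. For this the complexes must be flasque, the only property of
    injectives that is used for sections; injectivity proper serves to construct chain maps.
    Finiteness enters through windows of degrees: exactness of sections over an open [W] in degree
    [n] depends on stalks in degrees from [n - #|W|] to [n] only. A resolution is exact on stalks in
    positive degrees, so it contributes nothing beyond degree [#|X| + 1], and an induction along an
    infinite sequence of free covers can start there. Open subsets are not made into ringed spaces:
    a statement about [M|U] becomes one about modules on [X] whose maps and equations are
    constrained on [U] only. *)

Section Exactness.
Variables (C : nat -> zmodType) (d : forall n, {additive C n -> C n.+1}).

Definition bd n : C n -> Prop :=
  match n with 0 => fun a => a = 0 | m.+1 => fun a => exists b, d m b = a end.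

Definition exact_at n := forall a : C n, d n a = 0 -> bd a.
End Exactness.

Section ShortExact.
Variables (X Y Z : nat -> zmodType).
Variables (dX : forall n, {additive X n -> X n.+1}).
Variables (dY : forall n, {additive Y n -> Y n.+1}).
Variables (dZ : forall n, {additive Z n -> Z n.+1}).
Variables (i : forall n, {additive X n -> Y n}) (p : forall n, {additive Y n -> Z n}).
Hypothesis iP : forall n x, i n.+1 (dX n x) = dY n (i n x).
Hypothesis pP : forall n x, p n.+1 (dY n x) = dZ n (p n x).
Hypothesis i_inj : forall n, injective (i n).
Hypothesis p_surj : forall n z, exists y, p n y = z.
Hypothesis ip0 : forall n x, p n (i n x) = 0.
Hypothesis ip_exact : forall n y, p n y = 0 -> exists x, i n x = y.
Hypothesis dY0 : forall n y, dY n.+1 (dY n y) = 0.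

(** This lemma and the next two are segments of the long exact cohomology sequence with vanishing
    outer terms, here [H^n(Y) -> H^n(Z) -> H^(n+1)(X)]. Terms below degree 0 count as zero, so
    exactness in degree 0 is injectivity. *)
Lemma exact_quot n : exact_at dY n -> exact_at dX n.+1 -> exact_at dZ n.
Proof.
move=> eY eX z dz; have [y yz] := p_surj z.
have [x xy] : exists x, i _ x = dY n y by apply: ip_exact; rewrite pP yz.
have [|x' x'x] := eX x; first by apply: i_inj; rewrite iP xy dY0 raddf0.
have /eY : dY n (y - i n x') = 0 by rewrite raddfB -iP x'x xy subrr.
rewrite -yz -[p n y]subr0 -(ip0 x') -raddfB.
move: (y) (x'); clear x'x x' xy x yz y dz z eX eY.
case: n => [|n] y x' /=; first by move->; rewrite raddf0.
by case=> b <-; exists (p _ b); rewrite pP.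
Qed.

Lemma exact_sub n : (forall m, n = m.+1 -> exact_at dZ m) -> exact_at dY n ->
  exact_at dX n.
Proof.
case: n => [|n] eZ eY x dx.
  have /eY /= : dY 0 (i 0 x) = 0 by rewrite -iP dx raddf0.
  by move=> i0; apply: i_inj; rewrite i0 raddf0.
have /eY[/= y yx] : dY _ (i _ x) = 0 by rewrite -iP dx raddf0.
have /(eZ n erefl) : dZ _ (p _ y) = 0 by rewrite -pP yx ip0.
have lift w : p n (y - w) = 0 -> dY n w = 0 -> exists b, dX n b = x.
  move=> /ip_exact[b bw] dw; exists b; apply: i_inj.
  by rewrite iP bw raddfB dw subr0.
case: n eZ eY x dx y yx lift => [|n] eZ eY x dx y yx lift /= => [py0|[z zy]].
  by apply: (lift 0); rewrite ?subr0 ?raddf0.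
have [w wz] := p_surj z.
by apply: (lift (dY _ w)); rewrite ?dY0 // raddfB pP wz zy subrr.
Qed.

Lemma exact_ext n : exact_at dX n -> exact_at dZ n -> exact_at dY n.
Proof.
move=> eX eZ y dy.
have /eZ : dZ _ (p _ y) = 0 by rewrite -pP dy raddf0.
have lift w : p n w = p n y -> dY n w = 0 -> exists2 x, bd dX x & i n x = y - w.
  move=> pw dw; have [x xy] : exists x, i n x = y - w.
    by apply: ip_exact; rewrite raddfB pw subrr.
  by exists x => //; apply: eX; apply: i_inj; rewrite iP xy raddfB dy dw subrr raddf0.
case: n eX eZ y dy lift => [|n] eX eZ y dy lift /= => [py0|[z zy]].
  have [||x -> /=] := lift 0; rewrite ?raddf0 // => /esym.
  by rewrite addr0.
have [w wz] := p_surj z; have [||x [x' <-]] := lift (dY n w); rewrite ?dY0 //.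
  by rewrite pP wz.
by move=> xy; exists (i _ x' + w); rewrite raddfD -iP xy subrK.
Qed.
End ShortExact.

Section TensorMaps.
Variables (A : comPzRingType) (P : lmodType A).

HB.instance Definition _ (M N : lmodType A) (u : {linear M -> N}) :=
  GRing.Additive.on (@tens_map A P M N u).

Lemma tens_map_pure (M N : lmodType A) (u : {linear M -> N}) (p : P) m :
  tens_map u (pure p m) = pure p (u m).
Proof. exact: tens_lift_pure. Qed.

Lemma pure0l (M : lmodType A) (m : M) : pure (0 : P) m = 0.
Proof. by apply: eq_tensor; exact: tens_0l. Qed.

Lemma pure0r (M : lmodType A) (p : P) : pure p (0 : M) = 0.
Proof. by apply: (addIr (pure p 0)); rewrite -pureDr !add0r. Qed.

Lemma tens_map_comp (M N Q : lmodType A) (u : {linear M -> N}) (v : {linear N -> Q})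
    (w : {linear M -> Q}) : (forall m, v (u m) = w m) ->
  forall x : tensor P M, tens_map v (tens_map u x) = tens_map w x.
Proof.
move=> uvw; elim/tensor_ind => [|m n x IHx]; first by rewrite !raddf0.
by rewrite !raddfD /= IHx !tens_map_pure uvw.
Qed.

Lemma tens_map_id (M : lmodType A) (u : {linear M -> M}) : u =1 id ->
  forall x : tensor P M, tens_map u x = x.
Proof.
move=> u1; elim/tensor_ind => [|m n x IHx]; first by rewrite raddf0.
by rewrite raddfD /= IHx tens_map_pure u1.
Qed.

Lemma tens_map0 (M N : lmodType A) (u : {linear M -> N}) : (forall m, u m = 0) ->
  forall x : tensor P M, tens_map u x = 0.
Proof.
move=> u0; elim/tensor_ind => [|m n x IHx]; first by rewrite raddf0.
by rewrite raddfD /= IHx tens_map_pure u0 pure0r addr0.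
Qed.

Lemma tens_map_surj (M N : lmodType A) (u : {linear M -> N}) :
  (forall n, exists m, u m = n) -> forall y, exists x, tens_map (L := P) u x = y.
Proof.
move=> us; elim/tensor_ind => [|p n y [x <-]]; first by exists 0; rewrite raddf0.
by have [m <-] := us n; exists (pure p m + x); rewrite raddfD /= tens_map_pure.
Qed.

(** Right exactness of the tensor product. A set-theoretic section [s] of [v] sends formal sums over
    [P * N] to [tensor P M]; [relF] shows that this respects the tensor relations modulo the image
    of [tens_map u], and so it inverts [tens_map v] modulo that image. *)
Lemma tens_map_exact (L M N : lmodType A) (u : {linear L -> M}) (v : {linear M -> N}) :
  (forall n, exists m, v m = n) -> (forall m, v m = 0 -> exists l, u l = m) ->
  forall x : tensor P M, tens_map v x = 0 -> exists y, tens_map u y = x.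
Proof.
move=> /choice[s sK] uv.
pose im x := exists y, tens_map (L := P) u y = x.
have imD x y : im x -> im y -> im (x + y).
  by move=> [a <-] [b <-]; exists (a + b); rewrite raddfD.
have imN x : im x -> im (- x) by move=> [a <-]; exists (- a); rewrite raddfN.
have im0 : im 0 by exists 0; rewrite raddf0.
have imp p m : v m = 0 -> im (pure p m).
  by move=> /uv[l <-]; exists (pure p l); rewrite tens_map_pure.
have pureB (p : P) m m' : pure p (m - m') = pure p m - pure p m'.
  by apply: (addIr (pure p m')); rewrite -pureDr !subrK.
pose F (r : seq (P * N)) := \sum_(q <- r) pure q.1 (s q.2).
have relF r t : tens_rel r t -> im (F r - F t).
  rewrite /F; elim=> {r t}.
  - by move=> r; rewrite subrr.
  - by move=> r t _ /imN; rewrite opprB.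
  - by move=> r t z _ h _ /(imD _ _ h); rewrite addrA subrK.
  - move=> r r' t t' _ h _ /(imD _ _ h).
    by rewrite !big_cat /= opprD addrACA.
  - by move=> r t; rewrite !big_cat /= [X in _ - X]addrC subrr.
  - move=> n; rewrite big_seq1 big_nil subr0 /=; set z := pure _ _.
    by rewrite /z pure0l.
  - by move=> m m' n; rewrite !big_cons !big_nil /= pureDl !addr0 subrr.
  - move=> m n n'; rewrite !big_cons !big_nil /= !addr0 -pureDr -pureB.
    by apply: imp; rewrite linearB linearD !sK subrr.
  - move=> a m n; rewrite !big_seq1 /= pureZ -pureB; apply: imp.
    by rewrite linearB linearZ /= !sK subrr.
have sumpi r : \pi_(tensor P N) r = \sum_(q <- r) pure q.1 q.2.
  elim: r => [|q r IHr]; first by rewrite big_nil.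
  by rewrite big_cons -IHr -cat1s -tens_addE; case: q.
have sumpi' r : \pi_(tensor P M) r = \sum_(q <- r) pure q.1 q.2.
  elim: r => [|q r IHr]; first by rewrite big_nil.
  by rewrite big_cons -IHr -cat1s -tens_addE; case: q.
elim/tensorW => r; rewrite sumpi' raddf_sum /= => h.
pose t := [seq (q.1, v q.2) | q <- r].
have /relF : tens_rel t [::].
  have /eqmodP/asboolP// : \pi_(tensor P N) t = \pi_(tensor P N) [::].
  rewrite sumpi big_map; rewrite -[RHS]/(0 : tensor P N) -[RHS]h.
  by apply: eq_bigr => q _; rewrite tens_map_pure.
rewrite /F big_nil subr0 big_map /= => h'.
suff : im (\sum_(q <- r) pure q.1 q.2) by [].
rewrite -[X in im X](subrK (\sum_(q <- r) pure q.1 (s (v q.2)))); apply: (imD) => //.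
rewrite -sumrB; elim: (r) => [|q r' IH]; first by rewrite big_nil.
rewrite big_cons; apply: (imD) => //; rewrite -pureB; apply: imp.
by rewrite linearB sK subrr.
Qed.
End TensorMaps.

(** * Base change *)

Section BaseChange.
Variables (A B : comPzRingType) (g : {rmorphism A -> B}).

Notation ext M := (tensor (restr g B^o) M).

Section Map.
Variables (M : lmodType A) (N : lmodType B) (phi : {linear M -> N | g \; *:%R}).

Let bal (b : restr g B^o) (m : M) : N := (b : B) *: phi m.

Fact bc_addl b b' m : bal (b + b') m = bal b m + bal b' m.
Proof. exact: scalerDl. Qed.
Fact bc_addr b m m' : bal b (m + m') = bal b m + bal b m'.
Proof. by rewrite /bal linearD scalerDr. Qed.
Fact bc_bal a b m : bal (a *: b) m = bal b (a *: m).
Proof. by rewrite /bal linearZ /= scalerA mulrC. Qed.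

Definition bcmap : ext M -> N := tens_lift (Balanced bc_addl bc_addr bc_bal).
HB.instance Definition _ := GRing.Additive.on bcmap.

Lemma bcmap_pure (b : B) m : bcmap (@pure A (restr g B^o) M b m) = b *: phi m.
Proof. exact: tens_lift_pure. Qed.

Definition base_change := bijective bcmap.

Lemma base_changeP : injective bcmap -> (forall n, exists x, bcmap x = n) -> base_change.
Proof.
move=> inj /choice[h hK]; exists h => // x; apply: inj; exact: hK.
Qed.
End Map.

Lemma bcmap_nat (M M1 : lmodType A) (N N1 : lmodType B)
    (phi : {linear M -> N | g \; *:%R}) (phi1 : {linear M1 -> N1 | g \; *:%R})
    (u : {linear M -> M1}) (v : {linear N -> N1}) :
    (forall m, v (phi m) = phi1 (u m)) ->
  forall x, v (bcmap phi x) = bcmap phi1 (tens_map u x).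
Proof.
move=> uv; elim/tensor_ind => [|b m x IHx]; first by rewrite !raddf0.
by rewrite !raddfD /= IHx tens_map_pure !bcmap_pure linearZ /= uv.
Qed.

Lemma base_change_iso (M M1 : lmodType A) (N N1 : lmodType B)
    (phi : {linear M -> N | g \; *:%R}) (phi1 : {linear M1 -> N1 | g \; *:%R})
    (u : {linear M -> M1}) (v : {linear N -> N1}) :
    (forall m, v (phi m) = phi1 (u m)) -> bijective u -> bijective v ->
  base_change phi <-> base_change phi1.
Proof.
move=> uv [u' uK u'K] bv.
have u'_lin : linear u'.
  by move=> a m n; rewrite -{1}[m]u'K -{1}[n]u'K -linearP uK.
pose u1 := HB.pack_for {linear M1 -> M} u' (GRing.isLinear.Build _ _ _ _ u' u'_lin).
have bu : bijective (tens_map (L := restr g B^o) u).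
  exists (tens_map u1) => x.
    by rewrite (@tens_map_comp _ _ _ _ _ _ _ idfun) ?tens_map_id.
  by rewrite (@tens_map_comp _ _ _ _ _ _ _ idfun) ?tens_map_id.
split=> [h|h].
  apply: (@eq_bij _ _ (v \o bcmap phi \o (tens_map u1))) => [|x /=].
    apply: bij_comp; last by apply: (bij_can_bij bu) => x;
    rewrite (@tens_map_comp _ _ _ _ _ _ _ idfun) ?tens_map_id.
    exact: bij_comp.
  rewrite (bcmap_nat uv) (@tens_map_comp _ _ _ _ _ _ _ idfun) ?tens_map_id //.
have [v' vK v'K] := bv.
apply: (@eq_bij _ _ (v' \o bcmap phi1 \o (tens_map u))) => [|x /=].
  apply: bij_comp => //; apply: bij_comp => //; exact: (bij_can_bij bv).
by rewrite -(bcmap_nat uv) vK.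
Qed.
End BaseChange.

Section Submodule.
Variables (A : comPzRingType) (M : lmodType A).

Record submod := Submod {
  sm_in :> M -> Prop;
  sm_0 : sm_in 0;
  sm_D : forall m n, sm_in m -> sm_in n -> sm_in (m + n);
  sm_Z : forall a m, sm_in m -> sm_in (a *: m) }.

Variable S : submod.

Definition sm_pred : {pred M} := fun m => `[< S m >].

Fact sm_pred_closed : subsemimod_closed sm_pred.
Proof.
split; [split|].
- exact/asboolP/sm_0.
- by move=> m n /asboolP hm /asboolP hn; exact/asboolP/sm_D.
- by move=> a m /asboolP hm; exact/asboolP/sm_Z.
Qed.
HB.instance Definition _ :=
  GRing.isSubSemiModClosed.Build A M sm_pred sm_pred_closed.

Record sub_mod : Type := SubMod { sub_val :> M; sub_valP : sm_pred sub_val }.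
HB.instance Definition _ := [isSub for sub_val].
HB.instance Definition _ := [Choice of sub_mod by <:].
HB.instance Definition _ := [SubChoice_isSubLmodule of sub_mod by <:].

Lemma sub_in (x : sub_mod) : S (val x).
Proof. exact/asboolP/sub_valP. Qed.

Definition sub_mk m (h : S m) : sub_mod := SubMod (introT (asboolP _) h : sm_pred m).

Definition sub_incl : {linear sub_mod -> M} := val.
End Submodule.

Section FlatExact.
Variables (A B : comPzRingType) (g : {rmorphism A -> B}).
Hypothesis g_flat : flat g.

Section Image.
Variables (M N : lmodType A) (v : {linear M -> N}).
Fact im_sub0 : exists m, v m = 0.
Proof. by exists 0; rewrite linear0. Qed.
Fact im_subD n n' : (exists m, v m = n) -> (exists m, v m = n') ->
  exists m, v m = n + n'.
Proof. by move=> [m <-] [m' <-]; exists (m + m'); rewrite linearD. Qed.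
Fact im_subZ a n : (exists m, v m = n) -> exists m, v m = a *: n.
Proof. by move=> [m <-]; exists (a *: m); rewrite linearZ. Qed.
Definition im_sub : submod N := Submod im_sub0 im_subD im_subZ.

Definition corestr (m : M) : sub_mod im_sub :=
  sub_mk (ex_intro (fun m' => v m' = v m) m erefl : im_sub (v m)).
Fact corestr_linear : linear corestr.
Proof. by move=> a m n; apply: val_inj; rewrite /= linearP. Qed.
HB.instance Definition _ := GRing.isLinear.Build _ _ _ _ corestr corestr_linear.
End Image.

(** [flat] speaks of injections only. Factoring [v] through its image splits the claim into right
    exactness for the corestriction and flatness for the inclusion. *)
Lemma flat_exact (L M N : lmodType A) (u : {linear L -> M}) (v : {linear M -> N}) :
  (forall m, v m = 0 -> exists l, u l = m) ->
  forall x : tensor (restr g B^o) M, tens_map v x = 0 -> exists y, tens_map u y = x.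
Proof.
move=> uv x; rewrite -(@tens_map_comp _ _ _ _ _ (corestr v) (sub_incl (im_sub v))) //.
rewrite -[X in _ = X](raddf0 (tens_map (L := restr g B^o) (sub_incl (im_sub v)))).
move/(g_flat val_inj); apply: tens_map_exact => [n|m].
  by have [m mn] := sub_in n; exists m; exact: val_inj.
by move=> /(congr1 val) /= /uv.
Qed.
End FlatExact.

Section CohBaseChange.
Variables (A B : comPzRingType) (g : {rmorphism A -> B}).
Hypothesis g_flat : flat g.
Notation ext M := (tensor (restr g B^o) M).
Variables (L M N : lmodType A) (u : {linear L -> M}) (v : {linear M -> N}).
Variables (L' M' N' : lmodType B) (u' : {linear L' -> M'}) (v' : {linear M' -> N'}).
Hypothesis vu0 : forall l, v (u l) = 0.
Variable phi : {linear M -> M' | g \; *:%R}.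
Variable phiN : {linear N -> N' | g \; *:%R}.
Hypothesis phi_v : forall m, v' (phi m) = phiN (v m).
Variable psi : {linear coh u v -> coh u' v' | g \; *:%R}.
Hypothesis psiP : forall (z : cycles v) (z' : cycles v'), phi (val z) = val z' ->
  psi (\pi_(coh u v) z) = \pi_(coh u' v') z'.

(** [inj_at] and [surj_at] are injectivity and surjectivity of the comparison from the cohomology of
    [B (x) L -> B (x) M -> B (x) N] to that of [L' -> M' -> N'], on representatives, so that the
    former cohomology never has to be formed. *)
Definition inj_at := forall a : ext M, tens_map v a = 0 ->
  forall l', u' l' = bcmap phi a -> exists l, tens_map u l = a.
Definition surj_at := forall m', v' m' = 0 -> exists2 a : ext M,
  tens_map v a = 0 & exists l', u' l' = m' - bcmap phi a.

Let cyc_val : {linear cycles v -> M} := val.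

Fact bnd_cycle l : is_cycle v (u l).
Proof. exact/eqP/vu0. Qed.
Let bnd l : cycles v := Cycle (bnd_cycle l).
Fact bnd_linear : linear bnd.
Proof. by move=> a m n; apply: val_inj; rewrite /= linearP. Qed.
Let bndL : {linear L -> cycles v} :=
  HB.pack_for {linear L -> cycles v} bnd (GRing.isLinear.Build _ _ _ _ bnd bnd_linear).

Let proj (z : cycles v) : coh u v := \pi_(coh u v) z.
Fact proj_linear : linear proj.
Proof. by move=> a m n; rewrite /proj coh_piD coh_piZ. Qed.
Let projL : {linear cycles v -> coh u v} :=
  HB.pack_for {linear cycles v -> coh u v} proj
    (GRing.isLinear.Build _ _ _ _ proj proj_linear).

Let cyc_exact (a : ext M) : tens_map v a = 0 -> exists z, tens_map cyc_val z = a.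
Proof.
apply: (flat_exact g_flat) => m vm.
by exists (Cycle (introT eqP vm : is_cycle v m)).
Qed.

Let cyc_vanish (z : ext (cycles v)) : tens_map v (tens_map cyc_val z) = 0.
Proof.
rewrite (@tens_map_comp _ _ _ _ _ _ _ \0) ?tens_map0 // => m.
exact/eqP/(cycleP m).
Qed.

Let bcmap_cycle (z : ext (cycles v)) : exists2 z' : cycles v',
  val z' = bcmap phi (tens_map cyc_val z) & bcmap psi (tens_map projL z) = \pi_(coh u' v') z'.
Proof.
elim/tensor_ind: z => [|b z x [z' z'1 z'2]].
  by exists 0; rewrite ?raddf0 //= !raddf0.
have c : is_cycle v' (b *: phi (val z) + val z').
  rewrite /is_cycle linearD linearZ /= phi_v.
  have /eqP -> := cycleP z; have /eqP -> := cycleP z'.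
  by rewrite linear0 scaler0 addr0.
exists (Cycle c); rewrite !raddfD /= ?raddfD /= !tens_map_pure bcmap_pure.
  by rewrite -z'1.
rewrite z'2.
have c' : is_cycle v' (phi (val z)).
  by rewrite /is_cycle phi_v; have /eqP -> := cycleP z; rewrite linear0.
rewrite (psiP (z' := Cycle c')) // -coh_piZ -coh_piD.
by congr (\pi_(coh u' v') _); exact: val_inj.
Qed.

Let projL_surj (x : coh u v) : exists z, projL z = x.
Proof. by elim/cohW: x => z; exists z. Qed.

Let proj_exact (z : ext (cycles v)) : tens_map projL z = 0 ->
  exists l, tens_map u l = tens_map cyc_val z.
Proof.
move=> h; have [|l <-] := tens_map_exact (u := bndL) projL_surj _ h.
  move=> m /cohE[l hl]; exists l; apply: val_inj => /=; rewrite hl; exact: subr0.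
by exists l; rewrite (@tens_map_comp _ _ _ _ _ bndL cyc_val u).
Qed.

(** By flatness [B (x) cycles v] is the kernel of [tens_map v], and by right exactness
    [B (x) coh u v] is its quotient by the image of [tens_map u]. So [bcmap psi] is the comparison
    described by [inj_at] and [surj_at]. *)
Lemma bcmap_coh_inj : injective (bcmap psi) <-> inj_at.
Proof.
split=> [inj a va l' ul'|inj].
  have [z za] := cyc_exact va; rewrite -za.
  apply: proj_exact; apply: inj; rewrite raddf0.
  have [z' z'1 ->] := bcmap_cycle z; apply/cohE; exists l'.
  by rewrite ul' z'1 za; exact: (esym (subr0 _)).
apply: raddf_inj => x.
have [z <-] := tens_map_surj (P := restr g B^o) projL_surj x.
have [z' z'1 e] := bcmap_cycle z; rewrite /= {}e => /cohE[l']; rewrite [in X in _ = X -> _]subr0 => hl'.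
have [l hl] := inj _ (cyc_vanish z) l' (etrans hl' z'1).
have -> : z = tens_map bndL l.
  apply: (g_flat (u := cyc_val) val_inj).
  by rewrite (@tens_map_comp _ _ _ _ _ bndL cyc_val u) // hl.
rewrite (@tens_map_comp _ _ _ _ _ _ _ \0) ?tens_map0 // => m.
by apply/cohE; exists m; exact: (esym (subr0 _)).
Qed.

Lemma bcmap_coh_surj : (forall y, exists x, bcmap psi x = y) <-> surj_at.
Proof.
split=> [su m' vm'|su].
  have [x] := su (\pi_(coh u' v') (Cycle (introT eqP vm' : is_cycle v' m'))).
  have [z <-] := tens_map_surj (P := restr g B^o) projL_surj x.
  have [z' z'1 ->] := bcmap_cycle z => /esym /cohE[l' hl'].
  by exists (tens_map cyc_val z) => //; exists l'; rewrite hl' -z'1.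
elim/cohW => z'.
have /eqP/su[a va [l' hl']] := cycleP z'.
have [z za] := cyc_exact va; exists (tens_map projL z).
have [z1 z1P ->] := bcmap_cycle z; apply/esym/cohE; exists l'.
by rewrite hl' z1P za.
Qed.

Lemma base_change_coh : base_change psi <-> inj_at /\ surj_at.
Proof.
rewrite -bcmap_coh_inj -bcmap_coh_surj; split=> [[h hK Kh]|[inj su]].
  by split; [exact: can_inj hK | move=> y; exists (h y)].
exact: base_changeP.
Qed.
End CohBaseChange.

Section BaseChangeComp.
Variables (A B C : comPzRingType).
Variables (g1 : {rmorphism A -> B}) (g2 : {rmorphism B -> C}) (g3 : {rmorphism A -> C}).
Hypothesis g12 : forall a, g3 a = g2 (g1 a).
Variables (M : lmodType A) (N : lmodType B) (Q : lmodType C).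
Variables (phi : {linear M -> N | g1 \; *:%R}) (chi : {linear N -> Q | g2 \; *:%R}).
Variable om : {linear M -> Q | g3 \; *:%R}.
Hypothesis omE : forall m, om m = chi (phi m).

Notation extB := (tensor (restr g1 B^o) M).
Notation extC := (tensor (restr g3 C^o) M).

Section Mul.
Variable c : C.
Let f (b : restr g1 B^o) (m : M) : extC := @pure A (restr g3 C^o) M (c * g2 b) m.
Fact comp_addl b b' m : f (b + b') m = f b m + f b' m.
Proof. by rewrite /f (rmorphD g2 b b') mulrDr; exact: pureDl. Qed.
Fact comp_addr b m m' : f b (m + m') = f b m + f b m'.
Proof. exact: pureDr. Qed.
Fact comp_bal a b m : f (a *: b) m = f b (a *: m).
Proof.
rewrite /f -pureZ; congr pure.
by rewrite -[RHS]/(g3 a * (c * g2 b)) -[a *: b]/(g1 a * b) rmorphM g12 mulrCA.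
Qed.
Definition comp_mul : extB -> extC := tens_lift (Balanced comp_addl comp_addr comp_bal).
HB.instance Definition _ := GRing.Additive.on comp_mul.
Lemma comp_mul_pure b m :
  comp_mul (@pure A (restr g1 B^o) M b m) = @pure A (restr g3 C^o) M (c * g2 b) m.
Proof. exact: tens_lift_pure. Qed.
End Mul.

Lemma comp_mulD c c' x : comp_mul (c + c') x = comp_mul c x + comp_mul c' x.
Proof.
elim/tensor_ind: x => [|b m x IHx]; first by rewrite !raddf0 addr0.
by rewrite !raddfD /= IHx !comp_mul_pure mulrDl addrACA -pureDl.
Qed.

(** This is [C (x)_B (B (x)_A M) = C (x)_A M] made explicit. With [h] and [e] inverse to [bcmap phi]
    and [bcmap chi], the map [ka] sends [c (x) n] to [comp_mul c (h n)], and [ka] after [e] is a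
    left inverse of [bcmap om]. *)
Lemma base_change_comp : base_change phi -> base_change chi -> base_change om.
Proof.
move=> [h hK Kh] [e eK Ke].
have hD n n' : h (n + n') = h n + h n'.
  by apply: (can_inj hK); rewrite raddfD /= !Kh.
have hZ b x : comp_mul 1 (h (b *: bcmap phi x)) = comp_mul (g2 b) x.
  elim/tensor_ind: x => [|b' m x IHx].
    by rewrite !raddf0 ?scaler0 -[X in h X](raddf0 (bcmap phi)) hK raddf0.
  rewrite !raddfD /= ?scalerDr hD raddfD /= IHx; congr (_ + _).
  rewrite bcmap_pure scalerA -[X in h X](bcmap_pure phi) hK !comp_mul_pure.
  by rewrite mul1r rmorphM.
have mulE c x : comp_mul c x = comp_mul c (h (bcmap phi x)) by rewrite hK.
have hbal (b : B) (c : restr g2 C^o) n :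
    comp_mul (b *: c : C) (h n) = comp_mul c (h (b *: n)).
  rewrite -[n]Kh hK; move: (h n) => x {n}.
  elim/tensor_ind: x => [|b' m x IHx].
    by rewrite !raddf0 ?scaler0 -[X in h X](raddf0 (bcmap phi)) hK raddf0.
  rewrite !raddfD /= ?scalerDr hD raddfD /= IHx; congr (_ + _).
  rewrite bcmap_pure scalerA -[X in h X](bcmap_pure phi) hK !comp_mul_pure.
  by rewrite rmorphM mulrA [c * _]mulrC.
pose ka := Balanced (V := extC) (A := B) (M := restr g2 C^o) (N := N)
  (bal_fun := fun c n => comp_mul c (h n))
  (fun c c' n => comp_mulD c c' (h n))
  (fun c n n' => etrans (congr1 (comp_mul c) (hD n n')) (raddfD _ _ _))
  hbal.
apply: base_changeP; last first.
  move=> q; rewrite -[q]Ke; move: (e q) => x {q}.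
  elim/tensor_ind: x => [|c n x [y yx]]; first by exists 0; rewrite !raddf0.
  suff [z zn] : exists z, bcmap om z = c *: chi n.
    by exists (z + y); rewrite !raddfD /= bcmap_pure zn yx.
  rewrite -[n]Kh; move: (h n) => w {n}.
  elim/tensor_ind: w => [|b m w [z zw]]; first by exists 0; rewrite !raddf0 ?scaler0.
  exists (@pure A (restr g3 C^o) M (c * g2 b) m + z).
  by rewrite !raddfD /= !bcmap_pure zw omE linearZ /= ?scalerDr scalerA.
apply: (can_inj (g := fun q => tens_lift ka (e q))) => x.
have eD q q' : e (q + q') = e q + e q'.
  by apply: (can_inj eK); rewrite raddfD /= !Ke.
elim/tensor_ind: x => [|c m x IHx].
  by rewrite raddf0 -[X in e X](raddf0 (bcmap chi)) eK raddf0.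
rewrite raddfD /= eD raddfD /= IHx; congr (_ + _).
rewrite bcmap_pure omE -[X in e X](bcmap_pure chi) eK tens_lift_pure /=.
rewrite -[phi m]scale1r -[X in h X](bcmap_pure phi) hK comp_mul_pure.
by rewrite rmorph1 mulr1.
Qed.
End BaseChangeComp.

Section Pushout.
Variables (A B P P' : comPzRingType) (g : {rmorphism A -> B}) (s : {rmorphism P -> P'}).
Variables (iA : {rmorphism A -> P}) (iB : {rmorphism B -> P'}).
Hypothesis square : forall a, s (iA a) = iB (g a).
Variables (N : lmodType P) (N' : lmodType P').
Variables (phi : {linear N -> N' | s \; *:%R}).
Variables (phir : {linear restr iA N -> restr iB N' | g \; *:%R}).
Hypothesis phirE : forall n : N, phir n = phi n.

Notation extP := (tensor (restr s P'^o) N).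
Notation extB := (tensor (restr g B^o) (restr iA N)).

Let th (b : restr g B^o) (n : restr iA N) : extP := @pure P (restr s P'^o) N (iB b) n.
Fact push_addl b b' n : th (b + b') n = th b n + th b' n.
Proof. by rewrite /th (rmorphD iB b b'); exact: pureDl. Qed.
Fact push_addr b n n' : th b (n + n') = th b n + th b n'.
Proof. exact: pureDr. Qed.
Fact push_bal a b n : th (a *: b) n = th b (a *: n).
Proof.
rewrite /th -[a *: n]/(iA a *: (n : N)) -pureZ -[a *: b]/(g a * b) rmorphM -square.
exact: erefl.
Qed.
Definition push : extB -> extP := tens_lift (Balanced push_addl push_addr push_bal).
HB.instance Definition _ := GRing.Additive.on push.

Lemma push_pure (b : B) (n : N) :
  push (@pure A (restr g B^o) (restr iA N) b n) = @pure P (restr s P'^o) N (iB b) n.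
Proof. exact: tens_lift_pure. Qed.

Lemma bcmap_push x : bcmap phi (push x) = bcmap phir x.
Proof.
elim/tensor_ind: x => [|b n x IHx]; first by rewrite !raddf0.
by rewrite !raddfD /= IHx push_pure !bcmap_pure phirE.
Qed.

Hypothesis gen : forall (p : P') n, exists x, push x = @pure P (restr s P'^o) N p n.

Lemma push_surj y : exists x, push x = y.
Proof.
elim/tensor_ind: y => [|p n y [x <-]]; first by exists 0; rewrite raddf0.
by have [z <-] := gen p n; exists (z + x); rewrite raddfD.
Qed.

(** Since [bcmap phi] after [push] is [bcmap phir], surjectivity of [push] is enough in this
    direction; the opposite one also asks for injectivity. *)
Lemma base_change_push : base_change phir -> base_change phi.
Proof.
case=> h hK Kh; apply: base_changeP => [|n].
  apply: raddf_inj => y; have [x <-] := push_surj y => /=.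
  by rewrite bcmap_push -(raddf0 (bcmap phir)) => /(can_inj hK) ->; rewrite raddf0.
by exists (push (h n)); rewrite bcmap_push Kh.
Qed.

Lemma base_change_pull : injective push -> base_change phi -> base_change phir.
Proof.
move=> inj [h hK Kh]; apply: base_changeP => [x x'|n].
  by rewrite -!bcmap_push => /(can_inj hK) /inj.
by have [x xh] := push_surj (h n); exists x; rewrite -bcmap_push xh Kh.
Qed.
End Pushout.

Section AlgTensorPush.
Variables (k A1 A B : comPzRingType).
Variables (f : {rmorphism k -> A1}) (gA : {rmorphism k -> A}) (gB : {rmorphism k -> B}).
Variable g : {rmorphism A -> B}.
Hypothesis gE : forall c, gB c = g (gA c).

Section Right.
Variable s : {rmorphism algtens f gA -> algtens f gB}.
Hypothesis sE : forall a b, s (algpure f gA a b) = algpure f gB a (g b).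
Let iA : {rmorphism A -> algtens f gA} := tens_inr f gA.
Let iB : {rmorphism B -> algtens f gB} := tens_inr f gB.
Variables (N : lmodType (algtens f gA)) (N' : lmodType (algtens f gB)).
Variables (phi : {linear N -> N' | s \; *:%R}).
Variables (phir : {linear restr iA N -> restr iB N' | g \; *:%R}).
Hypothesis phirE : forall n : N, phir n = phi n.

Fact right_square a : s (iA a) = iB (g a).
Proof. exact: sE. Qed.

Notation extP := (tensor (restr s (algtens f gB)^o) N).
Notation extB := (tensor (restr g B^o) (restr iA N)).

Fact right_gen p n : exists x,
  push right_square x = @pure _ (restr s (algtens f gB)^o) N p n.
Proof.
elim/algtens_ind: p => [|a b p [x xp]].
  by exists 0; rewrite raddf0 [RHS]pure0l.
exists (@pure A (restr g B^o) (restr iA N) b (algpure f gA a 1 *: n) + x).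
rewrite raddfD /= push_pure xp -pureZ [RHS]pureDl; congr (pure _ _ + _).
by rewrite [LHS]/(s _ * _) sE rmorph1 [LHS]algpureM mulr1 mul1r.
Qed.

Section Retract.
Variable n : N.
Let q (a : A1) (b : B) : extB :=
  @pure A (restr g B^o) (restr iA N) b (algpure f gA a 1 *: n).
Fact retr_Dl a a' b : q (a + a') b = q a b + q a' b.
Proof. by rewrite /q algpureDl scalerDl; exact: pureDr. Qed.
Fact retr_Dr a b b' : q a (b + b') = q a b + q a b'.
Proof. exact: pureDl. Qed.
Fact retr_Z c a b : q (f c * a) b = q a (gB c * b).
Proof.
rewrite /q gE.
apply: etrans (esym (@pureZ A (restr g B^o) (restr iA N) (gA c) b
  (algpure f gA a 1 *: n))); congr pure.
rewrite -[RHS]/(iA (gA c) *: (algpure f gA a 1 *: n)) scalerA.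
by rewrite [iA _ * _]algpureM mul1r mulr1 -[gA c]mulr1 -algpureZ.
Qed.
Definition retr0 : algtens f gB -> extB := alglift retr_Dl retr_Dr retr_Z.
HB.instance Definition _ := GRing.Additive.on retr0.
Lemma retr0_pure a b : retr0 (algpure f gB a b) =
  @pure A (restr g B^o) (restr iA N) b (algpure f gA a 1 *: n).
Proof. exact: alglift_pure. Qed.
End Retract.

Let r (p : restr s (algtens f gB)^o) (n : N) : extB := retr0 n p.
Fact retract_addl p p' n : r (p + p') n = r p n + r p' n.
Proof. exact: (raddfD (retr0 n)). Qed.
Fact retract_addr p n n' : r p (n + n') = r p n + r p n'.
Proof.
rewrite /r; elim/algtens_ind: p => [|a b p IHp]; first by rewrite !raddf0 addr0.
rewrite !raddfD /= IHp !retr0_pure addrACA; congr (_ + _).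
by rewrite scalerDr; exact: pureDr.
Qed.
Fact retract_bal c p n : r (c *: p) n = r p (c *: n).
Proof.
have -> : c *: p = s c * p by [].
rewrite /r; elim/algtens_ind: p => [|a b p IHp]; first by rewrite mulr0 !raddf0.
rewrite mulrDr !raddfD /= IHp; congr (_ + _).
elim/algtens_ind: c {IHp} => [|a' b' c IHc].
  by rewrite rmorph0 mul0r scale0r !raddf0 retr0_pure scaler0 [RHS]pure0r.
rewrite rmorphD mulrDl scalerDl raddfD /= IHc -/(r _ _) -/(r _ (_ + _)) retract_addr.
congr (_ + _); rewrite /r sE algpureM !retr0_pure [LHS]pureZ; congr pure.
rewrite -[LHS]/(iA b' *: (algpure f gA (a' * a) 1 *: n)) !scalerA.
by rewrite [iA b' * _]algpureM [in RHS]algpureM mul1r !mulr1 [a * a']mulrC mul1r.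
Qed.
Definition retract : extP -> extB := tens_lift (Balanced retract_addl retract_addr retract_bal).
HB.instance Definition _ := GRing.Additive.on retract.

(** [retract] sends [(a (x) b) (x) n] to [b (x) (a (x) 1) n]; it is the inverse in
    [(A1 (x) B) (x)_(A1 (x) A) N = B (x)_A N]. *)
Fact right_inj : injective (push right_square (N := N)).
Proof.
apply: (can_inj (g := retract)); elim/tensor_ind => [|b n x IHx].
  by rewrite !raddf0.
rewrite !raddfD /= IHx push_pure; congr (_ + _).
rewrite [LHS]tens_lift_pure /= /r [LHS]retr0_pure; congr pure.
exact: scale1r.
Qed.

(** Meant for a product space on which only the second coordinate moves: base change along
    [O_x (x) O_y -> O_x (x) O_y'] becomes base change along [O_y -> O_y']. *)
Lemma base_change_right : base_change phi <-> base_change phir.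
Proof.
split; last exact: (base_change_push phirE right_gen).
exact: (base_change_pull phirE right_gen right_inj).
Qed.
End Right.
End AlgTensorPush.

Section AlgTensorPushLeft.
Variables (k A1 A B : comPzRingType).
Variables (f : {rmorphism k -> A1}) (gA : {rmorphism k -> A}) (gB : {rmorphism k -> B}).
Variable g : {rmorphism A -> B}.
Variable s : {rmorphism algtens gA f -> algtens gB f}.
Hypothesis sE : forall a b, s (algpure gA f a b) = algpure gB f (g a) b.
Let iA : {rmorphism A -> algtens gA f} := tens_inl gA f.
Let iB : {rmorphism B -> algtens gB f} := tens_inl gB f.
Variables (N : lmodType (algtens gA f)) (N' : lmodType (algtens gB f)).
Variables (phi : {linear N -> N' | s \; *:%R}).
Variables (phir : {linear restr iA N -> restr iB N' | g \; *:%R}).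
Hypothesis phirE : forall n : N, phir n = phi n.

Fact left_square a : s (iA a) = iB (g a).
Proof. exact: sE. Qed.

Fact left_gen p n : exists x,
  push left_square x = @pure _ (restr s (algtens gB f)^o) N p n.
Proof.
elim/algtens_ind: p => [|b a p [x xp]].
  by exists 0; rewrite raddf0 [RHS]pure0l.
exists (@pure A (restr g B^o) (restr iA N) b (algpure gA f 1 a *: n) + x).
rewrite raddfD /= push_pure xp -pureZ [RHS]pureDl; congr (pure _ _ + _).
by rewrite [LHS]/(s _ * _) sE rmorph1 [LHS]algpureM mulr1 mul1r.
Qed.

Lemma base_change_left : base_change phir -> base_change phi.
Proof. exact: (base_change_push phirE left_gen). Qed.
End AlgTensorPushLeft.

(** * Cones of base change maps of complexes *)

Section BaseChangeComplex.
Variables (A B : comPzRingType) (g : {rmorphism A -> B}).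
Notation ext M := (tensor (restr g B^o) M).

(* The target is indexed with a shift: [bc_tgt n] sits in degree [n - 1]. *)
Record bcx := Bcx {
  bc_src : nat -> lmodType A;
  bc_tgt : nat -> lmodType B;
  bc_d : forall n, {linear bc_src n -> bc_src n.+1};
  bc_d' : forall n, {linear bc_tgt n -> bc_tgt n.+1};
  bc_phi : forall n, {linear bc_src n -> bc_tgt n.+1 | g \; *:%R};
  bc_comm : forall n x, bc_phi n.+1 (bc_d n x) = bc_d' n.+1 (bc_phi n x) }.

Record bcx_hom (X Y : bcx) := BcxHom {
  bh_src : forall n, {linear bc_src X n -> bc_src Y n};
  bh_tgt : forall n, {linear bc_tgt X n -> bc_tgt Y n};
  bh_d : forall n x, bh_src n.+1 (bc_d X n x) = bc_d Y n (bh_src n x);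
  bh_d' : forall n x, bh_tgt n.+1 (bc_d' X n x) = bc_d' Y n (bh_tgt n x);
  bh_phi : forall n x, bh_tgt n.+1 (bc_phi X n x) = bc_phi Y n (bh_src n x) }.

Definition bcx_dd (X : bcx) :=
  (forall n x, bc_d X n.+1 (bc_d X n x) = 0) /\
  (forall n x, bc_d' X n.+1 (bc_d' X n x) = 0).

Section Total.
Variable X : bcx.
(* The cone of [B (x)_A bc_src -> bc_tgt]. *)
Definition tot n : zmodType := (ext (bc_src X n) * bc_tgt X n)%type.
Definition dtot n (x : tot n) : tot n.+1 :=
  (tens_map (bc_d X n) x.1, bcmap (bc_phi X n) x.1 - bc_d' X n x.2).
Fact dtot_additive n : zmod_morphism (@dtot n).
Proof.
move=> [a b] [c d]; rewrite /dtot /= !raddfB /=; congr (_, _).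
by rewrite /= addrACA [in RHS]opprD.
Qed.
HB.instance Definition _ n :=
  GRing.isZmodMorphism.Build (tot n) (tot n.+1) (@dtot n) (@dtot_additive n).

Definition tot_exact n := exact_at (fun n => (@dtot n : {additive _ -> _})) n.

Lemma dtotK n : bcx_dd X -> forall x, @dtot n.+1 (@dtot n x) = 0.
Proof.
move=> [dd dd'] [a b]; rewrite /dtot /=; congr (_, _).
  by rewrite (@tens_map_comp _ _ _ _ _ _ _ \0) ?tens_map0.
rewrite linearB dd' subr0; apply/eqP; rewrite subr_eq0; apply/eqP/esym.
by apply: bcmap_nat => m; rewrite bc_comm.
Qed.

Definition src_exact n := forall a : bc_src X n, bc_d X n a = 0 ->
  @bd (fun n => bc_src X n) (fun n => bc_d X n) n a.
Definition tgt_exact n := forall a : bc_tgt X n, bc_d' X n a = 0 ->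
  @bd (fun n => bc_tgt X n) (fun n => bc_d' X n) n a.
End Total.

Section TotalHom.
Variables (X Y : bcx) (h : bcx_hom X Y).
Definition tot_map n (x : tot X n) : tot Y n :=
  (tens_map (bh_src h n) x.1, bh_tgt h n x.2).
Fact tot_map_additive n : zmod_morphism (@tot_map n).
Proof. by move=> [a b] [c d]; rewrite /tot_map /= !raddfB. Qed.
HB.instance Definition _ n :=
  GRing.isZmodMorphism.Build (tot X n) (tot Y n) (@tot_map n) (@tot_map_additive n).

Lemma tot_mapP n x : @tot_map n.+1 (dtot x) = dtot (@tot_map n x).
Proof.
case: x => a b; rewrite /dtot /tot_map /=; congr (_, _).
  rewrite (tens_map_comp (w := bh_src h n.+1 \o bc_d X n)) //.
  by rewrite (tens_map_comp (w := bh_src h n.+1 \o bc_d X n)) // => m; rewrite /= bh_d.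
by rewrite linearB bh_d'; congr (_ - _); apply: bcmap_nat => m; rewrite bh_phi.
Qed.

Definition bh_bij := (forall n, bijective (bh_src h n)) /\ (forall n, bijective (bh_tgt h n)).
End TotalHom.

Definition bcx_ses X Y Z (i : bcx_hom X Y) (p : bcx_hom Y Z) :=
  [/\ (forall n, injective (bh_src i n)) /\ (forall n, injective (bh_tgt i n)),
      (forall n z, exists y, bh_src p n y = z) /\ (forall n z, exists y, bh_tgt p n y = z),
      (forall n x, bh_src p n (bh_src i n x) = 0) /\
      (forall n x, bh_tgt p n (bh_tgt i n x) = 0) &
      (forall n y, bh_src p n y = 0 -> exists x, bh_src i n x = y) /\
      (forall n y, bh_tgt p n y = 0 -> exists x, bh_tgt i n x = y)].

Hypothesis g_flat : flat g.

Section Ses.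
Variables (X Y Z : bcx) (i : bcx_hom X Y) (p : bcx_hom Y Z).
Hypothesis ip : bcx_ses i p.

Let iT n : {additive tot X n -> tot Y n} := @tot_map X Y i n.
Let pT n : {additive tot Y n -> tot Z n} := @tot_map Y Z p n.

Fact ses_inj n : injective (iT n).
Proof.
by case: ip => -[i1 i2] _ _ _ [a b] [c d] [/(g_flat (i1 n))-> /i2->].
Qed.
Fact ses_surj n z : exists y, pT n y = z.
Proof.
case: ip z => _ [p1 p2] _ _ [c d].
have [a ac] := tens_map_surj (P := restr g B^o) (p1 n) c.
by have [b bd] := p2 n d; exists (a, b); congr (_, _).
Qed.
Fact ses_comp n x : pT n (iT n x) = 0.
Proof.
case: ip x => _ _ [q1 q2] _ [a b]; rewrite /= /tot_map /= q2; congr (_, _).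
by rewrite (@tens_map_comp _ _ _ _ _ _ _ \0) ?tens_map0.
Qed.
Fact ses_exact n y : pT n y = 0 -> exists x, iT n x = y.
Proof.
case: ip y => _ _ _ [q1 q2] [a b] [/= ha hb].
have [c ca] := flat_exact g_flat (q1 n) ha.
by have [d dd] := q2 n b hb; exists (c, d); congr (_, _).
Qed.

Lemma tot_exact_quot n : bcx_dd Y -> tot_exact Y n -> tot_exact X n.+1 -> tot_exact Z n.
Proof.
move=> dd; apply: (exact_quot (i := iT) (p := pT)).
- exact: (tot_mapP i).
- exact: (tot_mapP p).
- exact: ses_inj.
- exact: ses_surj.
- exact: ses_comp.
- exact: ses_exact.
- by move=> m y; apply: dtotK.
Qed.

Lemma tot_exact_sub n : bcx_dd Y -> (forall m, n = m.+1 -> tot_exact Z m) ->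
  tot_exact Y n -> tot_exact X n.
Proof.
move=> dd; apply: (exact_sub (i := iT) (p := pT)).
- exact: (tot_mapP i).
- exact: (tot_mapP p).
- exact: ses_inj.
- exact: ses_surj.
- exact: ses_comp.
- exact: ses_exact.
- by move=> m y; apply: dtotK.
Qed.

Lemma tot_exact_ext n : bcx_dd Y -> tot_exact X n -> tot_exact Z n -> tot_exact Y n.
Proof.
move=> dd; apply: (exact_ext (i := iT) (p := pT)).
- exact: (tot_mapP i).
- exact: (tot_mapP p).
- exact: ses_inj.
- exact: ses_surj.
- exact: ses_exact.
- by move=> m y; apply: dtotK.
Qed.
End Ses.

(** For a cycle [(a, b)] of the cone, flatness lifts [a] to some [a1] in the preceding degree. Then
    [bcmap a1 - b] is a cycle of the target, and a primitive of it completes [a1] to a primitive of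
    [(a, b)]. *)
Lemma tot_exact_src_tgt (X : bcx) n : bcx_dd X -> src_exact X n ->
  (if n is m.+1 then src_exact X m else True) ->
  tgt_exact X n -> tot_exact X n.
Proof.
move=> dd sn sm tn [a b] [/= da db].
case: n sn sm tn a b da db => [|n] sn sm tn a b da db.
  have a0 : a = 0.
    apply: (g_flat (u := bc_d X 0)); last by rewrite da raddf0.
    by apply: raddf_inj => x /sn.
  have := tn b; move: db; rewrite a0 raddf0 sub0r => /eqP; rewrite oppr_eq0 => /eqP-> /(_ erefl) /= ->.
  by [].
have [a1 a1a] := flat_exact g_flat sn da.
have : bc_d' X n.+1 (bcmap (bc_phi X n) a1 - b) = 0.
  rewrite linearB; apply/eqP; rewrite subr_eq0; apply/eqP.
  rewrite (bcmap_nat (phi1 := bc_phi X n.+1) (u := bc_d X n)) ?a1a.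
    by move/eqP: db; rewrite subr_eq0 => /eqP.
  by move=> m; rewrite bc_comm.
move/tn => [b1 b1b]; exists (a1, b1); rewrite /= /dtot /= a1a b1b; congr (_, _).
by rewrite opprB addrC subrK.
Qed.

Lemma tot_exact_iso (X Y : bcx) (h : bcx_hom X Y) n : bh_bij h ->
  tot_exact Y n <-> tot_exact X n.
Proof.
move=> [b1 b2].
have bT m : bijective (@tot_map _ _ h m).
  have [u' uK u'K] := b1 m; have [v' vK v'K] := b2 m.
  have u'_lin : linear u'.
    by move=> a x y; rewrite -{1}[x]u'K -{1}[y]u'K -linearP uK.
  pose u1 := HB.pack_for {linear bc_src Y m -> bc_src X m} u'
    (GRing.isLinear.Build _ _ _ _ u' u'_lin).
  exists (fun y : tot Y m => (tens_map u1 y.1, v' y.2)) => -[a b] /=;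
    congr (_, _); rewrite /= ?vK ?v'K //.
    by rewrite (@tens_map_comp _ _ _ _ _ _ _ idfun) ?tens_map_id.
  by rewrite (@tens_map_comp _ _ _ _ _ _ _ idfun) ?tens_map_id.
have [t tK Kt] := bT n; split=> [eY x dx|eX y dy].
  have : dtot (@tot_map _ _ h n x) = 0 by rewrite -tot_mapP [X in tot_map h X]dx raddf0.
  case: n t tK Kt eY x dx => [|n] t tK Kt eY x dx /eY /=.
    by move=> h0; apply: (can_inj tK); rewrite h0 raddf0.
  have [w wK Kw] := bT n; case=> b bx; exists (w b); apply: (can_inj tK).
  by rewrite /= tot_mapP Kw.
have : dtot (t y) = 0.
  have [w wK Kw] := bT n.+1; apply: (can_inj wK).
  by rewrite tot_mapP Kt raddf0.
case: n t tK Kt eX y dy => [|n] t tK Kt eX y dy /eX /=.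
  by move=> h0; rewrite -[y]Kt h0 raddf0.
by case=> b bx; exists (@tot_map _ _ h n b); rewrite -[y]Kt -bx /= tot_mapP.
Qed.

Section TotalCohomology.
Variable X : bcx.
Hypothesis tgt0 : forall c : bc_tgt X 0, c = 0.

(** Exactness of the cone in degree [n] mixes injectivity on [H^n] with surjectivity on [H^(n-1)],
    because the target is shifted. Hence the two families of conditions correspond only when all
    degrees are taken together. Degree 0 is listed apart, with zero maps in place of the missing
    differentials. *)
Lemma tot_exact_coh :
  (inj_at (\0 : bc_src X 0 -> bc_src X 0) (bc_d X 0) (\0 : bc_tgt X 1 -> bc_tgt X 1)
     (bc_phi X 0) /\ surj_at (bc_d X 0) (\0 : bc_tgt X 1 -> bc_tgt X 1) (bc_d' X 1) (bc_phi X 0)) /\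
  (forall n, inj_at (bc_d X n) (bc_d X n.+1) (bc_d' X n.+1) (bc_phi X n.+1) /\
    surj_at (bc_d X n.+1) (bc_d' X n.+1) (bc_d' X n.+2) (bc_phi X n.+1)) <->
  forall n, tot_exact X n.
Proof.
have t0 : forall m, bc_d' X 0 m = 0 by move=> m; rewrite (tgt0 m) linear0.
split=> [[[i0 s0] isn] [|[|n]]|ex].
- move=> [a b] [/= da db]; rewrite (tgt0 b); move: db; rewrite t0 subr0 => db.
  have [|l] := i0 a da 0; first by rewrite db.
  by rewrite tens_map0 // => <-.
- move=> [a b] [/= da /eqP]; rewrite subr_eq0 => /eqP db.
  have [a1 a1a] := (isn 0).1 a da b (esym db).
  have [|a2 a2d [l]] := s0 (b - bcmap (bc_phi X 0) a1).
    rewrite linearB -db; apply/eqP; rewrite subr_eq0; apply/eqP/esym.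
    rewrite (bcmap_nat (phi1 := bc_phi X 1) (u := bc_d X 0)) ?a1a // => m.
    by rewrite bc_comm.
  move=> /esym/eqP; rewrite subr_eq0 => /eqP hb.
  exists (a1 + a2, 0); rewrite /= /dtot /= raddfD /= a1a a2d addr0 linear0 subr0.
  by congr (_, _); rewrite raddfD /= -hb addrC subrK.
- move=> [a b] [/= da /eqP]; rewrite subr_eq0 => /eqP db.
  have [a1 a1a] := (isn n.+1).1 a da b (esym db).
  have [|a2 a2d [l hl]] := (isn n).2 (b - bcmap (bc_phi X n.+1) a1).
    rewrite linearB -db; apply/eqP; rewrite subr_eq0; apply/eqP/esym.
    rewrite (bcmap_nat (phi1 := bc_phi X n.+2) (u := bc_d X n.+1)) ?a1a // => m.
    by rewrite bc_comm.
  exists (a1 + a2, - l); rewrite /= /dtot /= raddfD /= a1a a2d addr0; congr (_, _).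
  by rewrite linearN hl raddfD /= opprK addrC -[b - _ - _]addrA -opprD subrK.
have Hi n a c : tens_map (bc_d X n.+1) a = 0 -> bc_d' X n.+1 c = bcmap (bc_phi X n.+1) a ->
    exists l, tens_map (bc_d X n) l = a.
  move=> da dc; have [|[b b'] [/= hb _]] := ex n.+1 (a, c); last by exists b.
  by rewrite /= /dtot /= da dc subrr.
have Hs n m : bc_d' X n.+1 m = 0 -> exists2 a, tens_map (bc_d X n) a = 0 &
    exists l, bc_d' X n l = m - bcmap (bc_phi X n) a.
  move=> dm; have [|[b b'] [/= hb hb']] := ex n.+1 (0, m).
    by rewrite /= /dtot /= !raddf0 dm subr0.
  by exists b => //; exists (- b'); rewrite linearN -hb' addrAC subrr sub0r.
split; first split.
- move=> a da l hl; exists 0; rewrite raddf0.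
  have : @dtot X 0 (a, 0) = 0 by rewrite /dtot /= da -hl linear0 subr0.
  by move=> /(ex 0) /= [->].
- move=> m /Hs[a da [l]]; rewrite t0 => h0; exists a => //; exists 0.
  by rewrite -h0.
- by move=> n; split=> [a da l hl|m dm]; [exact: (Hi n a l) | exact: Hs].
Qed.
End TotalCohomology.
End BaseChangeComplex.

(** * Sections over open subsets *)

Section Sections.
Variables (k : comPzRingType) (X : rspace k).

Definition up (x : X) : {set X} := [set p | (x <= p)%O].

Lemma in_up x p : (p \in up x) = (x <= p)%O.
Proof. by rewrite inE. Qed.

Lemma up_open x : is_open (up x).
Proof. by move=> p q pq; rewrite !in_up => xp; exact: le_trans pq. Qed.

Lemma openT : is_open [set: X]%SET.
Proof. by move=> p q _ _; rewrite in_setT. Qed.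

Lemma openI (V W : {set X}) : is_open V -> is_open W -> is_open (V :&: W).
Proof.
by move=> oV oW p q pq; rewrite !in_setI => /andP[/(oV _ _ pq)-> /(oW _ _ pq)->].
Qed.

Lemma up_sub (V : {set X}) x : is_open V -> x \in V -> up x \subset V.
Proof. by move=> oV xV; apply/subsetP => p; rewrite in_up => /oV; apply. Qed.

(* Removing from [W] the class of a minimal point [x] leaves an open set [W'] with
   [W = up x :|: W']. *)
Lemma local_global (V : {set X}) (ex : {set X} -> nat -> Prop) :
    (forall n, ex finset.set0 n) ->
    (forall (W1 W2 : {set X}) n, is_open W1 -> is_open W2 ->
       W1 \subset V -> W2 \subset V ->
       (forall m, n = m.+1 -> ex (W1 :&: W2) m) -> ex W1 n -> ex W2 n ->
       ex (W1 :|: W2) n) ->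
  forall (W : {set X}) n, is_open W -> W \subset V ->
    (forall x j, x \in W -> (j <= n)%N -> (n <= j + #|W|)%N -> ex (up x) j) -> ex W n.
Proof.
move=> ex0 MV W n; have [c] := ubnP #|W|; elim: c W n => // c IH W n Wc oW WV loc.
have [->//|[x0 x0W]] := set_0Vmem W.
pose below x := #|[set p in W | (p <= x)%O]|.
case: (arg_minnP below x0W) => x xW0 xmin; have xW : x \in W := xW0.
pose W' := [set p in W | ~~ (p <= x)%O].
have W'W : W' \subset W by apply/subsetP => p; rewrite inE => /andP[].
have oW' : is_open W'.
  move=> p q pq; rewrite !inE => /andP[/(oW _ _ pq)-> /= npx].
  by apply: contra npx => /(le_trans pq).
have W'lt : (#|W'| < #|W|)%N.
  apply: proper_card; rewrite properE W'W; apply/subsetPn; exists x => //.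
  by rewrite !inE lexx andbF.
have eW : W = up x :|: W'.
  apply/setP => p; rewrite !inE; apply/idP/idP => [pW|/orP[|/andP[]//]];
    last by move=> xp; exact: (oW _ _ xp xW).
  rewrite pW /=; have [px|] /= := boolP (p <= x)%O; rewrite ?orbT // orbF.
  (* The relation is only a preorder: minimality of [below x] makes these two sets equal, so
     [p <= x] forces [x <= p]. *)
  have /subset_leqif_cards/geq_leqif sub :
      [set q in W | (q <= p)%O] \subset [set q in W | (q <= x)%O].
    by apply/subsetP => q; rewrite !inE => /andP[-> /le_trans]; apply.
  have := xmin p pW; rewrite /below sub => /eqP/setP/(_ x).
  by rewrite !inE xW lexx.
have oI : is_open (up x :&: W') := openI (@up_open x) oW'.
have leI : (#|up x :&: W'| <= #|W'|)%N by rewrite subset_leq_card ?subsetIr.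
rewrite eW; apply: MV => //.
- exact: up_open.
- exact: subset_trans (up_sub oW xW) WV.
- exact: subset_trans W'W WV.
(* Passing to the intersection lowers the degree by one and the cardinality by at least one, which
   keeps the window of degrees inside the given one. *)
- move=> m nm; apply: IH => //.
  + exact: leq_ltn_trans leI (leq_trans W'lt Wc).
  + apply: subset_trans (subset_trans W'W WV); exact: subsetIr.
  + move=> p j /setIP[_ /(subsetP W'W) pW] jm mj; apply: loc => //.
      by rewrite nm (leq_trans jm).
    rewrite nm (leq_ltn_trans mj) // ltn_add2l; exact: leq_ltn_trans W'lt.
- by apply: loc => //; rewrite leq_addr.
- apply: IH => //; first exact: leq_trans W'lt Wc.
    exact: subset_trans W'W WV.
  move=> p j /(subsetP W'W) pW jn nj; apply: loc => //.
  by rewrite (leq_trans nj) // leq_add2l ltnW.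
Qed.

Section Def.
Variables (V : {set X}) (N : omod X).

Record sec : Type := Sec {
  sec_fun :> forall p, p \in V -> N p;
  sec_resE : forall p q (h : (p <= q)%O) (hp : p \in V) (hq : q \in V),
    mres N h (sec_fun hp) = sec_fun hq }.

HB.instance Definition _ := gen_eqMixin sec.
HB.instance Definition _ := gen_choiceMixin sec.

Lemma secP (s t : sec) : (forall p (hp : p \in V), s p hp = t p hp) -> s = t.
Proof.
case: s t => [s sP] [t tP] /= st; have e : s = t.
  by apply: functional_extensionality_dep => p; apply/funext => hp.
by case: _ / e in tP {st} *; congr Sec; exact: Prop_irrelevance.
Qed.

Program Definition sec0 := @Sec (fun p _ => 0) _.
Next Obligation. exact: linear0. Qed.
Program Definition sec_opp (s : sec) := @Sec (fun p hp => - s p hp) _.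
Next Obligation. by rewrite linearN (sec_resE s h _ hq). Qed.
Program Definition sec_add (s t : sec) := @Sec (fun p hp => s p hp + t p hp) _.
Next Obligation. by rewrite linearD (sec_resE s h _ hq) (sec_resE t h _ hq). Qed.

Fact sec_addA : associative sec_add.
Proof. by move=> s t u; apply: secP => p hp; exact: addrA. Qed.
Fact sec_addC : commutative sec_add.
Proof. by move=> s t; apply: secP => p hp; exact: addrC. Qed.
Fact sec_add0 : left_id sec0 sec_add.
Proof. by move=> s; apply: secP => p hp; exact: add0r. Qed.
Fact sec_addN : left_inverse sec0 sec_opp sec_add.
Proof. by move=> s; apply: secP => p hp; exact: addNr. Qed.
HB.instance Definition _ := GRing.isZmodule.Build sec
  sec_addA sec_addC sec_add0 sec_addN.

Lemma sec_irr (s : sec) p (h h' : p \in V) : s p h = s p h'.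
Proof. by congr (sec_fun s _); exact: bool_irrelevance. Qed.
End Def.

Section Maps.
Variables (V : {set X}) (N N' : omod X) (u : ohom N N').
Program Definition sec_map (s : sec V N) : sec V N' := @Sec V N' (fun p hp => u p (s p hp)) _.
Next Obligation. by rewrite -oh_res (sec_resE s h _ hq). Qed.
Fact sec_map_additive : zmod_morphism sec_map.
Proof. by move=> s t; apply: secP => p hp; exact: linearB. Qed.
HB.instance Definition _ :=
  GRing.isZmodMorphism.Build (sec V N) (sec V N') sec_map sec_map_additive.
End Maps.

Section Restrict.
Variables (V V' : {set X}) (sV : V' \subset V) (N : omod X).
Program Definition sec_restr (s : sec V N) : sec V' N :=
  @Sec V' N (fun p hp => s p (subsetP sV p hp)) _.
Next Obligation. exact: sec_resE. Qed.
Fact sec_restr_additive : zmod_morphism sec_restr.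
Proof. by move=> s t; apply: secP => p hp. Qed.
HB.instance Definition _ :=
  GRing.isZmodMorphism.Build (sec V N) (sec V' N) sec_restr sec_restr_additive.
End Restrict.

Definition flasque (N : omod X) := forall V (s : sec V N), is_open V ->
  exists t : sec [set: X]%SET N, forall p (hp : p \in V), t p (in_setT p) = s p hp.

Lemma flasque_restr (N : omod X) (V V' : {set X}) (sV : V' \subset V) : flasque N -> is_open V' ->
  forall s : sec V' N, exists t, sec_restr sV t = s.
Proof.
move=> fl oV' s; have [t ts] := fl _ s oV'.
exists (sec_restr (subsetT V) t); apply: secP => p hp /=.
by rewrite -ts; exact: sec_irr.
Qed.

Section MayerVietoris.
Variables (V V1 V2 V3 : {set X}) (N : omod X).
Hypotheses (s1 : V1 \subset V) (s2 : V2 \subset V).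
Hypotheses (s31 : V3 \subset V1) (s32 : V3 \subset V2).
Hypothesis cov : forall p, p \in V -> (p \in V1) || (p \in V2).
Hypothesis int : forall p, p \in V1 -> p \in V2 -> p \in V3.
Hypotheses (o1 : is_open V1) (o2 : is_open V2).

Lemma sec_separated (s t : sec V N) :
  sec_restr s1 s = sec_restr s1 t -> sec_restr s2 s = sec_restr s2 t -> s = t.
Proof.
move=> e1 e2; apply: secP => p hp.
have /orP[h|h] := cov hp.
  by have /= := congr1 (fun s : sec V1 N => s p h) e1;
    rewrite (sec_irr s _ hp) (sec_irr t _ hp).
by have /= := congr1 (fun s : sec V2 N => s p h) e2;
  rewrite (sec_irr s _ hp) (sec_irr t _ hp).
Qed.

Lemma sec_glue (t1 : sec V1 N) (t2 : sec V2 N) :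
  sec_restr s31 t1 = sec_restr s32 t2 ->
  exists s, sec_restr s1 s = t1 /\ sec_restr s2 s = t2.
Proof.
move=> e.
have agree p (h1 : p \in V1) (h2 : p \in V2) : t1 p h1 = t2 p h2.
  have h3 := int h1 h2.
  have /= := congr1 (fun s : sec V3 N => s p h3) e.
  by rewrite (sec_irr t1 _ h1) (sec_irr t2 _ h2).
have ex p (hp : p \in V) : { m : N p | (forall h, t1 p h = m) /\ (forall h, t2 p h = m) }.
  apply: cid; have /orP[h|h] := cov hp.
    by exists (t1 p h); split=> h'; [exact: sec_irr | rewrite -agree].
  by exists (t2 p h); split=> h'; [exact: agree | exact: sec_irr].
have glueP p q (h : (p <= q)%O) (hp : p \in V) (hq : q \in V) :
    mres N h (sval (ex p hp)) = sval (ex q hq).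
  case: (ex p hp) => m /= [m1 m2]; case: (ex q hq) => n /= [n1 n2].
  have /orP[h'|h'] := cov hp.
    have hq' := o1 h h'.
    by rewrite -(m1 h') -(n1 hq'); exact: sec_resE.
  have hq' := o2 h h'.
  by rewrite -(m2 h') -(n2 hq'); exact: sec_resE.
exists (Sec glueP); split; apply: secP => p hp /=.
  by case: (ex _ _) => m /= [].
by case: (ex _ _) => m /= [].
Qed.
End MayerVietoris.
End Sections.

Arguments sec_restr {k X V V'} sV {N} s.
Arguments sec_map {k X V N N'} u s.

Lemma sec_restr_map (k : comPzRingType) (X : rspace k) (V V' : {set X})
    (sV : V' \subset V) (N N' : omod X) (u : ohom N N') (s : sec V N) :
  sec_restr sV (sec_map u s) = sec_map u (sec_restr sV s).
Proof. exact: secP. Qed.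

Lemma sec_restr_irr (k : comPzRingType) (X : rspace k) (V1 V2 V V' : {set X})
    (s1 : V1 \subset V) (s1' : V' \subset V1) (s2 : V2 \subset V) (s2' : V' \subset V2)
    (N : omod X) (s : sec V N) :
  sec_restr s1' (sec_restr s1 s) = sec_restr s2' (sec_restr s2 s).
Proof. by apply: secP => p hp /=; exact: sec_irr. Qed.

(** * Operations on modules and complexes, mapping cones *)

Section OmodConstructions.
Variables (k : comPzRingType) (X : rspace k).

Section SubOmod.
Variables (N : omod X) (S : forall p, submod (N p)).
Hypothesis S_res : forall p q (h : (p <= q)%O) m, S p m -> S q (mres N h m).

Section Res.
Variables (p q : X) (h : (p <= q)%O).
Definition sub_res (m : sub_mod (S p)) : sub_mod (S q) := sub_mk (S_res h (sub_in m)).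
Fact sub_res_linear : linear_for (rres h \; *:%R) sub_res.
Proof. by move=> a m n; apply: val_inj; rewrite /= linearP. Qed.
HB.instance Definition _ := GRing.isLinear.Build _ _ _ (rres h \; *:%R)
  sub_res sub_res_linear.
End Res.

Fact sub_res_id p (h : (p <= p)%O) m : sub_res h m = m.
Proof. by apply: val_inj; exact: mres_id. Qed.
Fact sub_res_comp p q r (h : (p <= q)%O) (h' : (q <= r)%O) (h'' : (p <= r)%O) m :
  sub_res h' (sub_res h m) = sub_res h'' m.
Proof. by apply: val_inj; exact: mres_comp. Qed.

Definition sub_omod : omod X := @OMod k X (fun p => sub_mod (S p))
  (fun p q h => sub_res h) sub_res_id sub_res_comp.

Definition sub_omod_incl : ohom sub_omod N :=
  @OHom k X sub_omod N (fun p => sub_incl (S p)) (fun p q h m => erefl).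
End SubOmod.

Section Zero.
Variable p : X.
Let st : lmodType (stalk p) := (stalk p)^o.
Definition zero_sub : submod st := @Submod _ st (fun m => m = 0) erefl
  (fun m n hm hn => etrans (congr2 +%R hm hn) (addr0 0))
  (fun a m hm => etrans (congr1 (fun m : st => a *: m) hm) (scaler0 st a)).
End Zero.

Fact zero_sub_res p q (h : (p <= q)%O) (m : struct_mod X p) :
  zero_sub p m -> zero_sub q (mres (struct_mod X) h m).
Proof. by move=> ->; exact: linear0. Qed.

Definition zero_omod : omod X := sub_omod zero_sub_res.

Lemma zero_omodE p (m : zero_omod p) : m = 0.
Proof. by apply: val_inj; exact: (sub_in m). Qed.

Section Prod.
Variables (N N' : omod X).
Section Res.
Variables (p q : X) (h : (p <= q)%O).
Definition pair_omod_res (m : (N p * N' p)%type) : (N q * N' q)%type :=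
  (mres N h m.1, mres N' h m.2).
Fact pair_omod_res_linear : linear_for (rres h \; *:%R) pair_omod_res.
Proof. by move=> a [m m'] [n n']; rewrite /pair_omod_res /= !linearP. Qed.
HB.instance Definition _ := GRing.isLinear.Build _ _ _ (rres h \; *:%R)
  pair_omod_res pair_omod_res_linear.
End Res.

Fact pair_omod_res_id p (h : (p <= p)%O) m : pair_omod_res h m = m.
Proof. by case: m => m n; rewrite /pair_omod_res /= !mres_id. Qed.
Fact pair_omod_res_comp p q r (h : (p <= q)%O) (h' : (q <= r)%O) (h'' : (p <= r)%O) m :
  pair_omod_res h' (pair_omod_res h m) = pair_omod_res h'' m.
Proof. by case: m => m n; rewrite /pair_omod_res /= !(mres_comp _ _ h''). Qed.

Definition prod_omod : omod X := @OMod k X (fun p => (N p * N' p)%type)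
  (fun p q h => pair_omod_res h) pair_omod_res_id pair_omod_res_comp.
End Prod.

Lemma flasque_zero : flasque zero_omod.
Proof.
move=> V s _; exists 0 => p hp; rewrite [LHS]zero_omodE; exact/esym/zero_omodE.
Qed.

Section ProdSec.
Variables (N N' : omod X) (V : {set X}).
Program Definition sec_fst (s : sec V (prod_omod N N')) : sec V N :=
  @Sec _ _ V N (fun p hp => (s p hp).1) _.
Next Obligation. by rewrite -(sec_resE s h hp hq). Qed.
Program Definition sec_snd (s : sec V (prod_omod N N')) : sec V N' :=
  @Sec _ _ V N' (fun p hp => (s p hp).2) _.
Next Obligation. by rewrite -(sec_resE s h hp hq). Qed.
Program Definition sec_pair (s : sec V N) (t : sec V N') : sec V (prod_omod N N') :=
  @Sec _ _ V (prod_omod N N') (fun p hp => (s p hp, t p hp)) _.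
Next Obligation. by rewrite /pair_omod_res /= (sec_resE s h hp hq) (sec_resE t h hp hq). Qed.
End ProdSec.

Lemma flasque_prod (N N' : omod X) : flasque N -> flasque N' -> flasque (prod_omod N N').
Proof.
move=> fN fN' V s oV; have [t tP] := fN V (sec_fst s) oV.
have [t' tP'] := fN' V (sec_snd s) oV.
exists (sec_pair t t') => p hp /=; rewrite tP tP' /=.
by case: (sec_fun s hp).
Qed.

Record ocx := Ocx { oc :> nat -> omod X; od : forall n, ohom (oc n) (oc n.+1) }.

Definition dd_on (U : {set X}) (J : ocx) :=
  forall n p, p \in U -> forall m, od J n.+1 p (od J n p m) = 0.

Definition shift_omod (J : nat -> omod X) n : omod X := if n is m.+1 then J m else zero_omod.
Definition shift_d (J : ocx) n : ohom (shift_omod J n) (shift_omod J n.+1) :=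
  match n return ohom (shift_omod J n) (shift_omod J n.+1) with
  | 0 => ohom0 _ _
  | m.+1 => od J m
  end.
Definition shift (J : ocx) : ocx := Ocx (shift_d J).

Lemma shift_dd U J : dd_on U J -> dd_on U (shift J).
Proof. by move=> dd [|n] p pU m; [exact: linear0 | exact: dd]. Qed.

Definition flasque_cx (J : ocx) := forall n, flasque (J n).

Lemma shift_flasque J : flasque_cx J -> flasque_cx (shift J).
Proof. by move=> fl [|n]; [exact: flasque_zero | exact: fl]. Qed.

Definition obd (J : ocx) n p : J n p -> Prop :=
  match n with 0 => fun a => a = 0 | m.+1 => fun a => exists b, od J m p b = a end.

Definition stalk_exact (U : {set X}) (J : ocx) n :=
  forall p, p \in U -> forall m : J n p, od J n p m = 0 -> obd m.

(* The cone of a chain map [v : J -> I], shifted by one: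
   degree [n] is [J n (+) I (n - 1)]. *)
Section Cocone.
Variables (J I : ocx) (v : forall n, ohom (J n) (I n)).

Definition coc n : omod X := prod_omod (J n) (shift I n).

Definition coc_fun n p (m : coc n p) : coc n.+1 p :=
  (od J n p m.1, (v n p m.1 : shift I n.+1 p) - od (shift I) n p m.2).
Fact coc_linear n p : linear (@coc_fun n p).
Proof.
move=> a [m m'] [l l']; rewrite /coc_fun /= !linearP; congr (_, _).
by rewrite /= addrACA -scalerDr.
Qed.
HB.instance Definition _ n p := GRing.isLinear.Build _ _ _ _ (@coc_fun n p) (@coc_linear n p).
Fact coc_res n p q (h : (p <= q)%O) m :
  coc_fun (mres (coc n) h m) = mres (coc n.+1) h (coc_fun m).
Proof.
case: m => m m'; rewrite /coc_fun /= /pair_omod_res /= linearB.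
by rewrite !oh_res.
Qed.
Definition cocone : ocx :=
  Ocx (fun n => @OHom k X (coc n) (coc n.+1) (fun p => @coc_fun n p) (@coc_res n)).

Variable U : {set X}.
Hypothesis vP : forall n p, p \in U -> forall m, v n.+1 p (od J n p m) = od I n p (v n p m).

Lemma cocone_dd : dd_on U J -> dd_on U I -> dd_on U cocone.
Proof.
move=> ddJ ddI n p pU [m m']; rewrite /= /coc_fun /= ddJ // linearB (shift_dd ddI) //.
by rewrite subr0 vP // subrr.
Qed.

Lemma cocone_flasque : flasque_cx J -> flasque_cx I -> flasque_cx cocone.
Proof. by move=> fJ fI n; apply: flasque_prod => //; exact: shift_flasque. Qed.
End Cocone.
End OmodConstructions.

Section StalkToSections.
Variables (k : comPzRingType) (X : rspace k).

Section Germ.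
Variables (N : omod X) (p : X) (m : N p).
Definition germ_fun q (hq : q \in up p) : N q := mres N (etrans (esym (in_up p q)) hq) m.
Fact germ_res q r (h : (q <= r)%O) (hq : q \in up p) (hr : r \in up p) :
  mres N h (germ_fun hq) = germ_fun hr.
Proof. exact: mres_comp. Qed.
Definition germ : sec (up p) N := Sec germ_res.
End Germ.

Lemma up_refl (p : X) : p \in up p.
Proof. by rewrite in_up. Qed.

Lemma sec_up_eq (N : omod X) p (s t : sec (up p) N) :
  s p (up_refl p) = t p (up_refl p) -> s = t.
Proof.
move=> e; apply: secP => q hq; have pq : (p <= q)%O by rewrite -in_up.
by rewrite -(sec_resE s pq (up_refl p)) e (sec_resE t pq (up_refl p) hq).
Qed.

Lemma sec_set0 (N : omod X) (V : {set X}) (s : sec V N) : (forall p, p \notin V) -> s = 0.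
Proof. by move=> V0; apply: secP => p hp; move: (V0 p); rewrite hp. Qed.

Definition sec_exact (V : {set X}) (J : ocx X) n :=
  exact_at (fun n => (@sec_map _ X V _ _ (od J n) : {additive _ -> _})) n.

Lemma sec_exact_up (J : ocx X) p n : stalk_exact (up p) J n -> sec_exact (up p) J n.
Proof.
move=> ex s ds; have := ex p (up_refl p) (s p (up_refl p)).
have -> : od J n p (s p (up_refl p)) = 0.
  by have /(congr1 (fun s : sec (up p) _ => s p (up_refl p))) := ds.
move=> /(_ erefl); case: n s ds ex => [|n] s ds ex /= => [s0|[b bs]].
  by apply: sec_up_eq; rewrite s0.
by exists (germ b); apply: sec_up_eq; rewrite /= [germ_fun _ _]mres_id.
Qed.

Lemma stalk_exactS (U V : {set X}) (J : ocx X) n : V \subset U ->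
  stalk_exact U J n -> stalk_exact V J n.
Proof. by move=> /subsetP VU ex p /VU; exact: ex. Qed.

(** Sections over [up x] are the stalk at [x], and Mayer-Vietoris propagates exactness to unions at
    the price of one degree per step. For a flasque complex that is exact on stalks in positive
    degrees this yields vanishing of the cohomology of [V] in degrees above [#|V|]. *)
Lemma sec_exact_local (U : {set X}) (J : ocx X) (V : {set X}) n :
    flasque_cx J -> dd_on U J -> is_open V -> V \subset U ->
    (forall j, (j <= n)%N -> (n <= j + #|V|)%N -> stalk_exact U J j) ->
  sec_exact V J n.
Proof.
move=> fl dd oV VU ex.
apply: (local_global (V := U) (ex := fun V n => sec_exact V J n)) => //; last first.
- move=> x j xV jn nj; apply: sec_exact_up.
  apply: (stalk_exactS (subset_trans (up_sub oV xV) VU)); exact: ex.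
- move=> {VU oV ex n V} W1 W2 n o1 o2 s1 s2 e12 e1 e2.
  have i1 := subsetUl W1 W2; have i2 := subsetUr W1 W2.
  have j1 := subsetIl W1 W2; have j2 := subsetIr W1 W2.
  have cov p : p \in W1 :|: W2 -> (p \in W1) || (p \in W2) by rewrite in_setU.
  have int p : p \in W1 -> p \in W2 -> p \in W1 :&: W2 by rewrite in_setI => -> ->.
  move=> s ds.
  have {}/e1 b1 : sec_map (od J n) (sec_restr i1 s) = 0.
    by rewrite -sec_restr_map ds raddf0.
  have {}/e2 b2 : sec_map (od J n) (sec_restr i2 s) = 0.
    by rewrite -sec_restr_map ds raddf0.
  case: n s ds b1 b2 e12 => [|n] s ds /= b1 b2 e12.
    by apply: (sec_separated (s1 := i1) (s2 := i2) cov); rewrite raddf0.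
  case: b1 b2 => [b1 b1s] [b2 b2s].
  (* Primitives of [s] over the two pieces differ on the intersection by a cycle, which is a
     boundary by exactness one degree lower. Flasqueness extends its primitive [c] to [W1], and the
     differential of the extension corrects [b1] so that the pieces glue. *)
  have /(e12 _ erefl) : sec_map (od J n) (sec_restr j1 b1 - sec_restr j2 b2) = 0.
    rewrite raddfB /= -!sec_restr_map b1s b2s.
    by rewrite (sec_restr_irr i1 j1 i2 j2) subrr.
  have fin c : sec_restr j1 b1 - sec_restr j2 b2 = sec_restr j1 c -> sec_map (od J n) c = 0 ->
      exists b, sec_map (od J n) b = s.
    move=> e dc; have [b [bb1 bb2]] : exists b, sec_restr i1 b = b1 - c /\ sec_restr i2 b = b2.
      apply: (sec_glue i1 i2 (s31 := j1) (s32 := j2) cov int o1 o2).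
      by rewrite raddfB /= -e opprB addrC subrK.
    exists b; apply: (sec_separated (s1 := i1) (s2 := i2) cov).
      by rewrite sec_restr_map bb1 raddfB /= dc subr0.
    by rewrite sec_restr_map bb2.
  case: n s ds e12 b1 b1s b2 b2s fin => [|n] s ds e12 b1 b1s b2 b2s fin /=.
    move=> e; apply: (fin 0); first by rewrite e raddf0.
    exact: raddf0.
  case=> c cE; have [c' c'c] := flasque_restr j1 (fl n) (openI o1 o2) c.
  apply: (fin (sec_map (od J n) c')).
    by rewrite sec_restr_map c'c cE.
  by apply: secP => p hp /=; apply: dd; exact: (subsetP s1).
- move=> m s _; have -> : s = 0 by apply: sec_set0 => p; rewrite inE.
  by case: m {s} => [|m] //=; exists 0; rewrite raddf0.
Qed.
End StalkToSections.

(** * Relative exactness *)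

Section RelativeSections.
Variables (k : comPzRingType) (X Y : rspace k) (f : rmor X Y).

Definition fib (W : {set X}) (y : Y) : {set X} := [set p in W | (y <= f p)%O].

Lemma in_fib W y p : (p \in fib W y) = (p \in W) && (y <= f p)%O.
Proof. by rewrite inE. Qed.

Lemma fib_open W y : is_open W -> is_open (fib W y).
Proof.
move=> oW p q pq; rewrite !in_fib => /andP[/(oW _ _ pq)-> /= yp].
exact: le_trans yp (rm_le f pq).
Qed.

Lemma fib_sub W y : fib W y \subset W.
Proof. by apply/subsetP => p; rewrite in_fib => /andP[]. Qed.

Lemma fib_le W y p : p \in fib W y -> (y <= f p)%O.
Proof. by rewrite in_fib => /andP[]. Qed.

Lemma fibS (W W' : {set X}) y : W' \subset W -> fib W' y \subset fib W y.
Proof.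
by move=> /subsetP s; apply/subsetP => p; rewrite !in_fib => /andP[/s-> ->].
Qed.

Lemma fib_mono W y y' : (y <= y')%O -> fib W y' \subset fib W y.
Proof.
move=> yy'; apply/subsetP => p; rewrite !in_fib => /andP[-> /=].
exact: le_trans.
Qed.

(** A separate name for these sections lets them carry a module structure over [stalk y], through
    [f]. *)
Definition wsec (W : {set X}) (y : Y) (N : omod X) : Type := sec (fib W y) N.

Section Module.
Variables (W : {set X}) (y : Y) (N : omod X).
HB.instance Definition _ := GRing.Zmodule.on (wsec W y N).

Program Definition wsec_scale (a : stalk y) (s : wsec W y N) : wsec W y N :=
  @Sec _ _ (fib W y) N (fun p hp => rm_sharp f p (rres (fib_le hp) a) *: sec_fun s hp) _.
Next Obligation.
rewrite linearZ /= (sec_resE s h _ hq) -rm_res.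
by rewrite (rres_comp _ _ (fib_le hq)).
Qed.

Fact wsec_scaleA a b s : wsec_scale a (wsec_scale b s) = wsec_scale (a * b) s.
Proof. by apply: secP => p hp; rewrite /= scalerA !rmorphM. Qed.
Fact wsec_scale1 : left_id 1 wsec_scale.
Proof. by move=> s; apply: secP => p hp; rewrite /= !rmorph1 scale1r. Qed.
Fact wsec_scaleDr : right_distributive wsec_scale +%R.
Proof. by move=> a s t; apply: secP => p hp; exact: scalerDr. Qed.
Fact wsec_scaleDl s : {morph wsec_scale^~ s : a b / a + b}.
Proof. by move=> a b; apply: secP => p hp; rewrite /= !rmorphD; exact: scalerDl. Qed.
HB.instance Definition _ := GRing.Zmodule_isLmodule.Build (stalk y) (wsec W y N)
  wsec_scaleA wsec_scale1 wsec_scaleDr wsec_scaleDl.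
End Module.

Section Map.
Variables (W : {set X}) (y : Y) (N N' : omod X) (u : ohom N N').
Definition wmap (s : wsec W y N) : wsec W y N' := sec_map u s.
Fact wmap_linear : linear wmap.
Proof. by move=> a s t; apply: secP => p hp; exact: linearP. Qed.
HB.instance Definition _ := GRing.isLinear.Build _ _ _ _ wmap wmap_linear.
End Map.

Section Restr.
Variables (W W' : {set X}) (sW : W' \subset W) (y : Y) (N : omod X).
Definition wrestr (s : wsec W y N) : wsec W' y N := sec_restr (fibS y sW) s.
Fact wrestr_linear : linear wrestr.
Proof.
move=> a s t; apply: secP => p hp /=; congr (rm_sharp f p (rres _ a) *: _ + _).
exact: bool_irrelevance.
Qed.
HB.instance Definition _ := GRing.isLinear.Build _ _ _ _ wrestr wrestr_linear.
End Restr.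

Section Phi.
Variables (W : {set X}) (y y' : Y) (h : (y <= y')%O) (N : omod X).
Definition wphi (s : wsec W y N) : wsec W y' N := sec_restr (fib_mono W h) s.
Fact wphi_linear : linear_for (rres h \; *:%R) wphi.
Proof.
move=> a s t; apply: secP => p hp /=; congr (rm_sharp f p _ *: _ + _).
exact/esym/rres_comp.
Qed.
HB.instance Definition _ := GRing.isLinear.Build _ _ _ (rres h \; *:%R) wphi wphi_linear.
End Phi.

Section Complex.
Variables (y y' : Y) (h : (y <= y')%O).

Section Def.
Variables (W : {set X}) (J : ocx X).
Fact rel_comm n (x : wsec W y (J n)) :
  @wphi W y y' h (J n.+1) (wmap (od J n) x) = wmap (od J n) (wphi h x).
Proof. exact: secP. Qed.

Definition relcx : bcx (rres h) :=
  @Bcx _ _ (rres h) (fun n => wsec W y (J n)) (fun n => wsec W y' (shift J n))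
    (fun n => @wmap W y _ _ (od J n)) (fun n => @wmap W y' _ _ (od (shift J) n))
    (fun n => @wphi W y y' h (J n)) rel_comm.

(* The cone of [O_y' (x) Gamma(W /\ f^-1(U_y), J) -> Gamma(W /\ f^-1(U_y'), J)] is exact
   in degree [n]. *)
Definition rel_exact n := tot_exact relcx n.

Lemma relcx_dd (U : {set X}) : W \subset U -> dd_on U J -> bcx_dd relcx.
Proof.
move=> /subsetP WU dd; split=> n x; apply: secP => p hp.
  by apply: dd; apply: WU; move: hp; rewrite in_fib => /andP[].
by apply: (shift_dd dd); apply: WU; move: hp; rewrite in_fib => /andP[].
Qed.
End Def.

Section Hom.
Variables (W : {set X}) (J I : ocx X) (u : forall n, ohom (J n) (I n)).
Hypothesis uP : forall n p, p \in W -> forall m, u n.+1 p (od J n p m) = od I n p (u n p m).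

Definition shift_hom n : ohom (shift J n) (shift I n) :=
  match n return ohom (shift J n) (shift I n) with
  | 0 => ohom0 _ _
  | m.+1 => u m
  end.

Fact relhom_d n (x : wsec W y (J n)) :
  wmap (u n.+1) (wmap (od J n) x) = wmap (od I n) (wmap (u n) x).
Proof. by apply: secP => p hp; apply: uP; move: hp; rewrite in_fib => /andP[]. Qed.
Fact relhom_d' n (x : wsec W y' (shift J n)) :
  wmap (shift_hom n.+1) (wmap (od (shift J) n) x) =
  wmap (od (shift I) n) (wmap (shift_hom n) x).
Proof.
apply: secP => p hp; case: n x => [|n] x; first by rewrite /= linear0.
by apply: uP; move: hp; rewrite in_fib => /andP[].
Qed.
Fact relhom_phi n (x : wsec W y (J n)) :
  @wmap W y' _ _ (shift_hom n.+1) (wphi h x) = wphi h (wmap (u n) x).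
Proof. exact: secP. Qed.

Definition relhom : bcx_hom (relcx W J) (relcx W I) :=
  @BcxHom _ _ _ (relcx W J) (relcx W I) (fun n => @wmap W y _ _ (u n))
    (fun n => @wmap W y' _ _ (shift_hom n)) relhom_d relhom_d' relhom_phi.
End Hom.
Arguments relhom W {J I} u uP.

Section SplitSes.
Variables (W : {set X}) (L M N : ocx X).
Variables (i : forall n, ohom (L n) (M n)) (p : forall n, ohom (M n) (N n)).
Variable (s : forall n, ohom (N n) (M n)).
Hypothesis iP : forall n x, x \in W -> forall m, i n.+1 x (od L n x m) = od M n x (i n x m).
Hypothesis pP : forall n x, x \in W -> forall m, p n.+1 x (od M n x m) = od N n x (p n x m).
Hypothesis i_inj : forall n x, injective (i n x).
Hypothesis ps : forall n x m, p n x (s n x m) = m.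
Hypothesis pi0 : forall n x m, p n x (i n x m) = 0.
Hypothesis pi_ex : forall n x m, p n x m = 0 -> exists l, i n x l = m.

Lemma sec_map_inj (N1 N2 : omod X) (v : ohom N1 N2) V :
  (forall x, injective (v x)) -> injective (@sec_map _ _ V _ _ v).
Proof.
move=> inj t t' e; apply: secP => x hx; apply: inj.
by have /= := congr1 (fun t : sec V N2 => t x hx) e.
Qed.

Lemma sec_map_ker (N1 N2 N3 : omod X) (v : ohom N1 N2) (w : ohom N2 N3) V :
  (forall x, injective (v x)) -> (forall x m, w x m = 0 -> exists l, v x l = m) ->
  forall t : sec V N2, sec_map w t = 0 -> exists t', sec_map v t' = t.
Proof.
move=> inj ex t wt.
have lft x (hx : x \in V) : { l | v x l = t x hx }.
  apply: cid; apply: ex.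
  by have /= := congr1 (fun t : sec V N3 => t x hx) wt.
have lftP x q (hxq : (x <= q)%O) (hx : x \in V) (hq : q \in V) :
    mres N1 hxq (sval (lft x hx)) = sval (lft q hq).
  apply: inj; rewrite oh_res (svalP (lft x hx)) (svalP (lft q hq)).
  exact: sec_resE.
exists (Sec lftP); apply: secP => x hx /=; exact: (svalP (lft x hx)).
Qed.

(** Taking sections is only left exact in general. The degreewise section [s] of [p], which is not
    assumed to be a chain map, supplies surjectivity. *)
Lemma split_ses : bcx_ses (relhom W i iP) (relhom W p pP).
Proof.
split; split.
- by move=> n; exact: (sec_map_inj (@i_inj n)).
- case=> [|n]; last exact: (sec_map_inj (@i_inj n)).
  by move=> t t' _; apply: secP => x hx; exact: (etrans (zero_omodE _) (esym (zero_omodE _))).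
- by move=> n z; exists (wmap (s n) z); apply: secP => x hx; exact: ps.
- case=> [|n] z; last by exists (wmap (s n) z); apply: secP => x hx; exact: ps.
  by exists 0; apply: secP => x hx; exact: (etrans (zero_omodE _) (esym (zero_omodE _))).
- by move=> n x; apply: secP => q hq; exact: pi0.
- by case=> [|n] x; apply: secP => q hq; [exact: zero_omodE | exact: pi0].
- by move=> n t pt; exact: (sec_map_ker (@i_inj n) (@pi_ex n) pt).
- case=> [|n] t pt; last exact: (sec_map_ker (@i_inj n) (@pi_ex n) pt).
  by exists 0; apply: secP => q hq; exact: (etrans (zero_omodE _) (esym (zero_omodE _))).
Qed.
End SplitSes.
End Complex.
End RelativeSections.

Arguments wrestr {k X Y f W W'} sW {y N} s.
Arguments wmap {k X Y f W y N N'} u s.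
Arguments wphi {k X Y f W y y'} h {N} s.
Arguments relhom {k X Y} f {y y'} h W {J I} u uP.

Section PairComplex.
Section Linear.
Variables (A B : comPzRingType) (r : {rmorphism A -> B}).
Variables (M M' M1 M1' : lmodType A) (N N' : lmodType B).

Section Lin.
Variables (u : {linear M -> M1}) (u' : {linear M' -> M1'}).
Definition pair_lin (x : (M * M')%type) : (M1 * M1')%type := (u x.1, u' x.2).
Fact pair_lin_linear : linear pair_lin.
Proof. by move=> a [m m'] [n n']; rewrite /pair_lin /= !linearP. Qed.
HB.instance Definition _ := GRing.isLinear.Build _ _ _ _ pair_lin pair_lin_linear.
End Lin.

Section Semi.
Variables (u : {linear M -> N | r \; *:%R}) (u' : {linear M' -> N' | r \; *:%R}).
Definition pair_semi (x : (M * M')%type) : (N * N')%type := (u x.1, u' x.2).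
Fact pair_semi_linear : linear_for (r \; *:%R) pair_semi.
Proof. by move=> a [m m'] [n n']; rewrite /pair_semi /= !linearP. Qed.
HB.instance Definition _ := GRing.isLinear.Build _ _ _ (r \; *:%R) pair_semi pair_semi_linear.
End Semi.

Section Fork.
Variables (u : {linear M -> M1}) (u' : {linear M -> M1'}).
Definition fork_lin (x : M) : (M1 * M1')%type := (u x, u' x).
Fact fork_lin_linear : linear fork_lin.
Proof. by move=> a m n; rewrite /fork_lin !linearP. Qed.
HB.instance Definition _ := GRing.isLinear.Build _ _ _ _ fork_lin fork_lin_linear.
End Fork.

Section Diff.
Variables (u : {linear M -> M1}) (u' : {linear M' -> M1}).
Definition diff_lin (x : (M * M')%type) : M1 := u x.1 - u' x.2.
Fact diff_lin_linear : linear diff_lin.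
Proof.
move=> a [m m'] [n n']; rewrite /diff_lin /= !linearP.
by rewrite /= addrACA -scalerDr.
Qed.
HB.instance Definition _ := GRing.isLinear.Build _ _ _ _ diff_lin diff_lin_linear.
End Diff.
End Linear.

Variables (A B : comPzRingType) (g : {rmorphism A -> B}).
Hypothesis g_flat : flat g.
Variables P Q : bcx g.

Fact pair_comm n (x : (bc_src P n * bc_src Q n)%type) :
  pair_semi (bc_phi P n.+1) (bc_phi Q n.+1) (pair_lin (bc_d P n) (bc_d Q n) x) =
  pair_lin (bc_d' P n.+1) (bc_d' Q n.+1) (pair_semi (bc_phi P n) (bc_phi Q n) x).
Proof. by rewrite /pair_semi /pair_lin /= !bc_comm. Qed.

Definition pair_bcx : bcx g :=
  @Bcx _ _ g (fun n => (bc_src P n * bc_src Q n)%type) (fun n => (bc_tgt P n * bc_tgt Q n)%type)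
    (fun n => pair_lin (bc_d P n) (bc_d Q n)) (fun n => pair_lin (bc_d' P n) (bc_d' Q n))
    (fun n => pair_semi (bc_phi P n) (bc_phi Q n)) pair_comm.

Lemma pair_dd : bcx_dd P -> bcx_dd Q -> bcx_dd pair_bcx.
Proof. by move=> [p1 p2] [q1 q2]; split=> n [a b]; rewrite /= /pair_lin /= ?p1 ?p2 ?q1 ?q2. Qed.

Program Definition pair_in : bcx_hom P pair_bcx :=
  @BcxHom _ _ g P pair_bcx (fun n => fork_lin idfun \0) (fun n => fork_lin idfun \0) _ _ _.
Next Obligation. by rewrite /pair_lin /= linear0. Qed.
Next Obligation. by rewrite /pair_lin /= linear0. Qed.
Next Obligation. by rewrite /fork_lin /pair_semi /= linear0. Qed.

Program Definition pair_out : bcx_hom pair_bcx Q :=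
  @BcxHom _ _ g pair_bcx Q (fun n => snd) (fun n => snd) _ _ _.

Lemma pair_exact n : bcx_dd P -> bcx_dd Q -> tot_exact P n -> tot_exact Q n ->
  tot_exact pair_bcx n.
Proof.
move=> ddP ddQ eP eQ; apply: (tot_exact_ext g_flat (i := pair_in) (p := pair_out)) => //;
  last exact: pair_dd.
split; split=> m.
- by move=> a b [].
- by move=> a b [].
- by move=> z; exists (0, z).
- by move=> z; exists (0, z).
- by [].
- by [].
- by case=> a b /= ->; exists a.
- by case=> a b /= ->; exists a.
Qed.
End PairComplex.

Section RelExact.
Variables (k : comPzRingType) (X Y : rspace k) (f : rmor X Y).
Variables (y y' : Y) (h : (y <= y')%O).
Hypothesis h_flat : flat (rres h).

Notation rex := (rel_exact f h).

(** Both rows of the cone are exact in the degrees concerned by [sec_exact_local]. The cone in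
    degree [n] also involves degree [n - 1], hence [#|X|.+1] in place of [#|X|]. *)
Lemma rel_exact_stalk (U W : {set X}) (J : ocx X) n :
    flasque_cx J -> dd_on U J -> is_open W -> W \subset U ->
    (forall j, (j <= n)%N -> (n <= j + #|X|.+1)%N -> stalk_exact U J j) ->
  rex W J n.
Proof.
move=> fl dd oW WU ex.
have card (V : {set X}) : (#|V| <= #|X|)%N by exact: max_card.
have sec_ok m z : (m <= n)%N -> (n <= m.+1)%N -> sec_exact (fib f W z) J m.
  move=> mn nm; apply: (sec_exact_local fl dd).
  - exact: fib_open.
  - exact: subset_trans (fib_sub _ _ _) WU.
  - move=> j jm mj; apply: ex; first exact: leq_trans mn.
    apply: leq_trans nm _; rewrite addnS ltnS; apply: leq_trans mj _.
    by rewrite leq_add2l card.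
apply: tot_exact_src_tgt => //; first exact: (relcx_dd f h WU dd).
- exact: (sec_ok n y).
- by case: n {ex} sec_ok => // n sec_ok; exact: (sec_ok n y).
- have : sec_exact (fib f W y') (shift J) n; last by [].
  apply: (sec_exact_local (shift_flasque fl) (shift_dd dd)).
  + exact: fib_open.
  + exact: subset_trans (fib_sub _ _ _) WU.
  + case=> [|j] jn nj p pU m dm; first exact: zero_omodE.
    have := ex j (ltnW jn) _ p pU m.
    rewrite -addSnnS => /(_ (leq_trans nj _)); rewrite leq_add2l card => /(_ erefl).
    case: j {jn nj} m dm => [|j] m dm ex0; have m0 := ex0 dm.
      by exists (0 : shift J 0 p); rewrite [RHS]m0; exact: linear0.
    exact: m0.
Qed.

Section MayerVietoris.
Variables (W1 W2 : {set X}) (J : ocx X).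
Hypotheses (o1 : is_open W1) (o2 : is_open W2) (fl : flasque_cx J).

Let W := W1 :|: W2.
Let W3 := W1 :&: W2.
Let i1 : W1 \subset W := subsetUl W1 W2.
Let i2 : W2 \subset W := subsetUr W1 W2.
Let j1 : W3 \subset W1 := subsetIl W1 W2.
Let j2 : W3 \subset W2 := subsetIr W1 W2.
Hypothesis dd : dd_on W J.

Let R V := relcx f h V J.

Fact wrestr_map (V V' : {set X}) (s : V' \subset V) z (N N' : omod X) (u : ohom N N')
    (t : wsec f V z N) : wrestr s (wmap u t) = wmap u (wrestr s t).
Proof. exact: sec_restr_map. Qed.

Fact wrestr_phi (V V' : {set X}) (s : V' \subset V) (N : omod X)
    (t : wsec f V y N) : wrestr s (wphi h t) = wphi h (wrestr s t).
Proof. exact: sec_restr_irr. Qed.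

Program Definition mv_in : bcx_hom (R W) (pair_bcx (R W1) (R W2)) :=
  @BcxHom _ _ _ (R W) (pair_bcx (R W1) (R W2))
    (fun n => @fork_lin _ (wsec f W y (J n)) (wsec f W1 y (J n)) (wsec f W2 y (J n))
                (wrestr i1) (wrestr i2))
    (fun n => @fork_lin _ (wsec f W y' (shift J n)) (wsec f W1 y' (shift J n))
                (wsec f W2 y' (shift J n)) (wrestr i1) (wrestr i2)) _ _ _.
Next Obligation. by congr (_, _); exact: wrestr_map. Qed.
Next Obligation. by congr (_, _); exact: wrestr_map. Qed.
Next Obligation. by congr (_, _); exact: wrestr_phi. Qed.

Program Definition mv_out : bcx_hom (pair_bcx (R W1) (R W2)) (R W3) :=
  @BcxHom _ _ _ (pair_bcx (R W1) (R W2)) (R W3)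
    (fun n => @diff_lin _ (wsec f W1 y (J n)) (wsec f W2 y (J n)) (wsec f W3 y (J n))
                (wrestr j1) (wrestr j2))
    (fun n => @diff_lin _ (wsec f W1 y' (shift J n)) (wsec f W2 y' (shift J n))
                (wsec f W3 y' (shift J n)) (wrestr j1) (wrestr j2)) _ _ _.
Next Obligation. by rewrite /diff_lin /= !wrestr_map linearB. Qed.
Next Obligation. by rewrite /diff_lin /= !wrestr_map linearB. Qed.
Next Obligation. by rewrite /diff_lin /= !wrestr_phi linearB. Qed.

Section Level.
Variables (z : Y) (N : omod X).
Hypothesis flN : flasque N.

Let cov p : p \in fib f W z -> (p \in fib f W1 z) || (p \in fib f W2 z).
Proof. by rewrite !in_fib in_setU => /andP[/orP[]-> ->]; rewrite ?orbT. Qed.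
Let int p : p \in fib f W1 z -> p \in fib f W2 z -> p \in fib f W3 z.
Proof. by rewrite !in_fib in_setI => /andP[-> ->] /andP[-> _]. Qed.

Fact mv_inj : injective (fun s : wsec f W z N => (wrestr i1 s, wrestr i2 s)).
Proof. move=> s t e; apply: (sec_separated (s1 := fibS f z i1) (s2 := fibS f z i2) cov).
  exact: (congr1 fst e).
exact: (congr1 snd e). Qed.
Fact mv_surj (s : wsec f W3 z N) :
  exists t : (wsec f W1 z N * wsec f W2 z N)%type, wrestr j1 t.1 - wrestr j2 t.2 = s.
Proof.
have [t ts] := flasque_restr (fibS f z j1) flN (@fib_open _ _ _ f _ z (openI o1 o2)) s.
by exists (t, 0); rewrite /= linear0 subr0.
Qed.
Fact mv_comp (s : wsec f W z N) : wrestr j1 (wrestr i1 s) - wrestr j2 (wrestr i2 s) = 0.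
Proof. by apply/eqP; rewrite subr_eq0; apply/eqP; exact: sec_restr_irr. Qed.
Fact mv_ker (t : (wsec f W1 z N * wsec f W2 z N)%type) :
  wrestr j1 t.1 - wrestr j2 t.2 = 0 -> exists s, (wrestr i1 s, wrestr i2 s) = t.
Proof.
case: t => t1 t2 /= /eqP; rewrite subr_eq0 => /eqP e.
have [s [<- <-]] := sec_glue (fibS f z i1) (fibS f z i2) cov int
  (@fib_open _ _ _ f _ z o1) (@fib_open _ _ _ f _ z o2) e.
by exists s.
Qed.
End Level.

(** Gluing gives exactness on the left and in the middle; flasqueness makes restriction to the
    intersection surjective. *)
Lemma mv_ses : bcx_ses mv_in mv_out.
Proof.
split; split=> n.
- exact: mv_inj.
- exact: mv_inj.
- by move=> s; have [t ts] := mv_surj (@fl n) s; exists t.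
- by move=> s; have [t ts] := mv_surj (@shift_flasque _ _ _ fl n) s; exists t.
- exact: mv_comp.
- exact: mv_comp.
- exact: mv_ker.
- exact: mv_ker.
Qed.

Lemma rel_exact_mv n : (forall m, n = m.+1 -> rex W3 J m) -> rex W1 J n -> rex W2 J n ->
  rex W J n.
Proof.
move=> e3 e1 e2; apply: (tot_exact_sub h_flat mv_ses) => //.
  by apply: pair_dd; exact: (relcx_dd f h _ dd).
by apply: pair_exact => //; exact: (relcx_dd f h _ dd).
Qed.
End MayerVietoris.

Lemma rel_exact_local (U W : {set X}) (J : ocx X) n :
    flasque_cx J -> dd_on U J -> is_open W -> W \subset U ->
    (forall x j, x \in W -> (j <= n)%N -> rex (up x) J j) ->
  rex W J n.
Proof.
move=> fl dd oW WU ex.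
apply: (local_global (V := U) (ex := fun V n => rex V J n)) => //.
(* Over the empty set all conditions on stalks are vacuous. *)
- move=> m; apply: (@rel_exact_stalk finset.set0) => //.
  + by move=> i p; rewrite inE.
  + by move=> p q _; rewrite inE.
  + by move=> j _ _ p; rewrite inE.
- move=> W1 W2 m o1 o2 s1 s2; apply: rel_exact_mv => //.
  move=> i p pW; apply: dd; move: pW; rewrite in_setU => /orP[].
    exact: (subsetP s1).
  exact: (subsetP s2).
- by move=> x j xW jn _; exact: ex.
Qed.
End RelExact.

Section CoconeExact.
Variables (k : comPzRingType) (X Y : rspace k) (f : rmor X Y).
Variables (y y' : Y) (h : (y <= y')%O).
Hypothesis h_flat : flat (rres h).

Notation rex := (rel_exact f h).

Variables (W : {set X}) (J I : ocx X) (v : forall n, ohom (J n) (I n)).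
Hypothesis vP : forall n p, p \in W -> forall m, v n.+1 p (od J n p m) = od I n p (v n p m).
Hypotheses (ddJ : dd_on W J) (ddI : dd_on W I).

(* The sign makes this inclusion a chain map. *)
Section Incl.
Variable n : nat.
Definition coc_in_fun p (m : shift I n p) : cocone v n p := (0, (-1) ^+ n *: m).
Fact coc_in_linear p : linear (@coc_in_fun p).
Proof.
move=> a m m'; rewrite /coc_in_fun scalerDr !scalerA mulrC.
by congr (_, _); rewrite /= ?scaler0 ?addr0 // -scalerA.
Qed.
HB.instance Definition _ p := GRing.isLinear.Build _ _ _ _ (@coc_in_fun p) (@coc_in_linear p).
Fact coc_in_res p q (hpq : (p <= q)%O) m :
  coc_in_fun (mres (shift I n) hpq m) = mres (cocone v n) hpq (coc_in_fun m).
Proof.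
rewrite /coc_in_fun /= /pair_omod_res /= linear0 linearZ /=; congr (_, _ *: _).
by rewrite rmorphXn rmorphN1.
Qed.
Definition coc_in : ohom (shift I n) (cocone v n) :=
  @OHom k X _ _ (fun p => @coc_in_fun p) coc_in_res.

Definition coc_out : ohom (cocone v n) (J n) :=
  @OHom k X (cocone v n) (J n) (fun p => fst) (fun p q hpq m => erefl).

Definition coc_sec_fun p (m : J n p) : cocone v n p := (m, 0).
Fact coc_sec_linear p : linear (@coc_sec_fun p).
Proof. by move=> a m m'; congr (_, _); rewrite /= scaler0 addr0. Qed.
HB.instance Definition _ p := GRing.isLinear.Build _ _ _ _ (@coc_sec_fun p) (@coc_sec_linear p).
Fact coc_sec_res p q (hpq : (p <= q)%O) m :
  coc_sec_fun (mres (J n) hpq m) = mres (cocone v n) hpq (coc_sec_fun m).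
Proof. by rewrite /coc_sec_fun /= /pair_omod_res /= linear0. Qed.
Definition coc_sec : ohom (J n) (cocone v n) :=
  @OHom k X _ _ (fun p => @coc_sec_fun p) coc_sec_res.
End Incl.

Fact coc_in_d n p : p \in W -> forall m,
  coc_in n.+1 p (od (shift I) n p m) = od (cocone v) n p (coc_in n p m).
Proof.
move=> pW m; rewrite /= /coc_in_fun /coc_fun /= !linear0 sub0r; congr (_, _).
by rewrite exprS mulN1r scaleNr [in RHS]linearZ.
Qed.
Fact coc_out_d n p : p \in W -> forall m,
  coc_out n.+1 p (od (cocone v) n p m) = od J n p (coc_out n p m).
Proof. by []. Qed.

Lemma cocone_ses : bcx_ses (relhom f h W coc_in coc_in_d) (relhom f h W coc_out coc_out_d).
Proof.
apply: (@split_ses _ _ _ _ _ _ _ _ _ _ _ _ _ coc_sec) => //.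
- move=> n p m m' [/(congr1 (fun l => (-1) ^+ n *: l))].
  by rewrite !scalerA -expr2 -exprM mulnC exprM sqrrN expr1n expr1n !scale1r.
- move=> n p [a b] /= ->; exists ((-1) ^+ n *: b); rewrite /coc_in_fun scalerA.
  by rewrite -expr2 -exprM mulnC exprM sqrrN expr1n expr1n scale1r.
Qed.

Lemma tot_shift0 (x : tot (relcx f h W (shift I)) 0) : x = 0.
Proof.
case: x => a b; congr (_, _); last by apply: secP => p hp; exact: zero_omodE.
elim/tensor_ind: a => [|c m x ->] //; rewrite addr0.
have -> : m = 0 by apply: secP => p hp; exact: zero_omodE.
exact: pure0r.
Qed.

Lemma rel_shift0 : rex W (shift I) 0.
Proof. by move=> x _; exact: tot_shift0. Qed.

Lemma rel_shift n : rex W (shift I) n.+1 <-> rex W I n.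
Proof.
split; last first.
  case: n => [|n] ex a da; last exact: (ex a da).
  by have := ex a da => /= ->; exists 0; rewrite raddf0.
case: n => [|n] ex a da; last exact: (ex a da).
have [/= b <-] := ex a da.
have b0 : b = 0 := tot_shift0 b.
by rewrite b0; exact: (raddf0 (@dtot _ _ _ (relcx f h W (shift I)) 0)).
Qed.

Let dd_cocone : bcx_dd (relcx f h W (cocone v)).
Proof. by apply: (relcx_dd f h (subxx _)); apply: cocone_dd. Qed.

(** Read off from [0 -> shift I -> cocone v -> J -> 0]. The connecting map raises the degree by one
    and [shift] lowers it again, so all degrees agree here, while [cocone_sub] asks for the cone in
    degree [n.+1]. *)
Lemma cocone_quot n : rex W (cocone v) n -> rex W I n -> rex W J n.
Proof.
by move=> e1 /rel_shift; apply: (tot_exact_quot h_flat cocone_ses).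
Qed.

Lemma cocone_sub n : rex W J n -> rex W (cocone v) n.+1 -> rex W I n.
Proof.
move=> e1 e2; apply/rel_shift; apply: (tot_exact_sub h_flat cocone_ses) => //.
by move=> m [<-].
Qed.
End CoconeExact.

(** * Injective resolutions and chain maps *)

Section InjectiveExtension.
Variables (k : comPzRingType) (X : rspace k).

Section Extend.
Variables (U : {set X}) (E N N' : omod X) (a : ohom N N').
Variable u : forall p, {linear N p -> E p}.
Hypotheses (oU : is_open U) (E_inj : injective_omod E) (uU : hom_on U u).
Hypothesis au : forall p, p \in U -> forall n, a p n = 0 -> u p n = 0.

Let img p (n' : N' p) := exists n, (p \notin U -> n = 0) /\ a p n = n'.
Fact img_0 p : @img p 0.
Proof. by exists 0; split=> //; exact: linear0. Qed.
Fact img_D p m n : @img p m -> @img p n -> @img p (m + n).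
Proof.
move=> [m' [m0 <-]] [n' [n0 <-]]; exists (m' + n'); split; last exact: linearD.
by move=> pU; rewrite m0 // n0 // addr0.
Qed.
Fact img_Z p c m : @img p m -> @img p (c *: m).
Proof.
move=> [m' [m0 <-]]; exists (c *: m'); split; last exact: linearZ.
by move=> pU; rewrite m0 // scaler0.
Qed.
Let S p := Submod (@img_0 p) (@img_D p) (@img_Z p).

Fact img_res p q (h : (p <= q)%O) m : S p m -> S q (mres N' h m).
Proof.
move=> [n [n0 <-]]; exists (mres N h n); split; last exact: oh_res.
move=> qU; rewrite n0 ?linear0 //; apply: contra qU; exact: oU.
Qed.
Let I := sub_omod img_res.

Section At.
Variable p : X.
Let t (x : I p) : E p := u p (sval (cid (sub_in x))).
Fact img_mapE (x : I p) n : (p \notin U -> n = 0) -> a p n = val x -> t x = u p n.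
Proof.
rewrite /t; case: cid => /= n' [n'0 <-] n0 ann'.
apply/eqP; rewrite -subr_eq0 -linearB; apply/eqP.
have [pU|pU] := boolP (p \in U); last by rewrite n0 // n'0 // subrr linear0.
by apply: au => //; rewrite linearB ann' subrr.
Qed.
Fact img_map_linear : linear t.
Proof.
move=> c x y; have [n [n0 nx]] := sub_in x; have [m [m0 my]] := sub_in y.
rewrite (img_mapE n0 nx) (img_mapE m0 my) -linearP; apply: img_mapE.
  by move=> pU; rewrite n0 // m0 // scaler0 addr0.
by rewrite linearP nx my.
Qed.
HB.instance Definition _ := GRing.isLinear.Build _ _ _ _ t img_map_linear.
Definition img_map : {linear I p -> E p} := t.
End At.

Fact img_map_res p q (h : (p <= q)%O) (x : I p) :
  img_map q (mres I h x) = mres E h (img_map p x).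
Proof.
have [n [n0 nx]] := sub_in x; rewrite [img_map p x](img_mapE n0 nx).
rewrite [LHS](img_mapE (n := mres N h n)).
- have [pU|pU] := boolP (p \in U); last by rewrite n0 // !linear0.
  by apply: uU => //; exact: oU h pU.
- move=> qU; rewrite n0 ?linear0 //; apply: contra qU; exact: oU.
- by rewrite oh_res nx.
Qed.

(** Injectivity on [X] is turned into injectivity for data given on [U] only. The image of [N|U] in
    [N'], extended by zero outside [U], is a submodule of [N'] because [U] is open, and [u] induces
    a morphism from it to [E]. *)
Lemma injective_extend : exists w : ohom N' E, forall p, p \in U -> forall n, w p (a p n) = u p n.
Proof.
have [w wP] := @E_inj _ _ (sub_omod_incl img_res) (OHom img_map_res) (fun p => val_inj).
exists w => p pU n.
have hn : S p (a p n) by exists n; split=> //; rewrite pU.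
rewrite -[a p n]/(val (sub_mk hn : I p)) (wP p) [LHS](@img_mapE p _ n) //.
by rewrite pU.
Qed.
End Extend.

Section Flasque.
Variables (E : omod X) (E_inj : injective_omod E).

Section Hom.
Variables (V : {set X}) (oV : is_open V) (s : sec V E).
Section At.
Variable p : X.
Let u (c : struct_mod X p) : E p :=
  match pselect (p \in V) with left hp => (c : stalk p) *: s p hp | right _ => 0 end.
Fact gen_linear : linear u.
Proof.
move=> c m n; rewrite /u; case: pselect => [hp|_]; last by rewrite scaler0 addr0.
by rewrite scalerDl scalerA.
Qed.
HB.instance Definition _ := GRing.isLinear.Build _ _ _ _ u gen_linear.
Definition gen_hom : {linear struct_mod X p -> E p} := u.
Lemma gen_homE (hp : p \in V) c : gen_hom c = (c : stalk p) *: s p hp.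
Proof. by rewrite /gen_hom /= /u; case: pselect => // hp'; rewrite (sec_irr s hp hp'). Qed.
End At.
Lemma gen_hom_on : hom_on V gen_hom.
Proof.
move=> p q h m pV qV; rewrite (gen_homE pV) (gen_homE qV) linearZ /=.
by rewrite (sec_resE s h pV qV).
Qed.
End Hom.

(** A section over [V] is a morphism to [E] from the structure sheaf on [V]; it extends to all of
    [X], and the image of 1 is the global section sought. *)
Lemma injective_flasque : flasque E.
Proof.
move=> V s oV; pose id1 : ohom (struct_mod X) (struct_mod X) :=
  @OHom k X _ _ (fun p => idfun) (fun p q h m => erefl).
have [|w wP] := injective_extend (a := id1) oV E_inj (gen_hom_on s).
  by move=> p pV n n0; rewrite [n]n0; exact: linear0.
have tP p q (h : (p <= q)%O) (hp : p \in [set: X]%SET) (hq : q \in [set: X]%SET) :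
    mres E h (w p 1) = w q 1.
  by rewrite -oh_res; congr (w q _); exact: rmorph1.
exists (Sec (sec_fun := fun p _ => w p 1) tP) => p hp /=.
by rewrite -[1]/(id1 p 1) wP // (gen_homE _ hp) scale1r.
Qed.
End Flasque.

Definition res_cx (M : omod X) (I : inj_resolution M) : ocx X := Ocx (ir_d I).

Lemma res_cx_flasque M (I : inj_resolution M) : flasque_cx (res_cx I).
Proof. by move=> n; apply: injective_flasque; exact: ir_inj. Qed.

Lemma res_cx_dd M (I : inj_resolution M) U : dd_on U (res_cx I).
Proof. by move=> n p _ m; apply/ir_exact; exists m. Qed.

Lemma res_cx_exact M (I : inj_resolution M) U n : stalk_exact U (res_cx I) n.+1.
Proof. by move=> p _ m /ir_exact. Qed.

Section ChainMap.
Variables (U : {set X}) (J : ocx X) (K M : omod X) (I : inj_resolution M).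
Hypothesis oU : is_open U.
Hypothesis J_exact : forall n, stalk_exact U J n.+1.
Variables (kap : ohom K (J 0)) (psi : forall p, {linear K p -> M p}).
Hypothesis psiU : hom_on U psi.
Hypothesis kap_psi : forall p, p \in U -> forall z, kap p z = 0 -> psi p z = 0.
Hypothesis ker_kap : forall p, p \in U -> forall j : J 0 p, od J 0 p j = 0 -> exists z, kap p z = j.

(** The invariant of the recursion: [ir_d I n] after [v] kills the kernel of [od J n] on [U], which
    is what extending it along [od J n] demands. *)
Let good n (v : ohom (J n) (I n)) := forall p, p \in U -> forall j,
  od J n p j = 0 -> ir_d I n p (v p j) = 0.

Lemma chain_map : exists v : forall n, ohom (J n) (res_cx I n),
  (forall n p, p \in U -> forall m, v n.+1 p (od J n p m) = od (res_cx I) n p (v n p m)) /\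
  (forall p, p \in U -> forall z, v 0 p (kap p z) = ir_aug I p (psi p z)).
Proof.
have step n (v : ohom (J n) (I n)) : good v ->
    exists2 w : ohom (J n.+1) (I n.+1), good w &
      forall p, p \in U -> forall m, w p (od J n p m) = ir_d I n p (v p m).
  move=> gv; have [||w wP] := @injective_extend U (I n.+1) _ _ (od J n)
      (fun p => ir_d I n p \o v p) oU (@ir_inj _ _ _ I n.+1).
  - by move=> p q h m _ _ /=; rewrite !oh_res.
  - by move=> p pU m; exact: gv.
  exists w => // p pU j /(J_exact pU)[b <-]; rewrite wP // /=.
  by apply/ir_exact; exists (v p b).
have [v0 v0P] := @injective_extend U (I 0) _ _ kap (fun p => ir_aug I p \o psi p)
  oU (@ir_inj _ _ _ I 0) 
    (fun p q h m pU qU => etrans (congr1 (ir_aug I q) (psiU h m pU qU)) (oh_res _ _ _))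
  (fun p pU z kz => etrans (congr1 (ir_aug I p) (kap_psi pU kz)) (linear0 _)).
have g0 : good v0.
  move=> p pU j /(ker_kap pU)[z <-]; rewrite v0P //=.
  by apply/ir_exact0; exists (psi p z).
(* The recursion carries the invariant along, and the commuting squares are read off from the choice
   made at each step. *)
pose st n := { v : ohom (J n) (I n) | good v }.
pose next n (s : st n) : st n.+1 :=
  let c := cid2 (step n (sval s) (svalP s)) in exist _ (s2val c) (s2valP c).
pose v n := nat_rect st (exist _ v0 g0) next n.
exists (fun n => sval (v n)); split=> [n p pU m|p pU z]; last exact: v0P.
exact: (s2valP' (cid2 (step n (sval (v n)) (svalP (v n))))).
Qed.
End ChainMap.
End InjectiveExtension.

Section Resolutions.
Variables (k : comPzRingType) (X : rspace k).

(** The terms are required to be flasque and not injective, since infinite direct sums of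
    injectives, used below, need not be injective. *)
Definition resolves (U : {set X}) (J : ocx X) (M : omod X) := [/\ flasque_cx J, dd_on U J,
  (forall n, stalk_exact U J n.+1) & exists kap : ohom M (J 0),
  forall p, p \in U -> injective (kap p) /\
    forall j, od J 0 p j = 0 <-> exists z, kap p z = j].

Section CoconeResolves.
Variables (U : {set X}) (J : ocx X) (F M : omod X) (I : inj_resolution M).

Hypothesis J_exact : forall n, stalk_exact U J n.+1.
Variables (kap : ohom F (J 0)) (psi : forall p, {linear F p -> M p}).
Hypothesis ker_kap : forall p, p \in U -> forall j : J 0 p,
  od J 0 p j = 0 <-> exists z, kap p z = j.
Variable v : forall n, ohom (J n) (res_cx I n).
Hypothesis vP : forall n p, p \in U -> forall m,
  v n.+1 p (od J n p m) = od (res_cx I) n p (v n p m).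
Hypothesis v0 : forall p, p \in U -> forall z, v 0 p (kap p z) = ir_aug I p (psi p z).

(** Together with [cocone_exact0]: the cone of a map of resolutions over a surjection [psi] resolves
    the kernel of [psi]. For a cycle [(j, e)] with [j] the boundary of [b], the element [v b - e] is
    a cycle of [I]. In degree 0 it comes from [M] and is absorbed by a lift along [psi]; in higher
    degrees it bounds. *)
Lemma cocone_exact n : (forall p, p \in U -> forall m, exists z, psi p z = m) ->
  stalk_exact U (cocone v) n.+1.
Proof.
move=> psi_surj p pU [j e] [/= dj /eqP]; rewrite subr_eq0 => /eqP ve.
have [/= b bj] := J_exact pU dj; move: ve; rewrite -bj vP // => ve.
case: n j e dj b bj ve => [|n] j e dj b bj ve.
  have [|a ae] := (ir_exact0 (v 0 p b - e : I 0 p)).1.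
    by rewrite linearB; apply/eqP; rewrite subr_eq0; apply/eqP.
  have [z zm] := psi_surj p pU a.
  exists (b - kap p z, 0); rewrite /= /coc_fun /= linear0 addr0 !linearB /= v0 // zm ae.
  rewrite (_ : od J 0 p (kap p z) = 0) ?subr0; last by apply/(ker_kap pU); exists z.
  by congr (_, _); rewrite opprB addrC subrK.
have [|a ae] := (ir_exact (v n.+1 p b - e : I n.+1 p)).1.
  by rewrite linearB; apply/eqP; rewrite subr_eq0; apply/eqP.
exists (b, a); rewrite /= /coc_fun /= bj; congr (_, _).
by apply/eqP; rewrite subr_eq addrC -subr_eq; apply/eqP; rewrite -ae.
Qed.

Lemma cocone_exact0 p (x : cocone v 0 p) : p \in U -> od (cocone v) 0 p x = 0 <->
  exists2 z, psi p z = 0 & (kap p z, 0) = x.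
Proof.
move=> pU; case: x => j e; split.
  move=> [/= dj]; rewrite subr0 => vj.
  have [z zj] := (ker_kap pU j).1 dj; exists z.
    by apply: (@ir_aug_inj _ _ _ I p); rewrite -v0 // zj vj linear0.
  by rewrite zj; congr (_, _); exact/esym/zero_omodE.
move=> [z pz [<- <-]]; rewrite /= /coc_fun /= v0 // pz !linear0 addr0.
by congr (_, _); apply/(ker_kap pU); exists z.
Qed.
End CoconeResolves.

Section Compare.
Variables (Y : rspace k) (f : rmor X Y) (y y' : Y) (h : (y <= y')%O).
Hypothesis h_flat : flat (rres h).

(** The lift of the identity of [M] to a chain map from [J] to [I] has a cone that is exact on
    stalks over [U], and two out of three applies both ways. *)
Lemma rel_exact_resolution (U W : {set X}) (J : ocx X) (M : omod X) (I : inj_resolution M) n :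
  is_open U -> is_open W -> W \subset U -> resolves U J M ->
  rel_exact f h W J n <-> rel_exact f h W (res_cx I) n.
Proof.
move=> oU oW WU [fl dd ex [kap kapP]].
have [v [vP v0]] : exists v : forall n, ohom (J n) (res_cx I n),
  (forall n p, p \in U -> forall m, v n.+1 p (od J n p m) = od (res_cx I) n p (v n p m)) /\
  (forall p, p \in U -> forall z, v 0 p (kap p z) = ir_aug I p z).
  apply: (chain_map I oU ex (psi := fun p => idfun)) => //.
    by move=> p pU z kz; apply: (kapP p pU).1; rewrite kz linear0.
  by move=> p pU j dj; apply/(kapP p pU).2.
have cex m : rel_exact f h W (cocone v) m.
  apply: (@rel_exact_stalk _ _ _ _ _ _ _ h_flat U) => //.
  - by apply: cocone_flasque => //; exact: res_cx_flasque.
  - by apply: cocone_dd => //; exact: res_cx_dd.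
  - case=> [|j] _ _.
      move=> p pU x /(cocone_exact0 (fun p pU => (kapP p pU).2) (psi := fun p => idfun) v0 _ pU).
      by move=> [z /= -> <-]; rewrite linear0.
    apply: (cocone_exact ex (fun p pU => (kapP p pU).2) (psi := fun p => idfun)) => //.
    by move=> p pU m'; exists m'.
have vW i p : p \in W -> forall m, v i.+1 p (od J i p m) = od (res_cx I) i p (v i p m).
  by move=> /(subsetP WU); exact: vP.
have ddW : dd_on W J by move=> i p /(subsetP WU); exact: dd.
have ddI : dd_on W (res_cx I) by exact: res_cx_dd.
split=> e; first exact: (cocone_sub h_flat vW ddW ddI e).
exact: (cocone_quot h_flat vW ddW ddI).
Qed.
End Compare.
End Resolutions.

(** * Quasi-coherence as base change *)

Section FiniteSupport.
Variable I : Type.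

Definition fsupp (V : zmodType) (s : I -> V) :=
  exists S : seq {classic I}, forall i, i \notin S -> s i = 0.

Lemma fsupp_finite (V : zmodType) (s : I -> V) :
  fsupp s <-> finite_set [set i | s i != 0]%classic.
Proof.
split=> [[S SP]|/(@finite_seqP {classic I})[S SE]].
  apply: sub_finite_set ((@finite_seqP {classic I} _).2 (ex_intro _ S erefl)) => i /= si.
  by apply: contraNT si => iS; rewrite SP.
exists S => i iS; apply: contraNeq iS => si.
have : [set i | s i != 0]%classic i by [].
by rewrite SE.
Qed.

Lemma fsuppW (V V' : zmodType) (s : I -> V) (t : I -> V') :
  (forall i, s i = 0 -> t i = 0) -> fsupp s -> fsupp t.
Proof. by move=> st [S SP]; exists S => i iS; rewrite st // SP. Qed.

Lemma fsuppD (V : zmodType) (s t : I -> V) : fsupp s -> fsupp t -> fsupp (fun i => s i + t i).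
Proof.
move=> [S SP] [T TP]; exists (S ++ T) => i; rewrite mem_cat negb_or => /andP[iS iT].
by rewrite SP // TP // addr0.
Qed.

(** The index type has no decidable equality, hence the classical copy and a chosen finite support;
    [fsumE] makes the choice immaterial. *)
Definition fsum (V : zmodType) (s : I -> V) : V :=
  match pselect (fsupp s) with
  | left fs => \sum_(i <- undup (sval (cid fs))) s i
  | right _ => 0
  end.

Lemma fsumE (V : zmodType) (s : I -> V) (S : seq {classic I}) :
  uniq S -> (forall i, i \notin S -> s i = 0) -> fsum s = \sum_(i <- S) s i.
Proof.
move=> uS SP; rewrite /fsum; case: pselect => [fs|]; last by case; exists S.
case: (cid fs) => T /= TP.
have red (R : seq {classic I}) :
    \sum_(i <- R) s i = \sum_(i <- [seq j <- R | s j != 0]) s i.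
  rewrite big_filter [RHS]big_mkcond; apply: eq_bigr => i _.
  by case: eqP => // ->.
rewrite red [RHS]red; apply: (perm_big (I := {classic I})); apply: uniq_perm.
- by rewrite filter_uniq // undup_uniq.
- by rewrite filter_uniq.
move=> i; rewrite !mem_filter mem_undup; have [//|si] /= := eqVneq (s i) 0.
have [|/SP /eqP] := boolP (i \in S); last by rewrite (negPf si).
by have [|/TP /eqP] := boolP (i \in T); last by rewrite (negPf si).
Qed.

Lemma fsumD (V : zmodType) (s t : I -> V) : fsupp s -> fsupp t ->
  fsum (fun i => s i + t i) = fsum s + fsum t.
Proof.
move=> [S SP] [T TP]; pose R := undup (S ++ T).
have RS i : i \notin R -> s i = 0.
  by rewrite mem_undup mem_cat negb_or => /andP[/SP].
have RT i : i \notin R -> t i = 0.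
  by rewrite mem_undup mem_cat negb_or => /andP[_ /TP].
rewrite !(fsumE (S := R)) ?undup_uniq // ?big_split // => i iR.
by rewrite RS // RT // addr0.
Qed.

Lemma fsum_morph (V V' : zmodType) (h : {additive V -> V'}) (s : I -> V) :
  fsupp s -> h (fsum s) = fsum (fun i => h (s i)).
Proof.
move=> [S SP]; pose R := undup S.
have RS i : i \notin R -> s i = 0 by rewrite mem_undup => /SP.
rewrite !(fsumE (S := R)) ?undup_uniq ?raddf_sum // => i iR.
by rewrite RS // raddf0.
Qed.

Lemma eq_fsum (V : zmodType) (s t : I -> V) : s =1 t -> fsum s = fsum t.
Proof. by move=> /funext ->. Qed.

Lemma fsum_delta (V : zmodType) (i0 : I) (s : I -> V) :
  (forall i, i <> i0 -> s i = 0) -> fsum s = s i0.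
Proof.
move=> s0; rewrite (fsumE (S := [:: (i0 : {classic I})])) ?big_seq1 // => i.
by rewrite mem_seq1 => /eqP; exact: s0.
Qed.
End FiniteSupport.

Section FreeModules.
Variables (I : Type) (A : comPzRingType).

Lemma free_fsupp (s : free_mod I A) : fsupp (s : I -> A^o).
Proof. by apply/fsupp_finite; have /asboolP := free_supp s. Qed.

Lemma mk_free_supp (s : I -> A^o) : fsupp s -> fin_supp s.
Proof. by move=> /fsupp_finite fs; exact/asboolP. Qed.

Lemma free_ext (s t : free_mod I A) : (forall i, s i = t i) -> s = t.
Proof. by move=> st; apply: val_inj; apply/funext. Qed.

Fact free_delta_supp i : fin_supp (fun j : I => (if `[< j = i >] then 1 else 0) : A^o).
Proof.
apply: mk_free_supp; exists [:: (i : {classic I})] => j.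
by rewrite mem_seq1 => /eqP ji; case: asboolP.
Qed.
Definition free_delta i : free_mod I A := FreeMod (free_delta_supp i).

Lemma free_deltaE i : free_delta i i = 1.
Proof. by rewrite /free_delta /=; case: asboolP. Qed.
Lemma free_delta_neq i j : j <> i -> free_delta i j = 0.
Proof. by rewrite /free_delta /=; case: asboolP. Qed.

Definition free_eval i (s : free_mod I A) : A := s i.
Fact free_eval_additive i : zmod_morphism (free_eval i).
Proof. by []. Qed.
HB.instance Definition _ i := GRing.isZmodMorphism.Build _ _ (free_eval i) (free_eval_additive i).

Section Lift.
Variables (M : lmodType A) (m : I -> M).
Definition free_lift (s : free_mod I A) : M := fsum (fun i => (s i : A) *: m i).
Fact free_lift_supp (s : free_mod I A) : fsupp (fun i => (s i : A) *: m i).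
Proof. by apply: fsuppW (free_fsupp s) => i ->; rewrite scale0r. Qed.
Fact free_lift_linear : linear free_lift.
Proof.
move=> a s t; rewrite /free_lift.
rewrite [a *: fsum _](fsum_morph (GRing.scale a : {additive M -> M})); last exact: free_lift_supp.
rewrite -fsumD; last exact: free_lift_supp.
  by apply: eq_fsum => i; rewrite /= scalerA -scalerDl.
by apply: fsuppW (free_fsupp s) => i ->; rewrite /= scale0r scaler0.
Qed.
HB.instance Definition _ := GRing.isLinear.Build _ _ _ _ free_lift free_lift_linear.

Lemma free_lift_delta i : free_lift (free_delta i) = m i.
Proof.
rewrite /free_lift (fsum_delta (i0 := i)) => [|j ji]; first by rewrite free_deltaE scale1r.
by rewrite free_delta_neq // scale0r.
Qed.
End Lift.

Lemma free_decomp (s : free_mod I A) : s = fsum (fun i => (s i : A) *: free_delta i).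
Proof.
apply: free_ext => j.
have fs : fsupp (fun i => (s i : A) *: free_delta i).
  by apply: fsuppW (free_fsupp s) => i ->; rewrite scale0r.
rewrite -[RHS]/(free_eval j _) (fsum_morph _ fs) (fsum_delta (i0 := j)) /=.
  by rewrite -[RHS]/(s j * free_delta j j) free_deltaE mulr1.
by move=> i ij; rewrite -[LHS]/(s i * free_delta i j) free_delta_neq ?mulr0 // => /esym.
Qed.
End FreeModules.

Section FreeBaseChange.
Variables (I : Type) (A B : comPzRingType) (g : {rmorphism A -> B}).
Variable phi : {linear free_mod I A -> free_mod I B | g \; *:%R}.
Hypothesis phiE : forall s i, phi s i = g (s i).

Notation extF := (tensor (restr g B^o) (free_mod I A)).
Let e (b : B) (s : free_mod I A) : extF := @pure A (restr g B^o) (free_mod I A) b s.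

Fact pure_r_additive b : zmod_morphism (e b).
Proof. by move=> s t; apply: (addIr (e b t)); rewrite -[LHS]pureDr !subrK. Qed.
Let ea b : {additive free_mod I A -> extF} :=
  HB.pack_for {additive free_mod I A -> extF} (e b)
    (GRing.isZmodMorphism.Build _ _ (e b) (pure_r_additive b)).

Let kap (t : free_mod I B) : extF := fsum (fun i => e (t i) (free_delta A i)).

Fact kap_supp (t : free_mod I B) : fsupp (fun i => e (t i) (free_delta A i)).
Proof. by apply: fsuppW (free_fsupp t) => i ->; exact: pure0l. Qed.

Fact phi_delta i : phi (free_delta A i) = free_delta B i.
Proof.
apply: free_ext => j; rewrite phiE.
have [->|ji] := pselect (j = i); first by rewrite !free_deltaE rmorph1.
by rewrite !free_delta_neq // rmorph0.
Qed.

(** The inverse [kap] sends [t] to the finite sum of the [t i (x) free_delta i]. *)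
Lemma free_base_change : base_change phi.
Proof.
exists kap => [x|t].
  elim/tensor_ind: x => [|b s x IHx].
    rewrite raddf0 /kap (fsumE (S := [::])) ?big_nil // => i _; exact: pure0l.
  have kD u v : kap (u + v) = kap u + kap v.
    rewrite /kap -fsumD; [|exact: kap_supp|exact: kap_supp].
    apply: eq_fsum => i; exact: pureDl.
  rewrite raddfD /= kD IHx; congr (_ + _); rewrite bcmap_pure.
  have fs : fsupp (fun i => (s i : A) *: free_delta A i).
    by apply: fsuppW (free_fsupp s) => i ->; rewrite scale0r.
  rewrite [in RHS](free_decomp s); apply: etrans (esym (fsum_morph (ea b) fs)); apply: eq_fsum => i.
  apply: etrans (pureZ _ _ _); congr pure.
  by rewrite -[LHS]/(b * phi s i) phiE mulrC.
rewrite [kap t]/(fsum _) (fsum_morph _ (kap_supp t)) [RHS]free_decomp.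
by apply: eq_fsum => i /=; rewrite bcmap_pure phi_delta.
Qed.
End FreeBaseChange.

Section RightExactBaseChange.
Variables (A B : comPzRingType) (g : {rmorphism A -> B}).
Variables (L M N : lmodType A) (u : {linear L -> M}) (v : {linear M -> N}).
Variables (L' M' N' : lmodType B) (u' : {linear L' -> M'}) (v' : {linear M' -> N'}).
Variables (rL : {linear L -> L' | g \; *:%R}) (rM : {linear M -> M' | g \; *:%R}).
Variable (rN : {linear N -> N' | g \; *:%R}).
Hypothesis u_r : forall l, u' (rL l) = rM (u l).
Hypothesis v_r : forall m, v' (rM m) = rN (v m).
Hypothesis v_surj : forall n, exists m, v m = n.
Hypothesis uv_exact : forall m, v m = 0 <-> exists l, u l = m.
Hypothesis bL : base_change rL.
Hypothesis bM : base_change rM.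

Notation ext M := (tensor (restr g B^o) M).

Let uv0 (x : ext L) : tens_map v (tens_map u x) = 0.
Proof.
rewrite (@tens_map_comp _ _ _ _ _ _ _ \0) ?tens_map0 // => l.
by apply/uv_exact; exists l.
Qed.

Lemma base_change_coker : (forall n, exists m, v' m = n) ->
  (forall m, v' m = 0 -> exists l, u' l = m) -> base_change rN.
Proof.
move=> v's uv'; have [kL hL hL'] := bL; have [kM hM hM'] := bM.
apply: base_changeP => [|n].
  apply: raddf_inj => x; have [z <-] := tens_map_surj (P := restr g B^o) v_surj x.
  rewrite /= -(bcmap_nat v_r) => /uv'[l ll].
  suff -> : z = tens_map u (kL l) by [].
  by apply: (can_inj hM); rewrite -ll -(bcmap_nat u_r) hL'.
have [m <-] := v's n; exists (tens_map v (kM m)).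
by rewrite -(bcmap_nat v_r) hM'.
Qed.

(** Extension of scalars keeps [L -> M -> N -> 0] exact, and the three base changes identify the
    result with the primed sequence. *)
Lemma coker_base_change : base_change rN ->
  (forall n, exists m, v' m = n) /\ (forall m, v' m = 0 <-> exists l, u' l = m).
Proof.
move=> [kN hN hN']; have [kL hL hL'] := bL; have [kM hM hM'] := bM.
split=> [n|m].
  have [z zn] := tens_map_surj (P := restr g B^o) v_surj (kN n).
  by exists (bcmap rM z); rewrite (bcmap_nat v_r) zn hN'.
split=> [v'm|[l <-]].
  have [|x xm] := tens_map_exact v_surj (fun m => (uv_exact m).1) (x := kM m).
    by apply: (can_inj hN); rewrite raddf0 -(bcmap_nat v_r) hM'.
  by exists (bcmap rL x); rewrite (bcmap_nat u_r) xm hM'.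
by rewrite -[l]hL' (bcmap_nat u_r) (bcmap_nat v_r) uv0 raddf0.
Qed.
End RightExactBaseChange.

Section QuasiCoherence.
Variables (k : comPzRingType) (X : rspace k) (M : omod X).

Lemma free_sheaf_base_change I p q (h : (p <= q)%O) :
  base_change (mres (free_sheaf X I) h).
Proof. exact: free_base_change. Qed.

Lemma quasi_coherent_base_change : quasi_coherent M ->
  forall p q (h : (p <= q)%O), base_change (mres M h).
Proof.
move=> qc p q h; have [U [oU pU [I [J [phi [psi [hphi hpsi ex]]]]]]] := qc p.
have qU := oU p q h pU; have [sp ep] := ex p pU; have [sq eq] := ex q qU.
apply: (@base_change_coker _ _ _ _ _ _ (phi p) (psi p) _ _ _ (phi q) (psi q)
   (mres (free_sheaf X I) h) (mres (free_sheaf X J) h)) => //.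
- by move=> l; exact: hphi.
- by move=> m; exact: hpsi.
- exact: free_sheaf_base_change.
- exact: free_sheaf_base_change.
- by move=> m /eq.
Qed.

Section Present.
Hypothesis bc : forall p q (h : (p <= q)%O), base_change (mres M h).
Variable p : X.

Definition spread (N : omod X) (q : X) (m : N p) : N q :=
  match pselect (p <= q)%O with left h => mres N h m | right _ => 0 end.
Lemma spreadE (N : omod X) q (h : (p <= q)%O) (m : N p) : spread q m = mres N h m.
Proof. by rewrite /spread; case: pselect => // h'; congr (mres N _ m); exact: bool_irrelevance. Qed.

Definition spread_lift (N : omod X) (I : Type) (m : I -> N p) q :
  {linear free_sheaf X I q -> N q} := free_lift (fun i => spread q (m i)).

Lemma spread_lift_on (N : omod X) (I : Type) (m : I -> N p) : hom_on (up p) (spread_lift m).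
Proof.
move=> q r h s; rewrite !in_up => pq pr.
rewrite [RHS](fsum_morph (mres N h : {additive _ -> _})); last exact: free_lift_supp.
apply: eq_fsum => i; rewrite (spreadE pq) (spreadE pr) /= linearZ /=.
by rewrite (mres_comp _ _ pr).
Qed.

Let rel := {s : free_sheaf X (M p) p | spread_lift (N := M) id p s = 0}.

Lemma spread_lift_delta (N : omod X) (I : Type) (m : I -> N p) i :
  spread_lift m p (free_delta _ i) = m i.
Proof. by rewrite [LHS]free_lift_delta (spreadE (lexx p)) mres_id. Qed.

(** The generators are all elements of the stalk at [p], the relations all relations among them. At
    [p] this is a presentation tautologically, and base change carries it to every [q] above [p]. *)
Lemma base_change_presented : presented_on (up p) M.
Proof.
pose phi := spread_lift (N := free_sheaf X (M p)) (sval : rel -> _).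
pose psi := spread_lift (N := M) (id : M p -> _).
exists rel, (M p), phi, psi; split; try exact: spread_lift_on.
move=> q; rewrite in_up => pq.
have on r s (h : (r <= s)%O) : (p <= r)%O -> r \in up p /\ s \in up p.
  by move=> pr; rewrite !in_up pr (le_trans pr h).
apply: (@coker_base_change _ _ _ _ _ _ (phi p) (psi p) _ _ _ (phi q) (psi q)
   (mres (free_sheaf X rel) pq) (mres (free_sheaf X (M p)) pq) (mres M pq)).
- by move=> l; apply: spread_lift_on; rewrite in_up.
- by move=> l; apply: spread_lift_on; rewrite in_up.
- by move=> n; exists (free_delta _ n); rewrite /psi spread_lift_delta.
- move=> m; split=> [pm|[l <-]].
    by exists (free_delta _ (exist _ m pm : rel)); rewrite /phi spread_lift_delta.
  pose F i : free_sheaf X rel p := (l i : stalk p) *: free_delta _ i.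
  have lF : l = fsum F := free_decomp l.
  have fs : fsupp F by apply: fsuppW (free_fsupp l) => i li; rewrite /F [l i]li scale0r.
  have fs' : fsupp (fun i => phi p (F i)).
    by apply: fsuppW fs => i ->; rewrite linear0.
  rewrite lF; apply: etrans (congr1 (psi p) (fsum_morph (phi p : {additive _ -> _}) fs)) _.
  apply: etrans (fsum_morph (psi p : {additive _ -> _}) fs') _.
  rewrite (fsumE (S := [::])) ?big_nil // => i _ /=.
  rewrite /F !linearZ /= free_lift_delta (spreadE (lexx p)) mres_id.
  by rewrite [free_lift _ _](svalP i) scaler0.
- exact: free_sheaf_base_change.
- exact: free_sheaf_base_change.
- exact: bc.
Qed.
End Present.

Lemma quasi_coherentP : quasi_coherent M <->
  forall p q (h : (p <= q)%O), base_change (mres M h).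
Proof.
split=> [|bc p]; first exact: quasi_coherent_base_change.
exists (up p); split; [exact: up_open | exact: up_refl | exact: base_change_presented].
Qed.
End QuasiCoherence.

(** * Quasi-coherent modules on a smallest open subset *)

Section DirectSum.
Variables (k : comPzRingType) (X : rspace k) (I : Type).

Section FunOmod.
Variable N : omod X.
Section Res.
Variables (p q : X) (h : (p <= q)%O).
Definition fun_res (s : I -> N p) : I -> N q := fun i => mres N h (s i).
Fact fun_res_linear : linear_for (rres h \; *:%R) fun_res.
Proof. by move=> a s t; apply/funext => i; rewrite /fun_res linearP. Qed.
HB.instance Definition _ := GRing.isLinear.Build _ _ _ (rres h \; *:%R)
  fun_res fun_res_linear.
End Res.
Fact fun_res_id p (h : (p <= p)%O) s : fun_res h s = s.
Proof. by apply/funext => i; exact: mres_id. Qed.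
Fact fun_res_comp p q r (h : (p <= q)%O) (h' : (q <= r)%O) (h'' : (p <= r)%O) s :
  fun_res h' (fun_res h s) = fun_res h'' s.
Proof. by apply/funext => i; exact: mres_comp. Qed.
Definition fun_omod : omod X := @OMod k X (fun p => (I -> N p) : lmodType (stalk p))
  (fun p q h => fun_res h) fun_res_id fun_res_comp.

Section At.
Variable p : X.
Fact fsupp_sub0 : fsupp (0 : I -> N p).
Proof. by exists [::]. Qed.
Fact fsupp_subD (s t : I -> N p) : fsupp s -> fsupp t -> fsupp (s + t).
Proof. exact: fsuppD. Qed.
Fact fsupp_subZ a (s : I -> N p) : fsupp s -> fsupp (a *: s).
Proof. by apply: fsuppW => i si; rewrite -[LHS]/(a *: s i) si scaler0. Qed.
Definition fsupp_sub : submod (fun_omod p) := Submod fsupp_sub0 fsupp_subD fsupp_subZ.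
End At.
Fact fsupp_sub_res p q (h : (p <= q)%O) (s : fun_omod p) :
  fsupp_sub p s -> fsupp_sub q (mres fun_omod h s).
Proof. by apply: fsuppW => i si; rewrite /= /fun_res si linear0. Qed.
Definition dsum : omod X := sub_omod fsupp_sub_res.

Definition dcomp p (s : dsum p) (i : I) : N p := val s i.

Lemma dsum_ext p (s t : dsum p) : (forall i, dcomp s i = dcomp t i) -> s = t.
Proof. by move=> st; apply: val_inj; apply/funext. Qed.

Lemma dsum_supp p (s : dsum p) : fsupp (dcomp s).
Proof. exact: (sub_in (S := fsupp_sub p) s). Qed.

Section Proj.
Variables (i : I) (p : X).
Definition dpr_fun (s : dsum p) : N p := dcomp s i.
Fact dpr_linear : linear dpr_fun.
Proof. by []. Qed.
HB.instance Definition _ := GRing.isLinear.Build _ _ _ _ dpr_fun dpr_linear.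
End Proj.
Definition dpr (i : I) : ohom dsum N :=
  @OHom k X dsum N (fun p => @dpr_fun i p) (fun p q h s => erefl).

Definition dinj_fun (i : I) p (m : N p) : I -> N p := fun j => if `[< j = i >] then m else 0.
Fact dinj_supp i p m : fsupp_sub p (@dinj_fun i p m).
Proof.
exists [:: (i : {classic I})] => j.
by rewrite mem_seq1 => /eqP ji; rewrite /dinj_fun; case: asboolP.
Qed.

Section Inj.
Variables (i : I) (p : X).
Definition dinj_at (m : N p) : dsum p := sub_mk (@dinj_supp i p m).
Fact dinj_linear : linear dinj_at.
Proof.
move=> a m n; apply: val_inj; apply/funext => j.
apply/esym; rewrite -[LHS]/(a *: dinj_fun i m j + dinj_fun i n j).
rewrite -[RHS]/(dinj_fun i (a *: m + n) j) /dinj_fun.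
by case: ifP => //; rewrite scaler0 addr0.
Qed.
HB.instance Definition _ := GRing.isLinear.Build _ _ _ _ dinj_at dinj_linear.
End Inj.
Fact dinj_res i p q (h : (p <= q)%O) m : dinj_at i (mres N h m) = mres dsum h (dinj_at i m).
Proof.
apply: val_inj; apply/funext => j /=.
by rewrite /fun_res /= /dinj_fun; case: ifP => //; rewrite linear0.
Qed.
Definition dinj (i : I) : ohom N dsum := @OHom k X N dsum (fun p => @dinj_at i p) (@dinj_res i).

Lemma dcomp_inj i j p m : dcomp (dinj i p m) j = if `[< j = i >] then m else 0.
Proof. by []. Qed.

Definition dcompa p (i : I) : {additive dsum p -> N p} := dpr i p.

Lemma dsum_decomp p (s : dsum p) (S : seq {classic I}) : uniq S ->
  (forall i, i \notin S -> dcomp s i = 0) -> s = \sum_(i <- S) dinj i p (dpr i p s).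
Proof.
move=> uS SP; apply: dsum_ext => j.
rewrite -[RHS]/(dcompa p j _) raddf_sum /=.
have E i : dpr j p (dinj i p (dpr i p s)) = if `[< j = i >] then dcomp s i else 0 by [].
have [jS|jS] := boolP ((j : {classic I}) \in S); last first.
  rewrite SP // big_seq big1 // => i iS; rewrite E; case: asboolP => // ji.
  by move: jS; rewrite [j]ji iS.
rewrite (bigD1_seq (j : {classic I})) //= E; case: asboolP => // _.
rewrite big1 ?addr0 // => i ij; rewrite E; case: asboolP => // ji.
by move: ij; rewrite [j]ji eqxx.
Qed.

(** As [X] is finite, the finite supports at its points have a finite union. Hence sections commute
    with arbitrary direct sums, which gives flasqueness of [dsum] and exactness of [dsum_cx]. *)
Lemma sec_fsupp (V : {set X}) (s : sec V dsum) : exists S : seq {classic I},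
  forall p (hp : p \in V) i, i \notin S -> dcomp (s p hp) i = 0.
Proof.
have /choice[T TP] p : exists T : seq {classic I},
    forall (hp : p \in V) i, i \notin T -> dcomp (s p hp) i = 0.
  have [hp|hp] := pselect (p \in V); last by exists [::].
  have [T TP] := dsum_supp (s p hp); exists T => hp' i iT.
  by rewrite (sec_irr s hp' hp) TP.
exists (flatten [seq T p | p <- enum X]) => p hp i iS; apply: TP.
by apply: contra iS => iT; apply/flatten_mapP; exists p; rewrite ?mem_enum.
Qed.

Lemma sec_decomp (V : {set X}) (s : sec V dsum) (S : seq {classic I}) : uniq S ->
    (forall p (hp : p \in V) i, i \notin S -> dcomp (s p hp) i = 0) ->
  s = \sum_(i <- S) sec_map (dinj i) (sec_map (dpr i) s).
Proof.
move=> uS SP; apply: secP => p hp.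
have ev (F : {classic I} -> sec V dsum) (R : seq {classic I}) :
    (\sum_(i <- R) F i) p hp = \sum_(i <- R) F i p hp.
  by elim: R => [|i R IH]; rewrite ?big_nil // !big_cons -IH.
by rewrite ev; apply: dsum_decomp => // i iS; exact: SP.
Qed.

Lemma flasque_dsum : flasque N -> flasque dsum.
Proof.
move=> fl V s oV; have [S0 SP0] := sec_fsupp s; pose S := undup S0.
have SP p (hp : p \in V) i : i \notin S -> dcomp (s p hp) i = 0.
  by rewrite mem_undup; exact: SP0.
have /choice[t tP] i := fl V (sec_map (dpr i) s) oV.
exists (\sum_(i <- S) sec_map (dinj i) (t i)) => p hp.
rewrite [in RHS](sec_decomp (undup_uniq S0) SP).
have ev W (F : {classic I} -> sec W dsum) (R : seq {classic I}) hW :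
    (\sum_(i <- R) F i) p hW = \sum_(i <- R) F i p hW.
  by elim: R => [|i R IH]; rewrite ?big_nil // !big_cons -IH.
by rewrite !ev; apply: eq_bigr => i _ /=; rewrite tP.
Qed.
End FunOmod.

Section Map.
Variables (N N' : omod X) (u : ohom N N').
Fact dmap_supp p (s : dsum N p) : fsupp_sub N' p (fun i => u p (dcomp s i)).
Proof. by apply: fsuppW (dsum_supp s) => i ->; exact: linear0. Qed.
Definition dmap_at p (s : dsum N p) : dsum N' p := sub_mk (dmap_supp s).
Fact dmap_linear p : linear (@dmap_at p).
Proof. by move=> a m n; apply: val_inj; apply/funext => j; exact: linearP. Qed.
HB.instance Definition _ p := GRing.isLinear.Build _ _ _ _ (@dmap_at p) (@dmap_linear p).
Fact dmap_res p q (h : (p <= q)%O) m : dmap_at (mres (dsum N) h m) = mres (dsum N') h (dmap_at m).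
Proof. by apply: val_inj; apply/funext => j /=; exact: oh_res. Qed.
Definition dmap : ohom (dsum N) (dsum N') :=
  @OHom k X (dsum N) (dsum N') (fun p => @dmap_at p) dmap_res.
Lemma dcomp_map p s i : dcomp (dmap p s) i = u p (dcomp s i).
Proof. by []. Qed.
End Map.

Section Complex.
Variable J : ocx X.
Definition dsum_cx : ocx X := Ocx (fun n => dmap (od J n)).

Lemma dsum_cx_flasque : flasque_cx J -> flasque_cx dsum_cx.
Proof. by move=> fl n; exact: flasque_dsum. Qed.

Lemma dsum_cx_dd U : dd_on U J -> dd_on U dsum_cx.
Proof.
by move=> dd n p pU m; apply: dsum_ext => i; rewrite !dcomp_map dd.
Qed.

Lemma dsum_lift (N N' : omod X) (u : ohom N N') p (s : dsum N' p) :
  (forall i, exists n, u p n = dcomp s i) -> exists t, dmap u p t = s.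
Proof.
move=> /choice[t tP].
(* The chosen preimages are reset to 0 where the component of [s] vanishes, so that the support
   stays finite. *)
pose t' i := if `[< dcomp s i = 0 >] then 0 else t i.
have ft : fsupp_sub N p t'.
  by apply: fsuppW (dsum_supp s) => i si; rewrite /t'; case: asboolP.
exists (sub_mk ft); apply: dsum_ext => i; rewrite dcomp_map -[dcomp _ i]/(t' i) /t'.
by case: asboolP => [->|_]; rewrite ?linear0.
Qed.

Lemma dsum_cx_exact U n : stalk_exact U J n -> stalk_exact U dsum_cx n.
Proof.
move=> ex p pU s ds; have {ds} ds i : od J n p (dcomp s i) = 0.
  by rewrite -dcomp_map [dmap _ p s]ds.
case: n ex s ds => [|n] ex s ds.
  by apply: dsum_ext => i; exact: (ex p pU _ (ds i)).
by apply: dsum_lift => i; exact: (ex p pU _ (ds i)).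
Qed.
End Complex.
End DirectSum.

Section SumLemmas.
Lemma pure_sumr (A : comPzRingType) (P M : lmodType A) (p : P) (T : Type) (r : seq T) (F : T -> M) :
  pure p (\sum_(i <- r) F i) = \sum_(i <- r) pure p (F i).
Proof.
by elim: r => [|i r IH]; rewrite ?big_nil ?pure0r // !big_cons pureDr IH.
Qed.

Lemma pair_sum (V W : zmodType) (T : Type) (r : seq T) (F : T -> V) (G : T -> W) :
  \sum_(i <- r) (F i, G i) = (\sum_(i <- r) F i, \sum_(i <- r) G i) :> (V * W)%type.
Proof. by elim: r => [|i r IH]; rewrite ?big_nil // !big_cons IH. Qed.
End SumLemmas.

Section DsumExact.
Variables (k : comPzRingType) (X Y : rspace k) (f : rmor X Y).
Variables (y y' : Y) (h : (y <= y')%O) (W : {set X}) (I : Type) (J : ocx X).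

Let D := dsum_cx I J.

Fact dinj_d (i : I) n p : p \in W -> forall m,
  dinj (J n.+1) i p (od J n p m) = od D n p (dinj (J n) i p m).
Proof.
move=> _ m; apply: dsum_ext => j; rewrite [RHS]dcomp_map !dcomp_inj.
by case: ifP => // _; rewrite linear0.
Qed.
Fact dpr_d (i : I) n p : p \in W -> forall m,
  dpr (J n.+1) i p (od D n p m) = od J n p (dpr (J n) i p m).
Proof. by []. Qed.

Let inj (i : I) := relhom f h W (J := J) (I := D) (fun n => dinj (J n) i) (@dinj_d i).
Let pr (i : I) := relhom f h W (J := D) (I := J) (fun n => dpr (J n) i) (@dpr_d i).

(** An element of the cone involves finitely many summands: a tensor is a finite sum of pure ones,
    and each section has a finite common support. The auxiliary claims allow any larger [S], so that
    the supports of different terms can be merged. *)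
Lemma tot_dsum_decomp n (t : tot (relcx f h W D) n) : exists S : seq {classic I},
  t = \sum_(i <- S) tot_map (inj i) (tot_map (pr i) t).
Proof.
case: t => a c.
have [S1 S1P] : exists S0 : seq {classic I}, forall S : seq {classic I}, uniq S ->
    {subset S0 <= S} ->
    a = \sum_(i <- S) tens_map (bh_src (inj i) n) (tens_map (bh_src (pr i) n) a).
  elim/tensor_ind: a => [|b s x [S0 S0P]].
    by exists [::] => S _ _; rewrite big1 // => i _; rewrite !raddf0.
  have [S1 S1P] := sec_fsupp s; exists (S0 ++ S1) => S uS sS.
  rewrite {1}(S0P S uS); last by move=> i iS; apply: sS; rewrite mem_cat iS.
  transitivity (\sum_(i <- S) pure b (bh_src (inj i) n (bh_src (pr i) n s)) +
    \sum_(i <- S) tens_map (bh_src (inj i) n) (tens_map (bh_src (pr i) n) x)).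
    congr (_ + _); rewrite -pure_sumr; congr pure; apply: sec_decomp => // p hp i iS.
    by apply: S1P; apply: contra iS => iS1; apply: sS; rewrite mem_cat iS1 orbT.
  rewrite -big_split; apply: eq_bigr => i _ /=.
  by rewrite !raddfD /= !tens_map_pure.
have [S2 S2P] : exists S0 : seq {classic I}, forall S : seq {classic I}, uniq S ->
    {subset S0 <= S} -> c = \sum_(i <- S) bh_tgt (inj i) n (bh_tgt (pr i) n c).
  case: n c {a S1 S1P} => [|n] c.
    exists [::] => S _ _; apply: secP => p hp.
    exact: (etrans (zero_omodE _) (esym (zero_omodE _))).
  have [S0 S0P] := sec_fsupp c; exists S0 => S uS sS.
  by apply: sec_decomp => // p hp i iS; apply: S0P; apply: contra iS; exact: sS.
pose S := undup (S1 ++ S2); exists S; rewrite pair_sum; congr (_, _).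
  by apply: S1P => [|i iS]; rewrite ?undup_uniq // mem_undup mem_cat iS.
by apply: S2P => [|i iS]; rewrite ?undup_uniq // mem_undup mem_cat iS orbT.
Qed.

Lemma rel_exact_dsum n : rel_exact f h W J n -> rel_exact f h W D n.
Proof.
move=> ex t dt; have [S tS] := tot_dsum_decomp t.
have cyc i : dtot (tot_map (pr i) t) = 0 by rewrite -tot_mapP [X in tot_map _ X]dt raddf0.
case: n ex t dt tS cyc => [|n] ex t dt tS cyc.
  rewrite /= tS big1 // => i _.
  by rewrite [X in tot_map _ X](ex _ (cyc i)) raddf0.
have /choice[b bE] i := ex _ (cyc i).
exists (\sum_(i <- S) tot_map (inj i) (b i)).
rewrite [RHS]tS raddf_sum; apply: eq_bigr => i _.
rewrite /= -tot_mapP; exact: (congr1 (@tot_map _ _ _ _ _ (inj i) n.+1) (bE i)).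
Qed.
End DsumExact.

Section KernelBaseChange.
Variables (A B : comPzRingType) (g : {rmorphism A -> B}).
Hypothesis g_flat : flat g.
Variables (L M N : lmodType A) (u : {linear L -> M}) (v : {linear M -> N}).
Variables (L' M' N' : lmodType B) (u' : {linear L' -> M'}) (v' : {linear M' -> N'}).
Variables (rL : {linear L -> L' | g \; *:%R}) (rM : {linear M -> M' | g \; *:%R}).
Variable (rN : {linear N -> N' | g \; *:%R}).
Hypothesis u_r : forall l, u' (rL l) = rM (u l).
Hypothesis v_r : forall m, v' (rM m) = rN (v m).
Hypotheses (u_inj : injective u) (u'_inj : injective u').
Hypothesis uv_exact : forall m, v m = 0 -> exists l, u l = m.
Hypothesis uv0' : forall l, v' (u' l) = 0.

(** By flatness [B (x) L] is still the kernel of [B (x) M -> B (x) N]. *)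
Lemma base_change_ker : base_change rM -> base_change rN -> base_change rL.
Proof.
move=> [kM hM hM'] [kN hN hN']; apply: base_changeP => [x x'|l'].
  move=> /(congr1 u'); rewrite !(bcmap_nat u_r) => /(can_inj hM).
  exact: (g_flat u_inj).
have [|x xl] := flat_exact g_flat uv_exact (x := kM (u' l')).
  by apply: (can_inj hN); rewrite -(bcmap_nat v_r) hM' uv0' raddf0.
by exists x; apply: u'_inj; rewrite (bcmap_nat u_r) xl hM'.
Qed.
End KernelBaseChange.

Section LocalQuasiCoherent.
Variables (k : comPzRingType) (X Y : rspace k) (f : rmor X Y).
Hypothesis X_flat : finite_space X.
Hypothesis resolution : forall M : omod X, inhabited (inj_resolution M).
Variables (y y' : Y) (h : (y <= y')%O).
Hypothesis h_flat : flat (rres h).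
Variable x : X.
Let U := up x.
Variable E : inj_resolution (struct_mod X).
Hypothesis E_exact : forall n, rel_exact f h U (res_cx E) n.

(** Quasi-coherence over [U] alone. The kernel of the free cover below is extended by zero, so base
    change may fail for it along restrictions that enter [U] from outside; the induction has to live
    on [U]. *)
Definition bc_on (M : omod X) := forall p q (hpq : (p <= q)%O), p \in U -> q \in U ->
  base_change (mres M hpq).

Section Cover.
Variables (M : omod X) (bcM : bc_on M).
Let psi := spread_lift (p := x) (N := M) (id : M x -> _).
Let F := free_sheaf X (M x).

Fact cover_surj q : q \in U -> forall m, exists s, psi q s = m.
Proof.
rewrite in_up => xq m; have [b _ bK] := bcM xq (up_refl x) (etrans (in_up _ _) xq).
rewrite -[m]bK; elim/tensor_ind: (b m) => [|c n z [s sz]].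
  by exists 0; rewrite [RHS]raddf0; exact: linear0.
exists ((c : stalk q) *: (free_delta (stalk q) n : F q) + s).
rewrite [LHS]linearD linearZ /= sz [RHS]raddfD /= bcmap_pure.
by congr (c *: _ + _); rewrite free_lift_delta (spreadE xq).
Qed.

Let ker p (s : F p) := (p \in U -> psi p s = 0) /\ (p \notin U -> s = 0).
Fact ker_0 p : @ker p 0. Proof. by split=> // _; exact: linear0. Qed.
Fact ker_D p s t : @ker p s -> @ker p t -> ker (s + t).
Proof.
move=> [s1 s2] [t1 t2]; split=> pU; first by rewrite linearD s1 // t1 // addr0.
by rewrite s2 // t2 // addr0.
Qed.
Fact ker_Z p a s : @ker p s -> ker (a *: s).
Proof.
move=> [s1 s2]; split=> pU; first by rewrite linearZ /= s1 // scaler0.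
by rewrite s2 // scaler0.
Qed.
Let S p := Submod (@ker_0 p) (@ker_D p) (@ker_Z p).
Fact ker_res p q (hpq : (p <= q)%O) s : S p s -> S q (mres F hpq s).
Proof.
move=> [s1 s2]; split=> qU.
  have [pU|pU] := boolP (p \in U); last by rewrite s2 // !linear0.
  by rewrite (spread_lift_on _ hpq s pU qU) s1 // linear0.
rewrite s2 ?linear0 //; apply: contra qU; exact: up_open.
Qed.
Definition cover_ker : omod X := sub_omod ker_res.

Lemma cover_ker_bc : bc_on cover_ker.
Proof.
move=> p q hpq pU qU.
pose iK := sub_omod_incl ker_res.
apply: (@base_change_ker _ _ _ (@X_flat p q hpq) (cover_ker p) (F p) (M p) (iK p) (psi p)
   (cover_ker q) (F q) (M q) (iK q) (psi q) (mres cover_ker hpq) (mres F hpq) (mres M hpq)) => //.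
- by move=> m; apply: spread_lift_on.
- move=> m pm; have Sm : S p m by split=> // ; rewrite pU.
  by exists (sub_mk Sm).
- by move=> l; exact: (sub_in l).1.
- exact: free_sheaf_base_change.
- exact: bcM.
Qed.

Let J := dsum_cx (M x) (res_cx E).

Section Aug.
Variable p : X.
Fact cover_aug_supp (s : F p) : @fsupp_sub k X (M x) (E 0) p (fun i => ir_aug E p (s i)).
Proof. by apply: fsuppW (free_fsupp s) => i ->; exact: linear0. Qed.
Definition cover_aug_at (s : F p) : J 0 p := sub_mk (cover_aug_supp s).
Fact cover_aug_linear : linear cover_aug_at.
Proof. by move=> a s t; apply: val_inj; apply/funext => i; exact: linearP. Qed.
HB.instance Definition _ := GRing.isLinear.Build _ _ _ _ cover_aug_at cover_aug_linear.
End Aug.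
Fact cover_aug_res p q (hpq : (p <= q)%O) s :
  cover_aug_at (mres F hpq s) = mres (J 0) hpq (cover_aug_at s).
Proof. by apply: val_inj; apply/funext => i; exact: oh_res. Qed.
Definition cover_aug : ohom F (J 0) := OHom cover_aug_res.

Lemma cover_aug_inj p : injective (cover_aug p).
Proof.
move=> s t st; apply: free_ext => i; apply: (@ir_aug_inj _ _ _ E p).
by have := congr1 (fun s : J 0 p => dcomp s i) st.
Qed.

Lemma cover_aug_exact p (j : J 0 p) : od J 0 p j = 0 <-> exists z, cover_aug p z = j.
Proof.
split=> [dj|[z <-]]; last first.
  by apply: dsum_ext => i; apply/ir_exact0; exists (z i).
have /choice[z zj] i : exists c, ir_aug E p c = dcomp j i.
  by apply/ir_exact0; have := congr1 (fun s : J 1 p => dcomp s i) dj.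
have fz : fin_supp z.
  apply: mk_free_supp; apply: fsuppW (dsum_supp j) => i ji.
  by apply: (@ir_aug_inj _ _ _ E p); rewrite zj ji linear0.
by exists (FreeMod fz); apply: dsum_ext => i; rewrite -zj.
Qed.

Variable IM : inj_resolution M.

(** A direct sum of copies of [E] resolves the free module [F]. Lifting the cover [psi] from [F] to
    [M] to the resolutions, the cone resolves its kernel on [U]. *)
Lemma cover_resolves : exists v : forall n, ohom (J n) (res_cx IM n),
  (forall n p, p \in U -> forall m, v n.+1 p (od J n p m) = od (res_cx IM) n p (v n p m)) /\
  resolves U (cocone v) cover_ker.
Proof.
have exJ n : stalk_exact U J n.+1 by apply: dsum_cx_exact; exact: res_cx_exact.
have ddJ : dd_on U J by apply: dsum_cx_dd; exact: res_cx_dd.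
have [v [vP v0]] := chain_map IM (@up_open _ _ x) exJ (kap := cover_aug) (psi := psi)
  (@spread_lift_on _ _ _ _ _ _) (fun p pU z kz => etrans (congr1 (psi p)
     (cover_aug_inj (etrans kz (esym (linear0 _))))) (linear0 _))
  (fun p pU j => (cover_aug_exact j).1).
exists v; split=> //; split.
- by apply: cocone_flasque; [apply: dsum_cx_flasque|]; exact: res_cx_flasque.
- by apply: cocone_dd => //; exact: res_cx_dd.
- by move=> n; apply: (cocone_exact exJ (fun p pU => @cover_aug_exact p) vP v0);
    exact: cover_surj.
pose kapf p (s : cover_ker p) : cocone v 0 p := (cover_aug p (val s), 0).
have kapl p : linear (@kapf p).
  by move=> a s t; rewrite /kapf !linearP; congr (_, _); rewrite /= scaler0 addr0.
pose kapL p := HB.pack_for {linear cover_ker p -> cocone v 0 p} (@kapf p)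
  (GRing.isLinear.Build _ _ _ _ (@kapf p) (kapl p)).
have kapR p q (hpq : (p <= q)%O) s :
    kapL q (mres cover_ker hpq s) = mres (cocone v 0) hpq (kapL p s).
  rewrite /= /kapf /= /pair_omod_res /= linear0; congr (_, _); exact: cover_aug_res.
exists (@OHom k X cover_ker (cocone v 0) kapL kapR) => p pU; split.
  by move=> s t /(congr1 fst) e; apply: val_inj; exact: (cover_aug_inj e).
move=> j; rewrite (cocone_exact0 (fun p pU => @cover_aug_exact p) v0 _ pU).
split=> [[z pz <-]|[z <-]]; last first.
  by exists (val z) => //; exact: (sub_in z).1.
have Sz : S p z by split=> //; rewrite pU.
by exists (sub_mk Sz).
Qed.
End Cover.

(* A free module covers [M] on [U_x], with a kernel of the same kind, and its
   cohomology is a sum of copies of that of the structure sheaf. So exactness for the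
   kernel in degree [n + 1] gives exactness for [M] in degree [n], while everything
   vanishes in large degrees: the induction is descending on [n]. *)
Lemma rel_exact_qc M (I : inj_resolution M) n : bc_on M -> rel_exact f h U (res_cx I) n.
Proof.
have [d] : exists d, (#|X|.+1 < n + d)%N by exists #|X|.+2; rewrite addnC leq_addr.
elim: d M I n => [|d IH] M I n nd bcM.
  apply: (@rel_exact_stalk _ _ _ _ _ _ _ h_flat U) => //.
  - exact: res_cx_flasque.
  - exact: res_cx_dd.
  - exact: up_open.
  (* Degree 0 is the only one in which a resolution is not exact on stalks, and for [n] above
     [#|X|.+1] it lies outside the window. *)
  - case=> [|j] _ nj; last exact: res_cx_exact.
    by move: nd; rewrite addn0 ltnNge -[_.+1]add0n nj.
have [v [vP rK]] := cover_resolves bcM I.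
have [IK] := resolution (cover_ker M).
have : rel_exact f h U (res_cx IK) n.+1.
  by apply: IH; [rewrite addSnnS | exact: cover_ker_bc].
have [_ eK] := @rel_exact_resolution _ _ _ f _ _ h h_flat U U (cocone v) _ IK n.+1
  (@up_open _ _ x) (@up_open _ _ x) (subxx _) rK.
move=> /eK {}eK.
apply: (cocone_sub h_flat vP) eK => //.
- by apply: dsum_cx_dd; exact: res_cx_dd.
- exact: res_cx_dd.
- exact: rel_exact_dsum.
Qed.
End LocalQuasiCoherent.

(** * Complexes with quasi-coherent cohomology *)

Section CohMap.
Variables (A B : comPzRingType) (g : {rmorphism A -> B}).
Variables (L M N : lmodType A) (u : {linear L -> M}) (v : {linear M -> N}).
Variables (L' M' N' : lmodType B) (u' : {linear L' -> M'}) (v' : {linear M' -> N'}).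
Variable b : {linear M -> M' | g \; *:%R}.
Hypothesis b_cyc : forall m, v m = 0 -> v' (b m) = 0.
Hypothesis b_bnd : forall l, exists l', u' l' = b (u l).

Fact coh_map_cycle (z : cycles v) : is_cycle v' (b (val z)).
Proof. by apply/eqP/b_cyc/eqP; exact: cycleP. Qed.
Definition coh_map_cyc (z : cycles v) : cycles v' := Cycle (coh_map_cycle z).

Definition coh_map (c : coh u v) : coh u' v' := \pi_(coh u' v') (coh_map_cyc (repr c)).

Lemma coh_mapE z : coh_map (\pi_(coh u v) z) = \pi_(coh u' v') (coh_map_cyc z).
Proof.
have [l hl] := coh_reprK u z; apply/cohE; have [l' hl'] := b_bnd l; exists l'.
by rewrite hl' hl linearB.
Qed.

Fact coh_map_linear : linear_for (g \; *:%R) coh_map.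
Proof.
move=> a; elim/cohW=> z; elim/cohW=> w.
rewrite -coh_piZ -coh_piD !coh_mapE /= -coh_piZ -coh_piD.
by congr (\pi_(coh _ _) _); apply: val_inj; rewrite /= linearP.
Qed.
HB.instance Definition _ := GRing.isLinear.Build _ _ _ (g \; *:%R) coh_map coh_map_linear.

Lemma coh_map_bij :
    (forall m, v m = 0 -> forall l', u' l' = b m -> exists l, u l = m) ->
    (forall m', v' m' = 0 -> exists2 m, v m = 0 & exists l', u' l' = m' - b m) ->
  bijective coh_map.
Proof.
move=> inj sur; have inj' : injective coh_map.
  apply: raddf_inj; elim/cohW => z; rewrite /= coh_mapE => /cohE[l' hl'].
  apply/cohE; have [||l hl] := inj (val z) _ l'; first by apply/eqP; exact: cycleP.
    by rewrite hl' /= subr0.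
  by exists l; rewrite hl; exact: (esym (subr0 _)).
have sur' x : exists y, coh_map y = x.
  elim/cohW: x => z'; have /eqP/sur[m vm [l' hl']] := cycleP z'.
  exists (\pi_(coh u v) (Cycle (introT eqP vm : is_cycle v m))).
  by rewrite coh_mapE; apply/esym/cohE; exists l'.
have /choice[t tK] := sur'; exists t => // x; apply: inj'; exact: tK.
Qed.
End CohMap.

Section CohomologySheaves.
Variables (k : comPzRingType) (X : rspace k).

Definition Hsheaf (J : ocx X) (q : nat) : omod X :=
  match q with
  | 0 => cohomology_sheaf (ohom0 (J 0) (J 0)) (od J 0)
  | q.+1 => cohomology_sheaf (od J q) (od J q.+1)
  end.

Lemma omod_iso_qc (M N : omod X) : omod_iso M N -> quasi_coherent M <-> quasi_coherent N.
Proof.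
move=> [u ub]; rewrite !quasi_coherentP.
have H p q (h : (p <= q)%O) : base_change (mres M h) <-> base_change (mres N h).
  exact: (base_change_iso (fun m => oh_res u h m) (ub p) (ub q)).
by split=> bc p q h; apply/H.
Qed.
End CohomologySheaves.

Section ShiftedResolution.
Variables (k : comPzRingType) (X : rspace k).

Definition shifts (m : nat) (I : ocx X) : ocx X := iter m (@shift k X) I.

Lemma shifts_lt m I n p (e : shifts m I n p) : (n < m)%N -> e = 0.
Proof.
elim: m n e => [|m IH] [|n] e //= nm; first exact: zero_omodE.
exact: (IH n e).
Qed.

Lemma shifts_flasque m I : flasque_cx I -> flasque_cx (shifts m I).
Proof. by elim: m => // m IH fl; exact/shift_flasque/IH. Qed.

Lemma shifts_dd m I U : dd_on U I -> dd_on U (shifts m I).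
Proof. by elim: m => // m IH dd; exact/shift_dd/IH. Qed.

Lemma shifts_exact U m I n : (forall n, stalk_exact U I n.+1) -> (m < n)%N ->
  stalk_exact U (shifts m I) n.
Proof.
move=> ex; elim: m n => [|m IH] [|n] // mn p pU e de.
have := IH n mn p pU e de; case: n mn e de => // n mn e de.
Qed.

Definition tail (J : ocx X) : ocx X := Ocx (fun n => od J n.+1).

(** A replacement for the truncation map [J -> H^m(J)[-m]] of a complex that is exact above degree
    [m], to be applied with [K] the cycles in degree [m] and [psi] the passage to classes. The
    induction drops the first term of [J]; the condition that [psi] kills boundaries makes the
    square into degree [m] commute. The last three conclusions say that [v] identifies [M] with the
    cycles of the target in degree [m]. *)
Lemma shifted_chain_map (M : omod X) (I : inj_resolution M) m (J : ocx X) (K : omod X)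
    (kap : ohom K (J m)) (psi : ohom K M) :
    (forall n, (m < n)%N -> stalk_exact [set: X]%SET J n) ->
    (forall p z, kap p z = 0 -> psi p z = 0) ->
    (forall p j, od J m p j = 0 -> exists z, kap p z = j) ->
    (forall n p (j : J n p), od J n.+1 p (od J n p j) = 0) ->
    (forall p z, obd (kap p z) -> psi p z = 0) ->
    (forall p m, exists z, psi p z = m) ->
  exists v : forall n, ohom (J n) (shifts m (res_cx I) n),
  [/\ forall n p j, v n.+1 p (od J n p j) = od (shifts m (res_cx I)) n p (v n p j),
      forall p z, v m p (kap p z) = 0 -> psi p z = 0,
      forall p z, psi p z = 0 -> v m p (kap p z) = 0 &
      forall p w, od (shifts m (res_cx I)) m p w = 0 -> exists z, v m p (kap p z) = w].
Proof.
elim: m J kap => [|m IH] J kap ex kz kerk dd bd sur.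
  have [v [vP v0]] := chain_map I (@openT _ X) (J := J) (fun n => ex n.+1 isT)
    (kap := kap) (psi := fun p => psi p) (fun p q h m _ _ => oh_res psi h m)
    (fun p _ => kz p) (fun p _ => kerk p).
  exists v; split.
  - by move=> n p j; apply: vP; rewrite finset.in_setT.
  - move=> p z; rewrite v0 ?finset.in_setT // => a0.
    by apply: (@ir_aug_inj _ _ _ I p); rewrite a0 linear0.
  - by move=> p z pz; rewrite v0 ?finset.in_setT // pz linear0.
  - move=> p w /ir_exact0[a <-]; have [z za] := sur p a; exists z.
    by rewrite v0 ?finset.in_setT // za.
have [||||||v [vP v1 v2 v3]] := IH (tail J) kap.
- by move=> n mn p pT j dj; have := ex n.+1 mn p pT j dj; case: n mn j dj.
- exact: kz.
- exact: kerk.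
- by move=> n p j; exact: dd.
- case: m {IH ex kerk dd sur} kap kz bd => [|m] kap kz bd p z /=; first exact: kz.
  exact: bd.
- exact: sur.
exists (fun n => match n return ohom (J n) (shifts m.+1 (res_cx I) n) with
  | 0 => ohom0 _ _ | n.+1 => v n end).
split=> // -[|n] p j; last exact: vP.
rewrite /= -/(shifts _ _).
case: m {IH} kap kz ex kerk bd v vP v1 v2 v3 => [|m] kap kz ex kerk bd v vP v1 v2 v3.
  have [z zj] := kerk p (od J 0 p j) (dd 0 p j).
  by rewrite -zj; apply: v2; apply: bd; exists j.
exact: zero_omodE.
Qed.
End ShiftedResolution.

Section Kernel.
Variables (k : comPzRingType) (X : rspace k) (L M N : omod X).
Variables (u : ohom L M) (v : ohom M N).

Section At.
Variable p : X.
Fact ker0 : v p 0 = 0.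
Proof. exact: linear0. Qed.
Fact kerD i j : v p i = 0 -> v p j = 0 -> v p (i + j) = 0.
Proof. by move=> hi hj; rewrite linearD hi hj addr0. Qed.
Fact kerZ a i : v p i = 0 -> v p (a *: i) = 0.
Proof. by move=> hi; rewrite linearZ /= hi scaler0. Qed.
Definition ker_sub : submod (M p) := Submod ker0 kerD kerZ.
End At.
Fact ker_sub_res p q (h : (p <= q)%O) j : ker_sub p j -> ker_sub q (mres M h j).
Proof. by move=> /= dj; rewrite oh_res dj linear0. Qed.
Definition ker_omod : omod X := sub_omod ker_sub_res.
Definition ker_incl : ohom ker_omod M := sub_omod_incl ker_sub_res.

Section Class.
Variable p : X.
Fact ker_class_cycle (z : ker_omod p) : is_cycle (v p) (val z).
Proof. apply/eqP; exact: (sub_in z). Qed.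
Definition ker_class_at (z : ker_omod p) : cohomology_sheaf u v p :=
  \pi_(coh (u p) (v p)) (Cycle (ker_class_cycle z)).
Fact ker_class_linear : linear ker_class_at.
Proof.
move=> a z w; rewrite /ker_class_at -coh_piZ -coh_piD.
by congr (\pi_(coh _ _) _); apply: val_inj.
Qed.
HB.instance Definition _ := GRing.isLinear.Build _ _ _ _ ker_class_at ker_class_linear.
End Class.
Fact ker_class_res p q (h : (p <= q)%O) z :
  ker_class_at (mres ker_omod h z) = mres (cohomology_sheaf u v) h (ker_class_at z).
Proof.
by rewrite [RHS]coh_resE; congr (\pi_(coh _ _) _); apply: val_inj.
Qed.
Definition ker_class : ohom ker_omod (cohomology_sheaf u v) := OHom ker_class_res.

Lemma ker_class0 p z : ker_class p z = 0 <-> exists l, u p l = ker_incl p z.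
Proof.
split=> [/cohE[l hl]|[l hl]].
  by exists l; rewrite hl; exact: subr0.
by apply/cohE; exists l; rewrite hl; exact: (esym (subr0 _)).
Qed.

Lemma ker_class_surj p c : exists z, ker_class p z = c.
Proof.
elim/cohW: c => z; have /eqP zz := cycleP z.
exists (sub_mk (zz : ker_sub p (val z))).
by congr (\pi_(coh _ _) _); apply: val_inj.
Qed.
End Kernel.

Section Devissage.
Variables (k : comPzRingType) (X Y : rspace k) (f : rmor X Y).
Hypothesis resolution : forall M : omod X, inhabited (inj_resolution M).
Variables (y y' : Y) (h : (y <= y')%O).
Hypothesis h_flat : flat (rres h).
Let T := [set: X]%SET.
Hypothesis qc_exact : forall M (I : inj_resolution M) n, quasi_coherent M ->
  rel_exact f h T (res_cx I) n.

Lemma rel_exact_shifts m I n : (forall n, rel_exact f h T I n) ->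
  rel_exact f h T (shifts m I) n.
Proof.
move=> ex; elim: m n => //= m IH [|n]; first exact: rel_shift0.
exact/rel_shift/IH.
Qed.

Lemma Hsheaf_class (J : ocx X) m : exists psi : ohom (ker_omod (od J m)) (Hsheaf J m),
  (forall p z, psi p z = 0 <-> obd (ker_incl (od J m) p z)) /\
  (forall p c, exists z, psi p z = c).
Proof.
case: m => [|m].
  exists (ker_class (ohom0 (J 0) (J 0)) (od J 0)); split; last exact: ker_class_surj.
  move=> p z; rewrite ker_class0; split=> [[l /= <-]|/= ->] //.
  by exists 0.
exists (ker_class (od J m) (od J m.+1)); split; last exact: ker_class_surj.
by move=> p z; rewrite ker_class0.
Qed.

(** Hypotheses [c1] and [c2] say that [v] is bijective on cohomology in degree [m]; above it neither
    complex has any, and [S] vanishes below. The injective half settles degree [m] of the cone, the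
    surjective half degree [m + 1]. *)
Lemma cocone_cut_exact (J S : ocx X) m (v : forall n, ohom (J n) (S n)) :
    (forall n p j, v n.+1 p (od J n p j) = od S n p (v n p j)) ->
    (forall n, (m < n)%N -> stalk_exact T J n) ->
    (forall n p (e : S n p), (n < m)%N -> e = 0) ->
    (forall n, (m < n)%N -> stalk_exact T S n) ->
    (forall p j, od J m p j = 0 -> v m p j = 0 -> obd j) ->
    (forall p w, od S m p w = 0 -> exists2 j, od J m p j = 0 & v m p j = w) ->
  forall n, (m <= n)%N -> stalk_exact T (cocone v) n.
Proof.
move=> vP exJ S0 exS c1 c2 [|n] mn p pT [j e] [/= dj /eqP]; rewrite subr_eq0 => /eqP ve.
  have e0 : e = 0 := zero_omodE e.
  move: mn; rewrite leqn0 => /eqP m0; subst m.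
  have /= -> : obd j by apply: c1 => //; rewrite ve e0 linear0.
  by rewrite e0.
move: mn; rewrite leq_eqVlt => /orP[/eqP mn|mn].
  subst m; have e0 : e = 0 by exact: S0.
  have [|b bj] := c1 p j dj; first by rewrite ve e0 linear0.
  exists (b, 0); rewrite /= /coc_fun /= bj; congr (_, _).
  by apply: (etrans _ (esym e0)); exact: S0.
have [b bj] := exJ _ mn p pT j dj.
have dw : od S n p (v n p b - e) = 0.
  by rewrite linearB -vP bj ve subrr.
move: mn; rewrite ltnS leq_eqVlt => /orP[/eqP mn|mn].
  subst m; have [z dz zw] := c2 p _ dw.
  exists (b - z, 0); rewrite /= /coc_fun /= linear0 subr0 !linearB /= bj zw dz.
  by rewrite subr0; congr (_, _); rewrite opprB addrC subrK.
have [c cw] : exists c : shift S n p, od (shift S) n p c = v n p b - e.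
  have := exS _ mn p pT _ dw; case: n {e ve dw j dj b bj} mn (v n p b - e) => //.
exists (b, c); rewrite /= /coc_fun /= bj; congr (_, _).
by rewrite [X in _ - X]cw opprB addrC subrK.
Qed.

Lemma cut_cocone (J : ocx X) m (I : inj_resolution (Hsheaf J m)) :
    (forall n p (j : J n p), od J n.+1 p (od J n p j) = 0) ->
    (forall n, (m < n)%N -> stalk_exact T J n) ->
  exists v : forall n, ohom (J n) (shifts m (res_cx I) n),
  (forall n p j, v n.+1 p (od J n p j) = od (shifts m (res_cx I)) n p (v n p j)) /\
  forall n, (m <= n)%N -> stalk_exact T (cocone v) n.
Proof.
move=> dd ex; have [psi [psi0 psi_s]] := Hsheaf_class J m.
have kinj p : injective (ker_incl (od J m) p) by exact: val_inj.
have kerk p j : od J m p j = 0 -> exists z, ker_incl (od J m) p z = j.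
  by move=> dj; exists (sub_mk (dj : ker_sub (od J m) p j)).
have [|v [vP v1 v2 v3]] := shifted_chain_map I ex (kap := ker_incl (od J m)) (psi := psi)
    _ kerk dd (fun p z => (psi0 p z).2) psi_s.
  move=> p z kz; have -> : z = 0 by apply: kinj; rewrite kz linear0.
  exact: linear0.
exists v; split=> //; apply: (cocone_cut_exact vP ex).
- by move=> n p e; exact: shifts_lt.
- by move=> n mn; apply: shifts_exact => // i; exact: res_cx_exact.
- by move=> p j /kerk[z <-] /v1 /psi0.
- move=> p w /v3[z zw]; exists (ker_incl (od J m) p z) => //.
  exact: (sub_in z).
Qed.

(** Up to degree [m] the summand [shift S] of the cone is zero, so the cone has the same terms and,
    below degree [m], the same cohomology as [J]. *)
Lemma Hsheaf_cocone (J S : ocx X) m (v : forall n, ohom (J n) (S n)) :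
    (forall n p (e : S n p), (n < m)%N -> e = 0) ->
  forall q, (q < m)%N -> omod_iso (Hsheaf (cocone v) q) (Hsheaf J q).
Proof.
move=> S0 q qm.
have sh0 n p (e : shift S n p) : (n < m.+1)%N -> e = 0.
  by case: n e => [|n] e nm; [exact: zero_omodE | exact: S0].
have S0' n p : (n < m)%N -> forall e : S n p, e = 0 by move=> nm e; exact: S0.
have iso (L L' : omod X) (u : ohom L (cocone v q)) (u' : ohom L' (J q)) :
    (forall p l, exists l', u' p l' = (u p l).1) ->
    (forall p l', exists l, (u p l).1 = u' p l') ->
  omod_iso (cohomology_sheaf u (od (cocone v) q)) (cohomology_sheaf u' (od J q)).
  move=> h1 h2; pose b p : {linear cocone v q p -> J q p} := fst.
  have cyc p m' : od (cocone v) q p m' = 0 -> od J q p (b p m') = 0 by move=> /(congr1 fst).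
  pose c p := @coh_map _ _ idfun _ _ _ (u p) (od (cocone v) q p) _ _ _ (u' p) (od J q p) (b p)
    (cyc p).
  have cE p z : c p (\pi_(coh (u p) (od (cocone v) q p)) z) =
    \pi_(coh (u' p) (od J q p)) 
      (@coh_map_cyc _ _ idfun _ _ (od (cocone v) q p) _ _ (od J q p) (b p) (cyc p) z).
    by apply: coh_mapE; exact: h1.
  have cl p : linear (c p) by apply: coh_map_linear; exact: h1.
  pose cL p := HB.pack_for {linear cohomology_sheaf u (od (cocone v) q) p ->
    cohomology_sheaf u' (od J q) p} (c p) (GRing.isLinear.Build _ _ _ _ (c p) (cl p)).
  have cR p r (h' : (p <= r)%O) z : cL r (mres (cohomology_sheaf u (od (cocone v) q)) h' z) =
      mres (cohomology_sheaf u' (od J q)) h' (cL p z).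
    elim/cohW: z => z; rewrite /= coh_resE !cE coh_resE.
    by congr (\pi_(coh _ _) _); apply: val_inj.
  exists (OHom cR) => p; apply: coh_map_bij; first exact: h1.
    move=> [j e] dm l' hl'; have [l hl] := h2 p l'; exists l.
    rewrite [LHS]surjective_pairing hl hl'; congr (_, _).
    by rewrite [LHS]sh0 ?[RHS]sh0 // ltnS ltnW.
  move=> j dj; exists (j, 0); last by exists 0; rewrite /= subrr linear0.
  rewrite /= /coc_fun /= dj linear0 subr0; congr (_, _).
  by apply: S0.
case: q qm iso => [|q] qm iso; apply: iso.
- by move=> p l; exists 0.
- by move=> p l; exists 0.
- by move=> p l; exists l.1.
- by move=> p l; exists (l, 0).
Qed.

(* The cone of a map from [J] to a shifted injective resolution of its last
   cohomology sheaf has one cohomology sheaf less. *)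
Lemma rel_exact_devissage m (J : ocx X) : flasque_cx J ->
    (forall n p (j : J n p), od J n.+1 p (od J n p j) = 0) ->
    (forall q, (q < m)%N -> quasi_coherent (Hsheaf J q)) ->
    (forall q, (m <= q)%N -> stalk_exact T J q) ->
  forall n, rel_exact f h T J n.
Proof.
elim: m J => [|m IH] J fl dd qc ex n.
  apply: (@rel_exact_stalk _ _ _ _ _ _ _ h_flat T) => //; last by move=> j _ _; exact: ex.
have [I] := resolution (Hsheaf J m).
have [v [vP vex]] := cut_cocone I dd ex.
have Sdd U : dd_on U (shifts m (res_cx I)) by apply: shifts_dd; exact: res_cx_dd.
have Jdd U : dd_on U J by move=> i p _; exact: dd.
apply: (cocone_quot h_flat (v := v)) => //.
- apply: IH => //.
  + by apply: cocone_flasque => //; apply: shifts_flasque; exact: res_cx_flasque.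
  + by move=> i p; apply: (cocone_dd (U := T)) => //; exact: finset.in_setT.
  + move=> q qm; apply/(omod_iso_qc (Hsheaf_cocone v _ qm)); last by apply: qc; exact: ltnW.
    by move=> i p e; exact: shifts_lt.
- apply: rel_exact_shifts => i; apply: qc_exact; exact: qc.
Qed.

End Devissage.

(** * Enough injectives *)


Section RationalsModIntegers.
Definition int_rat : {pred rat} := fun x => `[< exists n : int, x = n%:~R >].

Fact int_rat_closed : zmod_closed int_rat.
Proof.
split; first by apply/asboolP; exists 0.
move=> _ _ /asboolP[m ->] /asboolP[n ->]; apply/asboolP; exists (m - n).
by rewrite rmorphB.
Qed.
HB.instance Definition _ := GRing.isZmodClosed.Build rat int_rat int_rat_closed.

Definition QZ : zmodType := @Quotient.quot rat int_rat.

Definition qz (x : rat) : QZ := \pi_(@Quotient.quot rat int_rat) x.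
Fact qz_additive : zmod_morphism qz.
Proof.
move=> x y; have D a b : qz (a + b) = qz a + qz b by exact: Quotient.pi_add.
by apply: (addIr (qz y)); rewrite -D !subrK.
Qed.
HB.instance Definition _ := GRing.isZmodMorphism.Build rat QZ qz qz_additive.

Lemma qz_surj d : exists x, qz x = d.
Proof. by exists (repr d); exact: reprK. Qed.

Lemma qz_eq0 x : qz x = 0 <-> exists n : int, x = n%:~R.
Proof.
rewrite -(raddf0 qz); split=> [/eqP|[n xn]].
  by rewrite -Quotient.idealrBE subr0 => /asboolP.
by apply/eqP; rewrite -Quotient.idealrBE subr0; apply/asboolP; exists n.
Qed.

Lemma QZ_divisible (d : QZ) n : (0 < n)%N -> exists e : QZ, e *+ n = d.
Proof.
move=> n0; have [x <-] := qz_surj d; exists (qz (x / n%:R)).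
by rewrite -raddfMn -(mulr_natr (x / n%:R)) divfK // Num.Theory.pnatr_eq0 -lt0n.
Qed.

Lemma QZ_torsion n : (1 < n)%N -> exists2 d : QZ, d <> 0 & d *+ n = 0.
Proof.
move=> n1; have n0 : (n%:R : rat) != 0 by rewrite Num.Theory.pnatr_eq0 -lt0n ltnW.
exists (qz (n%:R^-1)).
  move=> /qz_eq0[m mE].
  have : (m * n%:Z)%:~R = 1 :> rat by rewrite intrM -mE mulVf.
  move=> /eqP; rewrite -[1]/(1%:~R) (inj_eq (@intr_inj _)) => /eqP mn.
  have := congr1 absz mn; rewrite abszM absz1 => /eqP; rewrite muln_eq1 => /andP[_].
  by rewrite absz_nat => /eqP n1'; rewrite n1' in n1.
apply/eqP; rewrite -raddfMn -(mulr_natr n%:R^-1) mulVf //; apply/eqP/qz_eq0.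
by exists 1.
Qed.
End RationalsModIntegers.

(** Subgroups of the integers are principal: [n0] is the least positive element, and remainders
    modulo [n0] stay in [P]. *)
Lemma int_subgroup (P : int -> Prop) : P 0 -> (forall m n, P m -> P n -> P (m - n)) ->
  (forall n, P n -> n = 0) \/
  exists n0 : nat, [/\ (0 < n0)%N, P n0%:Z & forall n, P n -> (n0%:Z %| n)%Z].
Proof.
move=> P0 PB.
have PN n : P n -> P (- n) by rewrite -[- n]sub0r; exact: PB.
have PD m n : P m -> P n -> P (m + n) by move=> Pm /PN Pn; rewrite -[n]opprK; exact: PB.
have PM m (q : int) : P m -> P (m * q).
  move=> Pm; have H (k : nat) : P (m * k%:Z).
    elim: k => [|k IH]; first by rewrite mulr0.
    by rewrite -addn1 PoszD mulrDr mulr1; exact: PD.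
  case: q => k; first exact: H.
  by rewrite NegzE mulrN; exact/PN/H.
have [[n [nz Pn]]|no] := pselect (exists n, n <> 0 /\ P n); last first.
  by left=> n Pn; apply: contrapT => nz; apply: no; exists n.
right; have ex : exists k : nat, (0 < k)%N && `[< P k%:Z >].
  exists `|n|%N; apply/andP; split; first by rewrite absz_gt0; apply/eqP.
  apply/asboolP; case: n {nz} Pn => k // Pn.
  by rewrite NegzE abszN absz_nat -[X in P X]opprK -NegzE; exact: PN.
case: (ex_minnP ex) => n0 /andP[n0pos /asboolP Pn0] min; exists n0; split=> // m Pm.
have Pr : P (m %% n0%:Z)%Z.
  have -> : (m %% n0%:Z)%Z = m - n0%:Z * (m %/ n0%:Z)%Z.
    by rewrite {2}(divz_eq m n0%:Z) mulrC addrC addKr.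
  by apply: PB => //; exact: PM.
have n0z : n0%:Z != 0 by rewrite eqz_nat -lt0n.
apply/dvdz_mod0P; move: Pr (ltz_mod m n0z) (modz_ge0 m n0z).
case: (m %% n0%:Z)%Z => r // Pr lt _; case: r Pr lt => // r Pr.
rewrite ltz_nat => lt; have := min r.+1; rewrite /= leqNgt lt.
by move=> /(_ (introT (asboolP _) Pr)).
Qed.

Section Extension.
Variables (G H : zmodType) (i : {additive G -> H}) (phi : {additive G -> QZ}).
Hypothesis i_phi : forall x, i x = 0 -> phi x = 0.

Local Open Scope classical_set_scope.

Let good (R : set (H * QZ)%type) := [/\ R (0, 0),
  (forall x y a b, R (x, a) -> R (y, b) -> R (x - y, a - b)) &
  forall a, R (0, a) -> a = 0].

Let R0 : set (H * QZ)%type := fun xa => exists x, xa = (i x, phi x).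

Let R0_good : good R0.
Proof.
split; first by exists 0; rewrite !raddf0.
  by move=> x y a b [z [-> ->]] [t [-> ->]]; exists (z - t); rewrite !raddfB.
by move=> a [z [z0 ->]]; apply: i_phi.
Qed.

(** Injectivity of Q/Z among abelian groups, by Zorn's lemma on graphs of partial homomorphisms:
    [good R] says that [R] is a subgroup of [H * QZ] and single-valued. *)
Lemma additive_extension : exists psi : {additive H -> QZ}, forall x, psi (i x) = phi x.
Proof.
(* Joining [R0] to every candidate takes care of the empty chain and keeps [phi] inside the maximal
   graph. *)
have [|A [gA maxA]] := @Zorn_bigcup _ (fun S => good (S `|` R0)).
  move=> F FP tot; split; first by right; case: R0_good.
    have [_ c0 _] := R0_good.
    move=> x y a b [[S FS Sx]|rx] [[S' FS' Sy]|ry].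
    - have [SS|SS] := tot S S' FS FS'.
        have [_ c _] := FP _ FS'.
        have [h|h] := c x y a b (or_introl (SS _ Sx)) (or_introl Sy); [left|by right].
        by exists S'.
      have [_ c _] := FP _ FS.
      have [h|h] := c x y a b (or_introl Sx) (or_introl (SS _ Sy)); [left|by right].
      by exists S.
    - have [_ c _] := FP _ FS.
      have [h|h] := c x y a b (or_introl Sx) (or_intror ry); [left|by right].
      by exists S.
    - have [_ c _] := FP _ FS'.
      have [h|h] := c x y a b (or_intror rx) (or_introl Sy); [left|by right].
      by exists S'.
    - by right; exact: c0.
  move=> a [[S FS Sa]|ra]; first by have [_ _ f] := FP _ FS; apply: f; left.
  by have [_ _ f] := R0_good; exact: f.
set R := A `|` R0 in gA; have [r0 rB rf] := gA.
have rN x a : R (x, a) -> R (- x, - a).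
  by move=> h; have := rB _ _ _ _ r0 h; rewrite !sub0r.
have rD x y a b : R (x, a) -> R (y, b) -> R (x + y, a + b).
  by move=> h /rN h'; rewrite -[y]opprK -[b]opprK; exact: rB.
have rM x a (n : int) : R (x, a) -> R (x *~ n, a *~ n).
  move=> h; have H' (k : nat) : R (x *+ k, a *+ k).
    by elim: k => [|k IH] //; rewrite !mulrS; exact: rD.
  case: n => k; first exact: H'.
  rewrite NegzE !mulrNz; apply: rN; exact: H'.
have dom g : exists a, R (g, a).
  apply: contrapT => ng.
  (* A value for [g] compatible with [R]: the multiples of [g] already in the domain are those of
     some [n0 *: g], and divisibility of Q/Z provides an [n0]-th part of the value there. *)
  have [d dP] : exists d : QZ, forall (n : int) c, R (g *~ n, c) -> c = d *~ n.
    have [||z|[n0 [n0pos [c0 Rc0] n0dvd]]] :=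
      @int_subgroup (fun n => exists c, R (g *~ n, c)).
    - by exists 0; rewrite mulr0z.
    - by move=> m n [c hc] [c' hc']; exists (c - c'); rewrite mulrzBr; exact: rB.
    - exists 0 => n c Rc; have n0 : n = 0 by apply: z; exists c.
      by move: Rc; rewrite n0 !mulr0z => /rf.
    have [d dc0] := QZ_divisible c0 n0pos; exists d => n c Rc.
    have /dvdzP[q nq] : (n0%:Z %| n)%Z by apply: n0dvd; exists c.
    have := rB _ _ _ _ Rc (rM _ _ q Rc0).
    rewrite nq mulrC mulrzA subrr => /rf/eqP; rewrite subr_eq0 => /eqP ->.
    by rewrite mulrzA -dc0.
  pose R' : set (H * QZ)%type := fun ya => exists x a (n : int),
    R (x, a) /\ ya = (x + g *~ n, a + d *~ n).
  have sub ya : R ya -> R' ya.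
    by case: ya => x a h; exists x, a, 0; rewrite !mulr0z !addr0.
  have R'R0 : R' `|` R0 = R'.
    by rewrite predeqE => ya; split=> [[//|h]|h]; [apply: sub; right | left].
  have gd : R' (g, d) by exists 0, 0, 1; rewrite !mulr1z !add0r.
  apply: (maxA R').
    split=> [ya h|h]; first by apply: sub; left.
    by apply: ng; exists d; left; exact: h.
  rewrite R'R0; split.
  - exact: sub.
  - move=> _ _ _ _ [x [a [n [h [-> ->]]]]] [x' [a' [n' [h' [-> ->]]]]].
    exists (x - x'), (a - a'), (n - n'); split; first exact: rB.
    by rewrite !mulrzBr !opprD; congr (_, _); rewrite addrACA.
  - move=> _ [x [a [n [h [xn ->]]]]].
    have /dP : R (g *~ n, - a).
      have -> : g *~ n = - x by apply/eqP; rewrite -addr_eq0 addrC -xn.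
      exact: rN.
    by move=> <-; rewrite subrr.
have [t tP] := choice dom.
have tU x a : R (x, a) -> t x = a.
  move=> h; apply/eqP; rewrite -subr_eq0; apply/eqP/rf.
  by have := rB _ _ _ _ (tP x) h; rewrite subrr.
have tA : zmod_morphism t by move=> x y; apply: tU; exact: rB.
exists (HB.pack_for {additive H -> QZ} t (GRing.isZmodMorphism.Build _ _ t tA)) => x.
by apply: tU; right; exists x.
Qed.
End Extension.

(** Extend a homomorphism from the subgroup generated by [m]. Its value at [m] has to be a nonzero
    [d] killed by the annihilator of [m]: arbitrary if that annihilator is 0, otherwise an
    [n0]-torsion element, where [n0] exceeds 1 because [m] is nonzero. *)
Lemma QZ_separates (H : zmodType) (m : H) : m <> 0 -> exists psi : {additive H -> QZ}, psi m <> 0.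
Proof.
move=> m0.
pose im (n : int) : H := m *~ n.
have imA : zmod_morphism im by move=> a b; exact: mulrzBr.
pose i := HB.pack_for {additive int -> H} im (GRing.isZmodMorphism.Build _ _ im imA).
suff [d d0 dP] : exists2 d : QZ, d <> 0 & forall n, m *~ n = 0 -> d *~ n = 0.
  pose fd (n : int) : QZ := d *~ n.
  have fA : zmod_morphism fd by move=> a b; exact: mulrzBr.
  pose phi := HB.pack_for {additive int -> QZ} fd (GRing.isZmodMorphism.Build _ _ fd fA).
  have [psi psiE] := @additive_extension _ _ i phi dP.
  by exists psi; have := psiE 1; rewrite /= /im /fd !mulr1z => ->.
have [||z|[n0 [n0pos mn0 n0dvd]]] := @int_subgroup (fun n => m *~ n = 0).
- exact: mulr0z.
- by move=> a b ha hb; rewrite mulrzBr ha hb subrr.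
- by have [//|d d0 _] := @QZ_torsion 2; exists d => // n /z ->; rewrite mulr0z.
have n01 : (1 < n0)%N.
  by rewrite ltn_neqAle n0pos andbT; apply/eqP => e; apply: m0; rewrite -[m]mulr1z -mn0 -e.
have [d d0 dn0] := QZ_torsion n01; exists d => // n /n0dvd/dvdzP[q ->].
by rewrite mulrC mulrzA -[d *~ n0]/(d *+ n0) dn0 mul0rz.
Qed.

Section InjectiveModule.
Variables (A : comPzRingType) (S : Type).

(* The coinduced module [Hom_Z(A, Q/Z)^S]. *)
Record coind : Type := Coind {
  co_fun :> S -> A -> QZ;
  coB : forall s, {morph co_fun s : a b / a - b} }.

HB.instance Definition _ := gen_eqMixin coind.
HB.instance Definition _ := gen_choiceMixin coind.

Lemma coP (t w : coind) : (forall s a, t s a = w s a) -> t = w.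
Proof.
case: t w => [t tP] [w wP] /= tw; have e : t = w.
  by apply/funext => s; apply/funext => a.
by case: _ / e in wP {tw} *; congr Coind; exact: Prop_irrelevance.
Qed.

Program Definition co0 := @Coind (fun _ _ => 0) _.
Next Obligation. by move=> a b; rewrite subrr. Qed.
Program Definition co_opp (t : coind) := @Coind (fun s a => - t s a) _.
Next Obligation. by move=> a b; rewrite coB opprB [RHS]addrC opprK. Qed.
Program Definition co_add (t w : coind) := @Coind (fun s a => t s a + w s a) _.
Next Obligation. by move=> a b; rewrite !coB opprD addrACA. Qed.
Program Definition co_scale (c : A) (t : coind) := @Coind (fun s a => t s (a * c)) _.
Next Obligation. by move=> a b; rewrite mulrBl coB. Qed.

Fact co_addA : associative co_add.
Proof. by move=> s t u; apply: coP => p hp; exact: addrA. Qed.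
Fact co_addC : commutative co_add.
Proof. by move=> s t; apply: coP => p hp; exact: addrC. Qed.
Fact co_add0 : left_id co0 co_add.
Proof. by move=> s; apply: coP => p hp; exact: add0r. Qed.
Fact co_addN : left_inverse co0 co_opp co_add.
Proof. by move=> s; apply: coP => p hp; exact: addNr. Qed.
HB.instance Definition _ := GRing.isZmodule.Build coind co_addA co_addC co_add0 co_addN.

Lemma coD (t : coind) s : {morph t s : a b / a + b}.
Proof.
move=> a b; have z : t s 0 = 0 by rewrite -[X in t s X](subrr 0) coB subrr.
by rewrite -[b in LHS]opprK coB -(sub0r b) coB z sub0r opprK.
Qed.

Fact co_scaleA a b t : co_scale a (co_scale b t) = co_scale (a * b) t.
Proof. by apply: coP => s c; rewrite /= mulrA. Qed.
Fact co_scale1 : left_id 1 co_scale.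
Proof. by move=> t; apply: coP => s c; rewrite /= mulr1. Qed.
Fact co_scaleDr : right_distributive co_scale +%R.
Proof. by move=> a t w; apply: coP. Qed.
Fact co_scaleDl t : {morph co_scale^~ t : a b / a + b}.
Proof. by move=> a b; apply: coP => s c; rewrite /= mulrDr coD. Qed.
HB.instance Definition _ := GRing.Zmodule_isLmodule.Build A coind
  co_scaleA co_scale1 co_scaleDr co_scaleDl.

(** Evaluation at 1 turns linear maps from [N] to [coind] into families, indexed by [S], of additive
    maps from [N] to Q/Z, and those extend. *)
Lemma coind_injective (N N' : lmodType A) (i : {linear N -> N'}) (u : {linear N -> coind}) :
  injective i -> exists w : {linear N' -> coind}, forall n, w (i n) = u n.
Proof.
move=> i_inj.
have ext s : exists psi : {additive N' -> QZ}, forall n, psi (i n) = u n s 1.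
  have fA : zmod_morphism (fun n => u n s 1) by move=> m n; rewrite linearB.
  pose phi := HB.pack_for {additive N -> QZ} (fun n => u n s 1)
    (GRing.isZmodMorphism.Build _ _ _ fA).
  have [|psi psiE] := @additive_extension _ _ i phi; last by exists psi.
  move=> n n0; have -> : n = 0 by apply: i_inj; rewrite n0 linear0.
  exact: raddf0.
have [psi psiE] := choice ext.
have wB n' s : {morph (fun a : A => psi s (a *: n')) : a b / a - b}.
  by move=> a b; rewrite scalerBl raddfB.
pose w n' := Coind (wB n').
have wl : linear w.
  move=> c m n; apply: coP => s a /=.
  by rewrite scalerDr raddfD scalerA.
exists (HB.pack_for {linear N' -> coind} w (GRing.isLinear.Build _ _ _ _ w wl)) => n.
apply: coP => s a; rewrite /= -linearZ psiE linearZ.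
by rewrite [LHS]/(u n s (1 * a)) mul1r.
Qed.
End InjectiveModule.

Section Embedding.
Variables (A : comPzRingType) (M : lmodType A).

(* [m |-> (psi |-> psi m)] is injective since [Q/Z] separates points, and coinduction
   preserves injectives. *)
Definition hull : lmodType A := coind A {additive M -> QZ}.

Fact to_hullB (m : M) (s : {additive M -> QZ}) : {morph (fun a : A => s (a *: m)) : a b / a - b}.
Proof. by move=> a b; rewrite scalerBl raddfB. Qed.
Definition to_hull_fun (m : M) : hull := Coind (to_hullB m).
Fact to_hull_linear : linear to_hull_fun.
Proof.
by move=> c m n; apply: coP => s a; rewrite /= scalerDr raddfD scalerA.
Qed.
HB.instance Definition _ := GRing.isLinear.Build _ _ _ _ to_hull_fun to_hull_linear.
Definition to_hull : {linear M -> hull} := to_hull_fun.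

Lemma to_hull_inj : injective to_hull.
Proof.
apply: raddf_inj => m m0; apply: contrapT => /QZ_separates[s]; apply.
have /= := congr1 (fun t : coind A {additive M -> QZ} => t s 1) m0.
by rewrite scale1r.
Qed.
End Embedding.

Section EnoughInjectives.
Variables (k : comPzRingType) (X : rspace k).

Section Godement.
Variable D : forall q : X, lmodType (stalk q).

Section Stalk.
Variable p : X.
(** The stalk at [p] of the product over all [q] of the skyscraper modules with value [D q]; the one
    at [q] contributes exactly when [q] lies in [U_p]. *)
Definition god : Type := forall q : X, (p <= q)%O -> D q.
HB.instance Definition _ := gen_eqMixin god.
HB.instance Definition _ := gen_choiceMixin god.

Lemma godP (s t : god) : (forall q hq, s q hq = t q hq) -> s = t.
Proof. by move=> st; apply: functional_extensionality_dep => q; apply/funext => hq. Qed.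

Definition god0 : god := fun q hq => 0.
Definition god_opp (s : god) : god := fun q hq => - s q hq.
Definition god_add (s t : god) : god := fun q hq => s q hq + t q hq.
Definition god_scale (a : stalk p) (s : god) : god := fun q hq => rres hq a *: s q hq.
Fact god_addA : associative god_add.
Proof. by move=> s t u; apply: godP => q hq; exact: addrA. Qed.
Fact god_addC : commutative god_add.
Proof. by move=> s t; apply: godP => q hq; exact: addrC. Qed.
Fact god_add0 : left_id god0 god_add.
Proof. by move=> s; apply: godP => q hq; exact: add0r. Qed.
Fact god_addN : left_inverse god0 god_opp god_add.
Proof. by move=> s; apply: godP => q hq; exact: addNr. Qed.
HB.instance Definition _ := GRing.isZmodule.Build god god_addA god_addC god_add0 god_addN.
Fact god_scaleA a b s : god_scale a (god_scale b s) = god_scale (a * b) s.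
Proof. by apply: godP => q hq; rewrite /god_scale scalerA rmorphM. Qed.
Fact god_scale1 : left_id 1 god_scale.
Proof. by move=> s; apply: godP => q hq; rewrite /god_scale rmorph1 scale1r. Qed.
Fact god_scaleDr : right_distributive god_scale +%R.
Proof. by move=> a s t; apply: godP => q hq; exact: scalerDr. Qed.
Fact god_scaleDl s : {morph god_scale^~ s : a b / a + b}.
Proof. by move=> a b; apply: godP => q hq; rewrite /god_scale rmorphD; exact: scalerDl. Qed.
HB.instance Definition _ := GRing.Zmodule_isLmodule.Build (stalk p) god
  god_scaleA god_scale1 god_scaleDr god_scaleDl.
End Stalk.

Section Res.
Variables (p r : X) (h : (p <= r)%O).
Definition god_res (s : god p) : god r := fun q hq => s q (le_trans h hq).
Fact god_res_linear : linear_for (rres h \; *:%R) god_res.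
Proof.
move=> a s t; apply: godP => q hq; congr (_ *: _ + _).
exact/esym/rres_comp.
Qed.
HB.instance Definition _ := GRing.isLinear.Build _ _ _ (rres h \; *:%R) god_res god_res_linear.
End Res.
Fact god_res_id p (h : (p <= p)%O) s : god_res h s = s.
Proof. by apply: godP => q hq; congr (s q _); exact: bool_irrelevance. Qed.
Fact god_res_comp p q r (h : (p <= q)%O) (h' : (q <= r)%O) (h'' : (p <= r)%O) s :
  god_res h' (god_res h s) = god_res h'' s.
Proof. by apply: godP => t ht; congr (s t _); exact: bool_irrelevance. Qed.
Definition god_omod : omod X := @OMod k X (fun p => god p)
  (fun p q h => god_res h) god_res_id god_res_comp.

Section FromStalks.
Variables (N : omod X) (w : forall q, {linear N q -> D q}).
Definition god_hom_at p (n : N p) : god p := fun q hq => w q (mres N hq n).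
Fact god_hom_linear p : linear (@god_hom_at p).
Proof. by move=> a m n; apply: godP => q hq; rewrite /god_hom_at !linearP. Qed.
HB.instance Definition _ p := GRing.isLinear.Build _ _ _ _ (@god_hom_at p) (@god_hom_linear p).
Fact god_hom_res p q (h : (p <= q)%O) n :
  god_hom_at (mres N h n) = mres god_omod h (god_hom_at n).
Proof. by apply: godP => r hr; congr (w r _); exact: mres_comp. Qed.
Definition god_hom : ohom N god_omod :=
  @OHom k X N god_omod (fun p => @god_hom_at p) god_hom_res.
End FromStalks.

Hypothesis D_inj : forall q (N N' : lmodType (stalk q)) (i : {linear N -> N'})
  (u : {linear N -> D q}), injective i -> exists w : {linear N' -> D q}, forall n, w (i n) = u n.

(** By adjunction a morphism to [god_omod] is a family of linear maps from the stalks at [q] to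
    [D q], obtained as the [q] component at the point [q]; these are extended one at a time. *)
Lemma god_injective : injective_omod god_omod.
Proof.
move=> N N' i u i_inj.
pose uq q (n : N q) : D q := (u q n : god q) q (lexx q).
have ul q : linear (@uq q).
  move=> a m n; rewrite /uq linearP; congr (_ *: _ + _).
  exact: rres_id.
have ex q : exists w : {linear N' q -> D q}, forall n, w (i q n) = uq q n.
  exact: (@D_inj q (N q) (N' q) (i q) (HB.pack_for {linear N q -> D q} (@uq q)
    (GRing.isLinear.Build _ _ _ _ (@uq q) (@ul q))) (@i_inj q)).
pose w q := sval (cid (ex q)); have wP q := svalP (cid (ex q)).
exists (god_hom w) => p m; apply: godP => q hq.
rewrite /= /god_hom_at -oh_res [LHS]wP /uq oh_res /=.
by congr ((u p m : god p) q _); exact: bool_irrelevance.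
Qed.
End Godement.

Section Resolution.
Definition hulls (M : omod X) : omod X := god_omod (fun q => hull (M q)).
Definition to_hulls (M : omod X) : ohom M (hulls M) := god_hom (fun q => to_hull (M q)).

Lemma hulls_injective M : injective_omod (hulls M).
Proof. by apply: god_injective => q N N' i u; exact: coind_injective. Qed.

Lemma to_hulls_inj M p : injective (to_hulls M p).
Proof.
move=> m n mn; have /= := congr1 (fun s : god (fun q => hull (M q)) p => s p (lexx p)) mn.
rewrite /god_hom_at => /(@to_hull_inj _ (M p)).
by rewrite !mres_id.
Qed.

Section Cokernel.
Variables (M N : omod X) (u : ohom M N).
(** Encoded as the cohomology at [N] of [u] followed by zero, so that the quotient construction is
    reused. *)
Definition coker : omod X := cohomology_sheaf u (ohom0 N N).
Section At.
Variable p : X.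
Fact coker_cycle (n : N p) : is_cycle (ohom0 N N p) n.
Proof. exact/eqP. Qed.
Definition coker_proj_at (n : N p) : coker p :=
  \pi_(coh (u p) (ohom0 N N p)) (Cycle (coker_cycle n)).
Fact coker_proj_linear : linear coker_proj_at.
Proof.
move=> a m n; rewrite /coker_proj_at -coh_piZ -coh_piD.
by congr (\pi_(coh _ _) _); apply: val_inj.
Qed.
HB.instance Definition _ := GRing.isLinear.Build _ _ _ _ coker_proj_at coker_proj_linear.
End At.
Fact coker_proj_res p q (h : (p <= q)%O) n :
  coker_proj_at (mres N h n) = mres coker h (coker_proj_at n).
Proof. by rewrite [RHS]coh_resE; congr (\pi_(coh _ _) _); apply: val_inj. Qed.
Definition coker_proj : ohom N coker :=
  @OHom k X N coker (fun p => @coker_proj_at p) coker_proj_res.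

Lemma coker_proj0 p n : coker_proj p n = 0 <-> exists m, u p m = n.
Proof.
split=> [/cohE[m hm]|[m hm]].
  by exists m; rewrite hm; exact: subr0.
by apply/cohE; exists m; rewrite hm; exact: (esym (subr0 _)).
Qed.

Lemma coker_proj_surj p c : exists n, coker_proj p n = c.
Proof.
elim/cohW: c => z; exists (val z).
by congr (\pi_(coh _ _) _); apply: val_inj.
Qed.
End Cokernel.

Fixpoint cosyzygy (M : omod X) (n : nat) : omod X :=
  if n is m.+1 then coker (to_hulls (cosyzygy M m)) else M.

Section Compose.
Variables (M N Q : omod X) (u : ohom M N) (v : ohom N Q).
Definition ocomp : ohom M Q := @OHom k X M Q (fun p => v p \o u p)
  (fun p q h m => etrans (congr1 (v q) (oh_res u h m)) (oh_res v h (u p m))).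
End Compose.

Lemma enough_injectives (M : omod X) : inhabited (inj_resolution M).
Proof.
pose E n := hulls (cosyzygy M n).
pose d n : ohom (E n) (E n.+1) :=
  ocomp (coker_proj (to_hulls (cosyzygy M n))) (to_hulls (cosyzygy M n.+1)).
have d0 n p e : d n p e = 0 <-> exists m, to_hulls (cosyzygy M n) p m = e.
  rewrite -coker_proj0; split=> [|/= ->]; last exact: linear0.
  rewrite -[X in _ = X -> _](linear0 (to_hulls (cosyzygy M n.+1) p)).
  exact: to_hulls_inj.
constructor; apply: (@InjResolution k X M E d (to_hulls M)).
- by move=> n; exact: hulls_injective.
- exact: to_hulls_inj.
- exact: d0.
move=> n p e; rewrite d0; split=> [[c <-]|[e' <-]].
  by have [e' <-] := coker_proj_surj c; exists e'.
by exists (coker_proj (to_hulls (cosyzygy M n)) p e').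
Qed.
End Resolution.
End EnoughInjectives.

(** * Higher direct images and extension from an open subset *)

Section Transfer.
Variables (k : comPzRingType) (X Y Z : rspace k) (f : rmor X Y) (r : rmor X Z).
Variable W : {set X}.

Section AtPoint.
Variables (y : Y) (z : Z) (sg : {rmorphism stalk y -> stalk z}).
Hypothesis zE : forall p, (z <= r p)%O = (p \in fib f W y).
Hypothesis sgE : forall p (hp : (z <= r p)%O) (hy : (y <= f p)%O) a,
  rm_sharp r p (rres hp (sg a)) = rm_sharp f p (rres hy a).

Section Sec.
Variable N : omod X.

Fact dsec_of_res (s : wsec f W y N) p q (hpq : (p <= q)%O) (hp : (z <= r p)%O)
    (hq : (z <= r q)%O) :
  mres N hpq (sec_fun s (etrans (esym (zE p)) hp)) = sec_fun s (etrans (esym (zE q)) hq).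
Proof. exact: sec_resE. Qed.
(** [zE] says that the preimage of [U_z] under [r] is [W /\ f^-1(U_y)]: the sections are the same
    and only the scalars change, along [sg]. The uses are [r = f] with [sg] the identity, and [r] a
    graph with [sg] one of the two maps into the tensor product, [f] being replaced by the identity
    of [X] for the first factor. *)
Definition dsec_of (s : wsec f W y N) : dsec r N z := DSec (dsec_of_res s).
Fact dsec_of_linear : linear_for (sg \; *:%R) dsec_of.
Proof. by move=> a s t; apply: dsecP => p hp; rewrite /= -sgE. Qed.
HB.instance Definition _ := GRing.isLinear.Build _ _ _ (sg \; *:%R) dsec_of dsec_of_linear.

Fact sec_of_res (s : dsec r N z) p q (hpq : (p <= q)%O) (hp : p \in fib f W y)
    (hq : q \in fib f W y) :
  mres N hpq (ds_fun s (etrans (zE p) hp)) = ds_fun s (etrans (zE q) hq).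
Proof. exact: ds_res. Qed.
Definition sec_of (s : dsec r N z) : wsec f W y N := Sec (sec_of_res s).

Lemma dsec_ofK : cancel dsec_of sec_of.
Proof. by move=> s; apply: secP => p hp /=; exact: sec_irr. Qed.
Lemma sec_ofK : cancel sec_of dsec_of.
Proof. by move=> s; apply: dsecP => p hp /=; congr (ds_fun s _); exact: bool_irrelevance. Qed.
End Sec.

Lemma dsec_of_map (N N' : omod X) (u : ohom N N') (s : wsec f W y N) :
  dsec_of (wmap u s) = direct_hom r u z (dsec_of s).
Proof. exact: dsecP. Qed.

Section Coh.
Variables (L M N : omod X) (U : ohom (direct_image r L) (direct_image r M)) (v : ohom M N).
Variable uy : {linear wsec f W y L -> wsec f W y M}.
Hypothesis uyE : forall s, U z (dsec_of s) = dsec_of (uy s).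

Let b : {linear wsec f W y M -> dsec r M z | sg \; *:%R} := @dsec_of M.
Let vw : {linear wsec f W y M -> wsec f W y N} := @wmap _ _ _ f W y _ _ v.
Let H : omod Z := cohomology_sheaf U (direct_hom r v).

Fact tr_cyc s : vw s = 0 -> direct_hom r v z (b s) = 0.
Proof. by move=> vs; rewrite /b /= -dsec_of_map [wmap v s]vs linear0. Qed.
Fact tr_bnd l : exists l', U z l' = b (uy l).
Proof. by exists (dsec_of l); exact: uyE. Qed.

Let tr_fun : coh uy vw -> H z := 
  @coh_map _ _ sg _ _ _ uy vw _ _ _ (U z) (direct_hom r v z) b tr_cyc.
Fact tr_linear : linear (tr_fun : coh uy vw -> restr sg (H z)).
Proof. exact: (coh_map_linear tr_cyc tr_bnd). Qed.
Definition tr : {linear coh uy vw -> restr sg (H z)} :=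
  HB.pack_for {linear coh uy vw -> restr sg (H z)} tr_fun
    (GRing.isLinear.Build _ _ _ _ (tr_fun : coh uy vw -> restr sg (H z)) tr_linear).

Lemma trE (c : cycles vw) : tr (\pi_(coh uy vw) c) =
  \pi_(coh (U z) (direct_hom r v z)) (@coh_map_cyc _ _ sg _ _ vw _ _ (direct_hom r v z) b tr_cyc c).
Proof. exact: (coh_mapE tr_cyc tr_bnd). Qed.

Lemma tr_bij : bijective tr.
Proof.
apply: coh_map_bij; first exact: tr_bnd.
  move=> s vs l'; rewrite -[l']sec_ofK uyE => /(can_inj (@dsec_ofK M)) e.
  by exists (sec_of l').
move=> s vs; exists (sec_of s).
  by apply: (can_inj (@dsec_ofK N)); rewrite /= dsec_of_map sec_ofK vs linear0.
by exists 0; rewrite linear0 [b _]sec_ofK subrr.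
Qed.
End Coh.
End AtPoint.

Variables (y y' : Y) (h : (y <= y')%O) (z z' : Z) (hz : (z <= z')%O).
Variables (sg : {rmorphism stalk y -> stalk z}) (sg' : {rmorphism stalk y' -> stalk z'}).
Hypothesis zE : forall p, (z <= r p)%O = (p \in fib f W y).
Hypothesis zE' : forall p, (z' <= r p)%O = (p \in fib f W y').
Hypothesis sgE : forall p (hp : (z <= r p)%O) (hy : (y <= f p)%O) a,
  rm_sharp r p (rres hp (sg a)) = rm_sharp f p (rres hy a).
Hypothesis sgE' : forall p (hp : (z' <= r p)%O) (hy : (y' <= f p)%O) a,
  rm_sharp r p (rres hp (sg' a)) = rm_sharp f p (rres hy a).
Hypothesis sgh : forall a, rres hz (sg a) = sg' (rres h a).
Hypothesis h_flat : flat (rres h).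

Section Restricted.
Variable N : omod Z.
Let restr_res_fun (n : restr sg (N z)) : restr sg' (N z') := mres N hz n.
Fact restr_res_linear : linear_for (rres h \; *:%R) restr_res_fun.
Proof.
move=> a m n; rewrite /restr_res_fun linearD; congr (_ + _).
have -> : mres N hz (a *: m) = rres hz (sg a) *: (mres N hz m : N z').
  by rewrite -[a *: m]/(sg a *: (m : N z)) linearZ.
by rewrite sgh.
Qed.
Definition restr_res : {linear restr sg (N z) -> restr sg' (N z') | rres h \; *:%R} :=
  HB.pack_for {linear restr sg (N z) -> restr sg' (N z') | rres h \; *:%R} restr_res_fun
    (GRing.isLinear.Build _ _ _ (rres h \; *:%R) restr_res_fun restr_res_linear).
End Restricted.

Section CohTransfer.
Variables (L M N : omod X) (U : ohom (direct_image r L) (direct_image r M)) (v : ohom M N).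
Variables (uy : {linear wsec f W y L -> wsec f W y M}).
Variables (uy' : {linear wsec f W y' L -> wsec f W y' M}).
Hypothesis uyE : forall s, U z (dsec_of zE s) = dsec_of zE (uy s).
Hypothesis uyE' : forall s, U z' (dsec_of zE' s) = dsec_of zE' (uy' s).
Hypothesis uyh : forall s, uy' (wphi h s) = wphi h (uy s).
Let vw : {linear wsec f W y M -> wsec f W y N} := @wmap _ _ _ f W y _ _ v.
Let vw' : {linear wsec f W y' M -> wsec f W y' N} := @wmap _ _ _ f W y' _ _ v.
Hypothesis vu0 : forall s, vw (uy s) = 0.
Let H : omod Z := cohomology_sheaf U (direct_hom r v).
Let bphi : {linear wsec f W y M -> wsec f W y' M | rres h \; *:%R} := @wphi _ _ _ f W y y' h M.
Let nphi : {linear wsec f W y N -> wsec f W y' N | rres h \; *:%R} := @wphi _ _ _ f W y y' h N.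

Fact wphi_map (N1 N2 : omod X) (u : ohom N1 N2) (s : wsec f W y N1) :
  wmap u (wphi h s) = wphi h (wmap u s).
Proof. exact: secP. Qed.
Fact psi_cyc s : vw s = 0 -> vw' (bphi s) = 0.
Proof. by move=> vs; rewrite /bphi /= wphi_map [wmap v s]vs linear0. Qed.
Fact psi_bnd l : exists l', uy' l' = bphi (uy l).
Proof. by exists (wphi h l); exact: uyh. Qed.
Let psi_fun : coh uy vw -> coh uy' vw' :=
  @coh_map _ _ (rres h) _ _ _ uy vw _ _ _ uy' vw' bphi psi_cyc.
Let psi : {linear coh uy vw -> coh uy' vw' | rres h \; *:%R} :=
  HB.pack_for {linear coh uy vw -> coh uy' vw' | rres h \; *:%R} psi_fun
    (GRing.isLinear.Build _ _ _ (rres h \; *:%R) psi_fun (coh_map_linear psi_cyc psi_bnd)).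

Lemma base_change_transfer : base_change (restr_res H) <->
  inj_at uy vw uy' bphi /\ surj_at vw uy' vw' bphi.
Proof.
have e : forall c, tr sgE' v uyE' (psi c) = restr_res H (tr sgE v uyE c).
  elim/cohW => c; rewrite (coh_mapE psi_cyc psi_bnd c : psi _ = _) (trE sgE uyE c).
  rewrite (trE sgE' uyE').
  rewrite [RHS]coh_resE; congr (\pi_(coh _ _) _); apply: val_inj.
  by apply: dsecP => p hp /=; exact: sec_irr.
rewrite -(base_change_iso e (tr_bij sgE v uyE) (tr_bij sgE' v uyE')).
apply: (base_change_coh h_flat vu0 (phiN := nphi)).
- by move=> m; exact: wphi_map.
- move=> c c' cc'; rewrite [psi _](coh_mapE psi_cyc psi_bnd).
  by congr (\pi_(coh _ _) _); apply: val_inj.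
Qed.
End CohTransfer.

(** In each degree, base change is the pair of conditions [inj_at] and [surj_at], and
    [tot_exact_coh] assembles all these pairs into exactness of the cone. *)
Lemma rel_exact_Rdirect (M : omod X) (E : inj_resolution M) :
  (forall i, base_change (restr_res (Rdirect_along r E i))) <->
  forall n, rel_exact f h W (res_cx E) n.
Proof.
have dd : bcx_dd (relcx f h W (res_cx E)).
  by apply: (relcx_dd f h (subxx _)); exact: res_cx_dd.
rewrite /rel_exact -tot_exact_coh; last by move=> c; apply: secP => p hp; exact: zero_omodE.
have B0 : base_change (restr_res (Rdirect_along r E 0)) <-> _ :=
  @base_change_transfer (E 0) (E 0) (E 1) (ohom0 _ _) (ir_d E 0) \0 \0
    (fun s => esym (linear0 (@dsec_of y z zE (E 0))))
    (fun s => esym (linear0 (@dsec_of y' z' zE' (E 0))))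
    (fun s => esym (linear0 (@wphi _ _ _ f W y y' h (E 0))))
    (fun s => linear0 _).
have BS i : base_change (restr_res (Rdirect_along r E i.+1)) <-> _ :=
  @base_change_transfer (E i) (E i.+1) (E i.+2) (direct_hom r (ir_d E i)) (ir_d E i.+1)
    (@wmap _ _ _ f W y _ _ (ir_d E i)) (@wmap _ _ _ f W y' _ _ (ir_d E i))
    (fun s => esym (dsec_of_map zE (ir_d E i) s)) (fun s => esym (dsec_of_map zE' (ir_d E i) s))
    (fun s => wphi_map (ir_d E i) s) (dd.1 i).
split=> [b|[b0 bS] [|i]].
- by split=> [|i]; [exact/B0 | exact/BS].
- exact/B0.
- by apply/(BS i); exact: bS.
Qed.
End Transfer.

Lemma base_change_coh_sheaf (k : comPzRingType) (X : rspace k) (L M N : omod X) (u : ohom L M)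
    (v : ohom M N) p q (h : (p <= q)%O) :
    (forall p l, v p (u p l) = 0) -> flat (rres h) ->
  base_change (mres (cohomology_sheaf u v) h) <->
  inj_at (u p) (v p) (u q) (mres M h) /\ surj_at (v p) (u q) (v q) (mres M h).
Proof.
move=> vu0 h_flat; apply: (base_change_coh h_flat (vu0 p) (phiN := mres N h)).
  by move=> m; exact: oh_res.
move=> z z' zz'; rewrite [LHS]coh_resE; congr (\pi_(coh _ _) _); exact: val_inj.
Qed.


Section JStar.
Variables (k : comPzRingType) (X : rspace k) (W : {set X}).

Notation fibW := (fib (rid X) W).
Notation wsecW := (wsec (rid X) W).

Section Mod.
Variable N : omod X.

Fact jstar_id p (h : (p <= p)%O) (s : wsecW p N) : wphi h s = s.
Proof. by apply: secP => q hq /=; exact: sec_irr. Qed.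
Fact jstar_comp p q r (h : (p <= q)%O) (h' : (q <= r)%O) (h'' : (p <= r)%O) (s : wsecW p N) :
  @wphi _ _ _ (rid X) W q r h' N (wphi h s) = wphi h'' s.
Proof. by apply: secP => t ht /=; exact: sec_irr. Qed.

(* [j_* (N|W)] for the inclusion [j] of [W] *)
Definition jstar : omod X := @OMod k X (fun p => wsecW p N)
  (fun p q h => @wphi _ _ _ (rid X) W p q h N) jstar_id jstar_comp.

Lemma in_fib_rid p q : (q \in fibW p) = (q \in W) && (p <= q)%O.
Proof. exact: in_fib. Qed.

Section Diag.
Variables (V : {set X}) (s : sec V jstar).

Fact diag_in p (hp : p \in V :&: W) : p \in fibW p.
Proof. by move: hp; rewrite in_setI in_fib_rid lexx andbT => /andP[]. Qed.
Fact diag_inV p (hp : p \in V :&: W) : p \in V.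
Proof. by move: hp; rewrite in_setI => /andP[]. Qed.
(** A section of [jstar N] over [V] amounts to a section of [N] over [V :&: W], recovered from its
    values on the diagonal. *)
Definition diag_fun p (hp : p \in V :&: W) : N p := sec_fun (sec_fun s (diag_inV hp)) (diag_in hp).

Lemma jstar_sec p q (hp : p \in V) (hq : q \in V :&: W) (hpq : q \in fibW p) :
  sec_fun (sec_fun s hp) hpq = diag_fun hq.
Proof.
have pq : (p <= q)%O by move: (hpq); rewrite in_fib_rid => /andP[].
rewrite /diag_fun -(sec_resE s pq hp) /=; exact: sec_irr.
Qed.

Fact diag_res p q (h : (p <= q)%O) (hp : p \in V :&: W) (hq : q \in V :&: W) :
  mres N h (diag_fun hp) = diag_fun hq.
Proof.
have hpq : q \in fibW p.
  by rewrite in_fib_rid h andbT; move: hq; rewrite in_setI => /andP[].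
by rewrite -(jstar_sec (diag_inV hp) hq hpq); exact: sec_resE.
Qed.
Definition diag_sec : sec (V :&: W) N := Sec diag_res.
End Diag.

Section Spread.
Variable t : sec [set: X]%SET N.
Definition spread_sec_at p : jstar p :=
  @Sec _ _ (fibW p) N (fun q hq => t q (in_setT q)) (fun q r h hq hr => sec_resE t h _ _).
Fact spread_sec_res p q (h : (p <= q)%O) (hp : p \in [set: X]%SET) (hq : q \in [set: X]%SET) :
  mres jstar h (spread_sec_at p) = spread_sec_at q.
Proof. exact: secP. Qed.
Definition spread_sec : sec [set: X]%SET jstar :=
  @Sec _ _ [set: X]%SET jstar (fun p _ => spread_sec_at p) spread_sec_res.
End Spread.

Lemma jstar_flasque : is_open W -> flasque N -> flasque jstar.
Proof.
move=> oW fl V s oV; have [t tP] := fl _ (diag_sec s) (openI oV oW).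
exists (spread_sec t) => p hp; apply: secP => q hq /=.
have hqV : q \in V :&: W.
  by move: hq; rewrite in_fib_rid in_setI => /andP[-> /oV->].
rewrite (jstar_sec s hp hqV hq); exact: tP.
Qed.
End Mod.

Section Hom.
Variables (N N' : omod X) (u : ohom N N').
Fact jstar_hom_res p q (h : (p <= q)%O) (s : jstar N p) :
  @wmap _ _ _ (rid X) W q _ _ u (mres (jstar N) h s) =
  mres (jstar N') h (@wmap _ _ _ (rid X) W p _ _ u s).
Proof. exact: secP. Qed.
Definition jstar_hom : ohom (jstar N) (jstar N') :=
  @OHom k X (jstar N) (jstar N') (fun p => @wmap _ _ _ (rid X) W p _ _ u) jstar_hom_res.
End Hom.

Definition jstar_cx (J : ocx X) : ocx X := Ocx (fun n => jstar_hom (od J n)).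

Section Complex.
Variable J : ocx X.
Hypothesis oW : is_open W.

Lemma jstar_cx_flasque : flasque_cx J -> flasque_cx (jstar_cx J).
Proof. by move=> fl n; exact: jstar_flasque. Qed.

Lemma jstar_cx_dd : dd_on W J -> dd_on [set: X]%SET (jstar_cx J).
Proof.
move=> dd n p _ s; apply: secP => q hq; apply: dd.
by move: hq; rewrite in_fib_rid => /andP[].
Qed.

(** The stalk of [jstar] at [p] consists of the sections over [W /\ U_p]. This set has at most
    [#|X|] points, so it has no cohomology in degrees above [#|X|]. *)
Lemma jstar_cx_exact n : flasque_cx J -> dd_on [set: X]%SET J ->
  (forall n, stalk_exact [set: X]%SET J n.+1) -> (#|X| < n)%N ->
  stalk_exact [set: X]%SET (jstar_cx J) n.
Proof.
move=> fl dd ex; case: n => // n Xn p _ s ds.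
have ofib : is_open (fibW p) by exact: fib_open.
have [|t ts] := @sec_exact_local _ _ _ J _ n.+1 fl dd ofib (subsetT _) _ s ds.
  case=> [|j] _; last by move=> _; exact: ex.
  by rewrite add0n leqNgt (leq_ltn_trans (max_card _) Xn).
by exists t.
Qed.

(** The restriction maps of the complex [jstar_cx J] are the comparison maps of [relcx] for the
    identity of [X], so base change of its cohomology is relative exactness along that identity. *)
Lemma jstar_Hsheaf_qc q : finite_space X -> dd_on W J ->
  (forall p p' (h : (p <= p')%O) n, rel_exact (rid X) h W J n) ->
  quasi_coherent (Hsheaf (jstar_cx J) q).
Proof.
move=> X_flat dd ex; apply/quasi_coherentP => p p' h.
have h_flat : flat (rres h) by exact: X_flat.
have [|b0 bS] := (@tot_exact_coh _ _ _ (relcx (rid X) h W J) _).2 (ex p p' h).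
  by move=> c; apply: secP => r hr; exact: zero_omodE.
case: q => [|q].
  by apply/(@base_change_coh_sheaf _ _ _ _ _ (ohom0 (jstar (J 0)) (jstar (J 0))));
    [move=> r s; exact: linear0 | exact: h_flat | exact: b0].
by apply/(@base_change_coh_sheaf _ _ _ _ _ (jstar_hom (od J q)));
  [move=> r s; exact: (relcx_dd (rid X) (lexx r) (subxx W) dd).1 | exact: h_flat | exact: bS].
Qed.
End Complex.

Section Relative.
Variables (Y : rspace k) (f : rmor X Y).

Section Sec.
Variables (y : Y) (N : omod X).
Notation fibT := (fib f [set: X]%SET y).

Fact fib_iter p q (hp : p \in fibT) (hq : q \in fibW p) : q \in fib f W y.
Proof.
move: hp hq; rewrite in_fib_rid !in_fib => /andP[_ yp] /andP[-> pq] /=.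
exact: le_trans yp (rm_le f pq).
Qed.
Definition iter_at (s : wsec f W y N) p (hp : p \in fibT) : jstar N p :=
  @Sec _ _ (fibW p) N (fun q hq => sec_fun s (fib_iter hp hq))
    (fun q r h hq hr => sec_resE s h _ _).
Fact iter_res (s : wsec f W y N) p q (h : (p <= q)%O) (hp : p \in fibT) (hq : q \in fibT) :
  mres (jstar N) h (iter_at s hp) = iter_at s hq.
Proof. by apply: secP => r hr /=; exact: sec_irr. Qed.
Definition iter_sec (s : wsec f W y N) : wsec f [set: X]%SET y (jstar N) := Sec (iter_res s).
Fact iter_linear : linear iter_sec.
Proof.
move=> a s t; apply: secP => p hp; apply: secP => q hq /=; congr (_ *: _ + _).
rewrite -[RHS]rm_res; congr (rm_sharp f q _); exact/esym/rres_comp.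
Qed.
HB.instance Definition _ := GRing.isLinear.Build _ _ _ _ iter_sec iter_linear.

Lemma iter_bij : bijective iter_sec.
Proof.
have inj : injective iter_sec.
  move=> s t st; apply: secP => p hp.
  have hpT : p \in fibT by rewrite in_fib in_setT /=; exact: fib_le hp.
  have hpp : p \in fibW p by rewrite in_fib_rid lexx andbT; exact: (subsetP (fib_sub f W y)).
  have := congr1 (fun s : wsec f [set: X]%SET y (jstar N) => sec_fun (sec_fun s hpT) hpp) st.
  by rewrite /= (sec_irr s _ hp) (sec_irr t _ hp).
have sur t : exists s, iter_sec s = t.
  have sub p (hp : p \in fib f W y) : p \in fibT :&: W.
    by move: hp; rewrite in_setI !in_fib in_setT => /andP[-> ->].
  pose s : wsec f W y N := sec_restr (introT subsetP sub) (diag_sec t).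
  exists s; apply: secP => p hp; apply: secP => q hq /=.
  exact/esym/jstar_sec.
have /choice[g gK] := sur; exists g => // s; apply: inj; exact: gK.
Qed.
End Sec.

Variables (y y' : Y) (h : (y <= y')%O) (J : ocx X).

Definition iter_shift n :
    {linear wsec f W y' (shift J n) -> wsec f [set: X]%SET y' (shift (jstar_cx J) n)} :=
  match n with
  | 0 => \0
  | m.+1 => @iter_sec y' (J m)
  end.

Program Definition iter_bcx : bcx_hom (relcx f h W J) (relcx f h [set: X]%SET (jstar_cx J)) :=
  @BcxHom _ _ _ (relcx f h W J) (relcx f h [set: X]%SET (jstar_cx J))
    (fun n => @iter_sec y (J n)) iter_shift _ _ _.
Next Obligation. by apply: secP => p hp; exact: secP. Qed.
Next Obligation.
case: n x => [|n] s; first rewrite [RHS]linear0 -[LHS]/(iter_sec (wmap (ohom0 _ _) s)).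
  by rewrite [wmap _ _](_ : _ = 0) ?linear0 //; exact: secP.
by apply: secP => p hp; exact: secP.
Qed.
Next Obligation.
by apply: secP => p hp; apply: secP => q hq /=; exact: sec_irr.
Qed.

(** Direct images compose: sections of [jstar N] over the preimage of [U_y] are sections of [N] over
    [W] intersected with that preimage, and [iter_sec] is this identification. *)
Lemma rel_exact_jstar n :
  rel_exact f h [set: X]%SET (jstar_cx J) n <-> rel_exact f h W J n.
Proof.
apply: (tot_exact_iso (h := iter_bcx)); split=> -[|m]; try exact: iter_bij.
have z0 (V : {set X}) (s : wsec f V y' (zero_omod X)) : s = 0.
  by apply: secP => p hp; exact: zero_omodE.
by exists \0 => s; rewrite [RHS]z0 [LHS]z0.
Qed.
End Relative.
End JStar.

(** * The graph *)

Section RestrId.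
Variables (A B : comPzRingType) (M : lmodType A) (N : lmodType B).
(** [restr idfun M] is a different module structure syntactically; this identification lets the
    transfer lemmas run with [idfun] as change of scalars. *)
Definition to_restr_id (m : M) : restr idfun M := m.
Fact to_restr_id_linear : linear to_restr_id.
Proof. by []. Qed.
HB.instance Definition _ := GRing.isLinear.Build _ _ _ _ to_restr_id to_restr_id_linear.
End RestrId.

Section Criteria.
Variables (k : comPzRingType) (X Y : rspace k) (f : rmor X Y).
Hypothesis Y_flat : finite_space Y.

Lemma Rdirect_qcP (M : omod X) i : Rdirect_quasi_coherent f M i <->
  forall E : inj_resolution M, quasi_coherent (Rdirect_along f E i).
Proof.
split=> [H E|H N [E /omod_iso_qc e]]; last exact/e.
apply: H; exists E; pose N := Rdirect_along f E i.
exists (@OHom k Y N N (fun=> idfun) (fun _ _ _ _ => erefl)) => y; exact: inv_bij.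
Qed.

Lemma Rdirect_qc_rel_exact (M : omod X) (E : inj_resolution M) :
  (forall i, quasi_coherent (Rdirect_along f E i)) <->
  forall y y' (h : (y <= y')%O) n, rel_exact f h [set: X]%SET (res_cx E) n.
Proof.
have D y y' (h : (y <= y')%O) : (forall i, base_change (mres (Rdirect_along f E i) h)) <->
    forall n, rel_exact f h [set: X]%SET (res_cx E) n.
  have zE z p : (z <= f p)%O = (p \in fib f [set: X]%SET z) by rewrite in_fib in_setT.
  have sgE z p (hp hz : (z <= f p)%O) a :
      rm_sharp f p (rres hp (idfun a)) = rm_sharp f p (rres hz a).
    by rewrite (bool_irrelevance hp hz).
  rewrite -(rel_exact_Rdirect (sg := idfun) (sg' := idfun) (zE y) (zE y') (@sgE y) (@sgE y')
    (hz := h) (fun=> erefl) (@Y_flat y y' h)).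
  have e i := base_change_iso (phi := mres (Rdirect_along f E i) h)
    (phi1 := restr_res (hz := h) (sg := idfun) (sg' := idfun) (fun=> erefl) (Rdirect_along f E i))
    (u := @to_restr_id _ _) (v := @to_restr_id _ _) (fun=> erefl) (inv_bij (fun=> erefl))
    (inv_bij (fun=> erefl)).
  by split=> b i; apply/e; exact: b.
split=> [qc y y' h|ex i].
  by apply/D => i; have /quasi_coherentP := qc i; exact.
by apply/quasi_coherentP => y y' h; move: i; apply/D; exact: ex.
Qed.

Section Graph.
Variables (M : omod X) (E : inj_resolution M).

Let Z := rprod X Y.
Let pt (x : X) (y : Y) : Z := (x, y).

(** The graph pulls [U_(x, z)] back to [U_x /\ f^-1(U_z)], which explains [W = up x];
    [base_change_right] then replaces the scalars [O_x (x) O_z] by [O_z]. *)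
Lemma graph_right x y y' (h : (y <= y')%O) (hz : (pt x y <= pt x y')%O) :
  (forall i, base_change (mres (Rdirect_along (graph f) E i) hz)) <->
  forall n, rel_exact f h (up x) (res_cx E) n.
Proof.
have zE z p : (pt x z <= graph f p)%O = (p \in fib f (up x) z) by rewrite in_fib in_up.
pose sg z : {rmorphism stalk z -> stalk (pt x z)} := tens_inr (kmap x) (kmap z).
have sgE z p (hp : (pt x z <= graph f p)%O) (hy : (z <= f p)%O) a :
    rm_sharp (graph f) p (rres hp (sg z a)) = rm_sharp f p (rres hy a).
  rewrite [rres hp _]prod_res_pure [LHS]copair_pure !rmorph1 mul1r.
  by congr (rm_sharp f p (rres _ a)); exact: bool_irrelevance.
have sE a b : rres hz (algpure (kmap x) (kmap y) a b) = algpure (kmap x) (kmap y') a (rres h b).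
  rewrite [LHS]prod_res_pure rres_id.
  by congr (algpure _ _ _ (rres _ b)); exact: bool_irrelevance.
have sgh a : rres hz (sg y a) = sg y' (rres h a) by exact: sE.
rewrite -(rel_exact_Rdirect (zE y) (zE y') (@sgE y) (@sgE y') sgh (@Y_flat y y' h)).
have e i := base_change_right (fun c => esym (kmap_res h c)) sE
  (phi := mres (Rdirect_along (graph f) E i) hz)
  (phir := restr_res sgh (Rdirect_along (graph f) E i)) (fun=> erefl).
by split=> b i; apply/e; exact: b.
Qed.

(** With [y] fixed the roles are exchanged: the identity of [X] takes the place of [f], and the open
    set is [f^-1(U_y)]. *)
Lemma graph_left x x' y (h : (x <= x')%O) (hz : (pt x y <= pt x' y)%O) : flat (rres h) ->
  (forall n, rel_exact (rid X) h [set p | (y <= f p)%O] (res_cx E) n) ->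
  forall i, base_change (mres (Rdirect_along (graph f) E i) hz).
Proof.
move=> h_flat; set W := [set p | _].
have zE z p : (pt z y <= graph f p)%O = (p \in fib (rid X) W z).
  by rewrite in_fib inE andbC.
pose sg z : {rmorphism stalk z -> stalk (pt z y)} := tens_inl (kmap z) (kmap y).
have sgE z p (hp : (pt z y <= graph f p)%O) (hy : (z <= rid X p)%O) a :
    rm_sharp (graph f) p (rres hp (sg z a)) = rm_sharp (rid X) p (rres hy a).
  rewrite [rres hp _]prod_res_pure [LHS]copair_pure !rmorph1 mulr1.
  by congr (rm_sharp (rid X) p (rres _ a)); exact: bool_irrelevance.
have sE a b : rres hz (algpure (kmap x) (kmap y) a b) = algpure (kmap x') (kmap y) (rres h a) b.
  rewrite [LHS]prod_res_pure rres_id.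
  by congr (algpure _ _ (rres _ a) _); exact: bool_irrelevance.
have sgh a : rres hz (sg x a) = sg x' (rres h a) by exact: sE.
rewrite -(rel_exact_Rdirect (zE x) (zE x') (@sgE x) (@sgE x') sgh h_flat) => ex i.
exact: (base_change_left sE (phir := restr_res sgh (Rdirect_along (graph f) E i))
  (fun=> erefl) (ex i)).
Qed.
End Graph.
End Criteria.

Theorem theorem5p6 (k : comPzRingType) (X Y : rspace k)
    (hX : schematic_space X) (hY : finite_space Y) (f : rmor X Y) :
  schematic f <-> preserves_quasi_coherence f.
Proof.
have [X_flat diag] := hX; have resolution := @enough_injectives k X.
have oT := @openT k X.
split=> [graph_qc M qcM i|pres i].
  apply/Rdirect_qcP => I; move: i; apply/(Rdirect_qc_rel_exact _ hY) => y y' h n.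
  have h_flat : flat (rres h) by exact: hY.
  have [E] := resolution (struct_mod X).
  apply: (@rel_exact_local _ _ _ _ _ _ _ h_flat _ _ _ n (@res_cx_flasque _ _ _ I)
    (@res_cx_dd _ _ _ I _) oT (subxx _)) => x j _ _.
  apply: (@rel_exact_qc _ _ _ _ X_flat resolution _ _ _ h_flat _ E).
    have hz : ((x, y) <= (x, y') :> rprod X Y)%O by apply/andP; split.
    apply/(@graph_right _ _ _ f hY _ E x y y' h hz) => i.
    have /Rdirect_qcP/(_ E)/quasi_coherentP := graph_qc i; exact.
  by move=> p q hpq _ _; have /quasi_coherentP := qcM; exact.
apply/Rdirect_qcP => E.
(* The diagonal is the graph of the identity, so [graph_right] applies with [rid X] for [f]. *)
have diag_exact x p p' (h : (p <= p')%O) n : rel_exact (rid X) h (up x) (res_cx E) n.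
  have hz : ((x, p) <= (x, p') :> rprod X X)%O by apply/andP; split.
  move: n; apply/(@graph_right _ _ _ (rid X) X_flat _ E x p p' h hz) => j.
  have /Rdirect_qcP/(_ E)/quasi_coherentP := diag j; exact.
have f_exact x y y' (h : (y <= y')%O) n : rel_exact f h (up x) (res_cx E) n.
  have h_flat : flat (rres h) by exact: hY.
  apply/rel_exact_jstar.
  (* Sections over subsets of [X] have no cohomology in degrees above [#|X|], so at most [#|X|.+1]
     cohomology sheaves remain to be removed. *)
  apply: (@rel_exact_devissage _ _ _ _ resolution _ _ _ h_flat _ #|X|.+1).
  - move=> M I j qcM; have qc i' := (Rdirect_qcP f M i').1 (pres M qcM i') I.
    have H := (Rdirect_qc_rel_exact f hY I).1 qc; exact: H.
  - by apply: jstar_cx_flasque; [exact: up_open | exact: res_cx_flasque].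
  - move=> j p s; apply: (@jstar_cx_dd _ _ (up x) (res_cx E)); last exact: in_setT.
    exact: res_cx_dd.
  - by move=> q _; apply: jstar_Hsheaf_qc => //; exact: res_cx_dd.
  - move=> q Xq; apply: jstar_cx_exact => //; first exact: up_open.
    + exact: res_cx_flasque.
    + exact: res_cx_dd.
    + by move=> j; exact: res_cx_exact.
apply/quasi_coherentP => -[x y] [x' y'] h.
have hx : (x <= x')%O by exact: (prod_le1 h).
have hy : (y <= y')%O by exact: (prod_le2 h).
have h1 : ((x, y) <= (x', y) :> rprod X Y)%O by apply/andP; split.
have h2 : ((x', y) <= (x', y') :> rprod X Y)%O by apply/andP; split.
have comp m : mres (Rdirect_along (graph f) E i) h m = mres _ h2 (mres _ h1 m).
  exact/esym/mres_comp.
apply: (base_change_comp (fun a => esym (rres_comp h1 h2 h a)) comp).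
(* Relative exactness for the identity over [f^-1(U_y)] is local, and on each [up p] it is
   [diag_exact]. *)
- apply: (@graph_left _ _ _ f _ E x x' y hx h1) => [|n]; first exact: X_flat.
  apply: (@rel_exact_local _ _ _ _ _ _ _ (X_flat _ _ hx) [set: X]%SET _ _ n
    (@res_cx_flasque _ _ _ E) (@res_cx_dd _ _ _ E _)) => //.
  by move=> p q pq; rewrite !inE => yp; exact: le_trans yp (rm_le f pq).
- exact: ((@graph_right _ _ _ f hY _ E x' y y' hy h2).2 (f_exact x' y y' hy) i).
Qed.
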